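(* There exists an absolute constant $C_0>1$ such that the following holds. Let $v_0\in H^1(\mathbb{R}^3)$ with $\operatorname{div}v_0=0$, let $v\in C([0,T);H^1(\mathbb{R}^3))\cap C((0,T);C^\infty(\mathbb{R}^3))$ be the classical solution of the Navier-Stokes equations with initial data $v_0$, and let $\omega=\operatorname{curl}v$, $\omega_0=\operatorname{curl}v_0$. Then for all $\gamma\ge C_0$ and $t\in[0,T)$, $$\|\omega(t)\|_{L^2}\le\frac{\|\omega_0\|_{L^2}\exp\left[\frac{\gamma}{4}\int_0^t\|\omega(\tau)\|_{L^2}^4d\tau\right]}{\left\{1+(\gamma-C_0)\|\omega_0\|_{L^2}^4\int_0^t\exp\left[\gamma\int_0^\tau\|\omega(\sigma)\|_{L^2}^4d\sigma\right]d\tau\right\}^{1/4}}.$$ Moreover, for all $\gamma\ge C_0$ and all $t\in[0,T)$ with $C_0\|\omega_0\|_{L^2}^4t<1$, $$1+(\gamma-C_0)\|\omega_0\|_{L^2}^4\int_0^t\exp\left[\gamma\int_0^\tau\|\omega(\sigma)\|_{L^2}^4d\sigma\right]d\tau\le\frac{1}{\left(1-C_0\|\omega_0\|_{L^2}^4t\right)^{\frac{\gamma-C_0}{C_0}}}.$$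
   Context: The 3D Navier-Stokes equations (unit viscosity, no forcing) are $$\partial_t v+(v\cdot\nabla)v=\Delta v-\nabla p,\quad \operatorname{div}v=0\ \text{ in }\mathbb{R}^3\times(0,T),\qquad v(x,0)=v_0(x),$$ with scalar pressure $p$. *)

(* Defs.v *)
From HB Require Import structures.
From mathcomp Require Import all_boot all_order all_algebra.
From mathcomp Require Import all_classical all_reals all_analysis.

Set Implicit Arguments.
Unset Strict Implicit.
Unset Printing Implicit Defensive.
Import Order.TTheory GRing.Theory Num.Theory.
Import numFieldNormedType.Exports.

Local Open Scope classical_set_scope.
Local Open Scope ring_scope.

(* R^3 is an iterated product, so that the topology, the measurable structure
   and Lebesgue measure are those of the library. *)
Notation R3 R := (R * R * R)%type.

Definition leb3 (R : realType) : {measure set (R3 (measurableTypeR R)) -> \bar R} :=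
  ((@lebesgue_measure R \x @lebesgue_measure R) \x @lebesgue_measure R)%E.
Arguments leb3 R : clear implicits.

Definition e3 (R : realType) (i : 'I_3) : R3 R :=
  ((i == 0)%:R, (i == 1)%:R, (i == 2)%:R).

(* Vector fields on R^3, given by their three components. *)
Definition vfield (R : realType) := 'I_3 -> R3 R -> R.

Definition partial (R : realType) (i : 'I_3) (f : R3 R -> R) : R3 R -> R :=
  fun x => 'D_(e3 R i) f x.

Definition partials (R : realType) (s : seq 'I_3) (f : R3 R -> R) : R3 R -> R :=
  foldr (@partial R) f s.

Definition smooth (R : realType) (f : R3 R -> R) : Prop :=
  forall s : seq 'I_3, continuous (partials s f) /\
    forall i x, derivable (partials s f) x (e3 R i).

Definition test_function (R : realType) (f : R3 R -> R) : Prop :=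
  smooth f /\ exists2 K : set (R3 R), compact K & forall x, ~ K x -> f x = 0.

Definition L2 (R : realType) (f : R3 R -> R) : Prop :=
  f \in Lfun (leb3 R) 2%:E.

Definition is_weak_partial (R : realType) (i : 'I_3) (f g : R3 R -> R) : Prop :=
  forall phi, test_function phi ->
    (\int[leb3 R]_x (f x * partial i phi x) = - \int[leb3 R]_x (g x * phi x))%R.

Definition H1 (R : realType) (f : R3 R -> R) : Prop :=
  L2 f /\ forall i, exists2 g, L2 g & is_weak_partial i f g.

(* A representative of the weak derivative in L^2, unique up to null sets
   when it exists; the zero function otherwise. *)
Definition weak_partial (R : realType) (i : 'I_3) (f : R3 R -> R) : R3 R -> R :=
  xget (fun=> 0) [set g | L2 g /\ is_weak_partial i f g].

Definition weak_div (R : realType) (u : vfield R) : R3 R -> R :=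
  fun x => \sum_i weak_partial i (u i) x.

(* Indices are taken modulo 3. *)
Definition weak_curl (R : realType) (u : vfield R) : vfield R :=
  fun i x => weak_partial (i + 1) (u (i + 2)) x
           - weak_partial (i + 2) (u (i + 1)) x.

Definition L2norm (R : realType) (u : vfield R) : R :=
  fine ('N[leb3 R]_2%:E [(fun x => (Num.sqrt (\sum_i u i x ^+ 2))%:E)]).

Definition H1norm (R : realType) (u : vfield R) : R :=
  Num.sqrt (L2norm u ^+ 2 +
            \sum_j L2norm (fun i => weak_partial j (u i)) ^+ 2).

(* T is an extended real, so that solutions on [0, +oo) are covered. *)
Definition time_dom (R : realType) (T : \bar R) : set R :=
  [set t | 0 <= t /\ (t%:E < T)%E].

Definition time_int (R : realType) (T : \bar R) : set R :=
  [set t | 0 < t /\ (t%:E < T)%E].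

Definition continuous_H1 (R : realType) (T : \bar R) (v : R -> vfield R) :=
  (forall t i, time_dom T t -> H1 (v t i)) /\
  forall t, time_dom T t ->
    H1norm (fun i x => v s i x - v t i x) @[s --> within (time_dom T) (nbhs t)]
      --> (0 : R).

(* C^oo(R^3) carries its usual Frechet topology: uniform convergence on compact
   sets of all partial derivatives. *)
Definition continuous_smooth (R : realType) (T : \bar R) (v : R -> vfield R) :=
  (forall t i, time_int T t -> smooth (v t i)) /\
  forall t i (s : seq 'I_3), time_int T t ->
    {family compact, (fun tau => partials s (v tau i)) @ t
                       --> partials s (v t i)}.

(* The equations hold pointwise, and every term in them is continuous. *)
Definition navier_stokes (R : realType) (T : \bar R)
    (v : R -> vfield R) (p : R -> R3 R -> R) : Prop :=
  [/\ forall t x i, time_int T t -> derivable (fun s => v s i x) t 1,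
      forall t x i, time_int T t -> derivable (p t) x (e3 R i),
      forall t x i, time_int T t ->
        {for (t, x), continuous (fun z : R * R3 R => partial i (p z.1) z.2)},
      forall t x i, time_int T t ->
        'D_1 (fun s => v s i x) t + \sum_j v t j x * partial j (v t i) x
        = \sum_j partial j (partial j (v t i)) x - partial i (p t) x &
      forall t x, time_int T t -> \sum_i partial i (v t i) x = 0].

Definition classical_solution (R : realType) (T : \bar R)
    (v0 : vfield R) (v : R -> vfield R) : Prop :=
  [/\ continuous_H1 T v, continuous_smooth T v,
      exists p, navier_stokes T v p &
      forall i, {ae leb3 R, forall x, v 0 i x = v0 i x}].

(* Main.v *)
Require Import Defs.
From HB Require Import structures.
From mathcomp Require Import all_boot all_order all_algebra.
From mathcomp Require Import all_classical all_reals all_analysis.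
From mathcomp Require Import measurable_realfun ring lra.
Import Order.TTheory GRing.Theory Num.Theory.
Import numFieldNormedType.Exports.
Local Open Scope classical_set_scope.
Local Open Scope ring_scope.
Set Implicit Arguments.
Unset Strict Implicit.
Unset Printing Implicit Defensive.

(* On each ball the vorticity Om_ab = d_a v_b - d_b v_a is cut off by the fourth
   power of eta(x / r); testing the difference of the equation at two times
   against eta^4 (Om(t) + Om(s)) removes the pressure by curl-freeness and gives
   d/dt int eta^4 Om^2 = 2 int eta^4 Om Q, where Q collects dissipation,
   transport and stretching.  With g = eta^2 Om, the stretching is bounded by
   Hoelder in L^4 x L^4 x L^2 and the inequality
   ||g||_4^4 <= 4 ||g||_2 ||grad g||_2^3, which the dissipation absorbs up to
   C w^6, w = ||omega||_2; the terms containing derivatives of eta are O(1/r).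
   Letting r go to infinity, w(t)^2 - w(s)^2 <= (C0/2) (t - s) sup w^6.

   With I(t) = int_0^t w^4 and D(t) the bracket of the statement, this makes
   w^4 exp(-C0 I) D - w(0)^4 exp((gamma - C0) I) nonincreasing, which is the first
   bound.  For gamma = C0 it reads w^4 <= w(0)^4 exp(C0 I), hence
   exp(-C0 I) >= 1 - C0 w(0)^4 t, and integrating D' = (gamma - C0) w(0)^4 exp(gamma I)
   against this yields the second. *)

(** At each time v is smooth and in H^1, but no decay of its higher derivatives or of the pressure
    is given; every integration by parts therefore passes through a compactly supported factor. The
    power eta^4 is chosen so that both vorticity factors of the stretching term become g = eta^2 Om,
    the function whose gradient the dissipation controls.

    The third factor of the stretching term is grad v, not Om. Its L^2 norm is bounded by w because
    |grad v|^2 - |Om|^2 / 2, with |Om|^2 summed over all (a, b), is a divergence when div v = 0;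
    this is [gradient_bound].

    Origin of C0: the 27 triples (a, b, j) carry two stretching terms each. Each of these 54 terms
    is at most A / 216 + 8 216^3 w^6, where A is the total dissipation. Together they use A / 4, and
    the transport errors use at most A / 2 once |grad eta| <= 1 / 108. What remains is 54 8 216^3 =
    432 216^3 = C0 / 2. The factor 2 from differentiating a square is offset by the double count in
    sum_ab ||Om_ab||^2 = 2 w^2. *)

(** * Measurability, cubes and compact support in R^3 *)

Lemma open_R3_measurable (R : realType) (U : set (R3 R)) : open U ->
  measurable (U : set (R3 (measurableTypeR R))).
Proof.
move=> oU.
(* Rational centres and half-widths 1 / (n + 1) make the family of boxes countable, so that open
   sets of the product topology belong to the product sigma-algebra. *)
pose box (q : rat * rat * rat * nat) : set (R3 R) :=
  (ball (ratr q.1.1.1 : R) (q.2.+1%:R^-1) `*` ball (ratr q.1.1.2 : R) (q.2.+1%:R^-1)) `*` ball (ratr q.1.2 : R) (q.2.+1%:R^-1).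
have -> : U = \bigcup_(q : rat * rat * rat * nat)
    (if `[< box q `<=` U >] then box q else set0).
  apply/seteqP; split => [x Ux|x [q _]]; last by case: ifPn => // /asboolP; apply.
  have /nbhs_ballP[e /= e0 eU] : nbhs x U by rewrite nbhsE/=; exists U.
  have [n ne] : exists n : nat, n.+1%:R^-1 < e / 2.
    have := @near_infty_natSinv_lt R (PosNum (divr_gt0 e0 (ltr0Sn _ 1))).
    by move=> [n _ /(_ n (leqnn n))]; exists n.
  have n0 : (0 : R) < n.+1%:R^-1 by rewrite invr_gt0 ltr0n.
  have dr (y : R) : exists q : rat, ball (ratr q : R) (n.+1%:R^-1) y.
    have := @dense_rat R (ball y (n.+1%:R^-1)).
    move=> []; [by exists y; exact: ballxx|exact: ball_open|].
    by move=> z [yz [q _ qz]]; exists q; apply: ball_sym; rewrite qz.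
  have [q1 h1] := dr x.1.1; have [q2 h2] := dr x.1.2; have [q3 h3] := dr x.2.
  exists (q1, q2, q3, n) => //; rewrite ifT; first by split => //; split.
  apply/asboolP => y [[y1 y2] y3]; apply: eU.
  have st (a b c : R) : ball b (n.+1%:R^-1) a -> ball b (n.+1%:R^-1) c -> ball a e c.
    move=> ba bc; apply: (@le_ball _ _ _ (n.+1%:R^-1 + n.+1%:R^-1)).
      by rewrite (splitr e) lerD// ltW.
    by apply: ball_triangle bc; exact: ball_sym.
  by split; [split|]; apply: st; eassumption.
apply: countable_bigcupT_measurable => [|q]; first exact: countableP.
by case: ifPn => // _; do !apply: measurableX; rewrite ball_itv.
Qed.

Lemma continuous_R3_measurable (R : realType) (f : R3 R -> R) : continuous f ->
  measurable_fun setT (f : R3 (measurableTypeR R) -> R).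
Proof.
move=> cf.
apply: (measurability _ (measurable_realfun.RGenOpens.measurableE R)).
move=> _ [_ [a [b ->] <-]]; rewrite setTI.
apply: open_R3_measurable.
by apply: open_comp => // x _; exact: cf.
Qed.

Section r3.
Variable R : realType.
Local Notation mu := (leb3 R).
Local Notation lam := (@lebesgue_measure R).
Definition cube (r : R) : set (R3 R) := (`[-r, r] `*` `[-r, r]) `*` `[-r, r].

(** Vanishing off a cube stands for compact support: two such bounds combine by the larger radius,
    the measure of the cube is explicit, and a coordinate line leaves the cube at a known
    distance. *)
Definition csupp (f : R3 R -> R) := exists r : R, forall x, ~ cube r x -> f x = 0.

Lemma cube_compact r : compact (cube r).
Proof. by do !apply: compact_setX; exact: segment_compact. Qed.

Lemma leb3_prod (A B C : set R) : measurable A -> measurable B -> measurable C ->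
  mu ((A `*` B) `*` C) = (lam A * lam B * lam C)%E.
Proof.
move=> mA mB mC.
have h : mu ((A `*` B) `*` C) = ((lam \x lam)%E (A `*` B) * lam C)%E.
  by apply: product_measure1E => //; exact: measurableX.
by rewrite h product_measure1E.
Qed.

Lemma cube_measurable r : measurable (cube r : set (R3 (measurableTypeR R))).
Proof. by do !apply: measurableX. Qed.

Lemma leb3_cube r : (mu (cube r) < +oo)%E.
Proof.
rewrite leb3_prod//= !lebesgue_measure_itv/=; case: ifP => _; rewrite ?mule0//.
by rewrite -!EFinD -!EFinM ltry.
Qed.

Lemma compact_csupp (f : R3 R -> R) (K : set (R3 R)) : compact K ->
  (forall x, ~ K x -> f x = 0) -> csupp f.
Proof.
move=> /compact_bounded[M [Mr MK]] f0.
exists (`|M| + 1) => x nx; apply: f0 => Kx; apply: nx.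
have := MK (`|M| + 1) _ _ Kx; rewrite (le_lt_trans (ler_norm M)) ?ltrDl// => /(_ isT).
rewrite /= [X in X <= _]prod_normE/= ge_max [X in (X <= _) && _]prod_normE ge_max => /andP[/andP[h1 h2] h3].
by split; [split|]; rewrite /= in_itv/= -ler_norml.
Qed.

Lemma csupp_compact (f : R3 R -> R) : csupp f ->
  exists2 K : set (R3 R), compact K & forall x, ~ K x -> f x = 0.
Proof. by move=> [r fr]; exists (cube r) => //; exact: cube_compact. Qed.

Lemma continuous_cube_bounded (f : R3 R -> R) (r : R) : continuous f ->
  exists2 M : R, 0 < M & forall x, cube r x -> `|f x| <= M.
Proof.
move=> cf; have : compact (f @` cube r).
  by apply: continuous_compact; [exact: continuous_subspaceT|exact: cube_compact].
move=> /compact_bounded[M [Mr MK]]; exists (`|M| + 1); first by rewrite ltr_wpDl.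
move=> x cx; apply: (MK (`|M| + 1)); last by exists x.
by rewrite (le_lt_trans (ler_norm M)) ?ltrDl.
Qed.

Lemma csupp_bounded (f : R3 R -> R) : continuous f -> csupp f ->
  exists2 M : R, 0 < M & forall x, `|f x| <= M.
Proof.
move=> cf [r fr]; have [M M0 fM] := continuous_cube_bounded r cf.
exists M => // x; have [|n] := pselect (cube r x); first exact: fM.
by rewrite fr// normr0 ltW.
Qed.

Lemma integrable_cube_cst (r : R) (M : R) : mu.-integrable (cube r) (cst M%:E).
Proof.
apply/integrableP; split; first exact: measurable_cst.
rewrite integral_cst; last exact: cube_measurable.
by rewrite lte_mul_pinfty//=; exact: leb3_cube.
Qed.

Lemma integrable_cc (f : R3 R -> R) : continuous f -> csupp f ->
  mu.-integrable setT (EFin \o f).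
Proof.
move=> cf [r fr]; have [M M0 fM] := continuous_cube_bounded r cf.
have mf := continuous_R3_measurable cf; move/measurable_EFinP in mf.
have mcb := cube_measurable r.
have fE : EFin \o f = (EFin \o f) \_ (cube r).
  apply/funext => x; rewrite patchE; case: ifPn => //; rewrite notin_setE.
  by move=> /fr /= ->.
rewrite fE -integrable_restrict//; rewrite setTI.
apply: (le_integrable _ _ _ (integrable_cube_cst r M)) => //.
- exact: measurable_funS mf.
- by move=> x cx; rewrite /= lee_fin [leRHS]ger0_norm ?(ltW M0)// fM.
Qed.

End r3.

(** * Partial derivatives *)

Section calculus.
Variable R : realType.
Implicit Types (f g : R3 R -> R) (x : R3 R) (i j : 'I_3).

(** Unlike [smooth], which quantifies over words of indices, this recursion peels off the innermost
    derivative and grades by the order, so that closure under sums and products goes by induction.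
    Only derivatives along the axes enter. *)
Fixpoint Ck n f : Prop := continuous f /\
  if n is m.+1 then forall i, (forall x, derivable f x (e3 R i)) /\ Ck m (partial i f)
  else True.

Lemma Ck_cont n f : Ck n f -> continuous f.
Proof. by case: n => [|n] []. Qed.

Lemma CkS n f : Ck n.+1 f -> Ck n f.
Proof.
elim: n f => [|n IH] f [cf df]; split => // i.
by have [? ?] := df i; split => //; exact: IH.
Qed.

Lemma Ck_partial n f i : Ck n.+1 f -> Ck n (partial i f).
Proof. by move=> [_ /(_ i)[]]. Qed.

Lemma Ck_derivable n f i x : Ck n.+1 f -> derivable f x (e3 R i).
Proof. by move=> [_ /(_ i)[]]. Qed.

Lemma smooth_Ck f n : smooth f -> Ck n f.
Proof.
elim: n f => [|n IH] f sf; have [cf df] := sf [::]; split => // i.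
split => [x|]; first exact: df.
by apply: IH => s; have := sf (rcons s i); rewrite /partials foldr_rcons.
Qed.

Lemma Ck_smooth f : (forall n, Ck n f) -> smooth f.
Proof.
move=> Cf s; elim/last_ind: s f Cf => [|s i IH] f Cf.
  by split; [exact: Ck_cont (Cf 0%N)|move=> i x; exact: Ck_derivable (Cf 1%N)].
rewrite /partials foldr_rcons; apply: IH => n; exact: Ck_partial.
Qed.

Lemma partialD f g i x : derivable f x (e3 R i) -> derivable g x (e3 R i) ->
  partial i (fun y => f y + g y) x = partial i f x + partial i g x.
Proof. by move=> df dg; rewrite /partial -deriveD. Qed.

Lemma partialB f g i x : derivable f x (e3 R i) -> derivable g x (e3 R i) ->
  partial i (fun y => f y - g y) x = partial i f x - partial i g x.
Proof. by move=> df dg; rewrite /partial -deriveB. Qed.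

Lemma partialM f g i x : derivable f x (e3 R i) -> derivable g x (e3 R i) ->
  partial i (fun y => f y * g y) x = f x * partial i g x + g x * partial i f x.
Proof. by move=> df dg; exact: deriveM df dg. Qed.

Lemma partialcst c i x : partial i (fun=> c) x = 0.
Proof. by rewrite /partial derive_cst. Qed.

Lemma Ck_cst n c : Ck n (fun=> c).
Proof.
elim: n c => [|n IH] c; split => //; try by move=> x; exact: cst_continuous.
move=> i; split => [x|]; first exact: derivable_cst.
by rewrite (_ : partial i _ = fun=> 0) //; apply/funext => x; rewrite partialcst.
Qed.

Lemma CkD n f g : Ck n f -> Ck n g -> Ck n (fun x => f x + g x).
Proof.
elim: n f g => [|n IH] f g Cf Cg; split => //;
  try by move=> x; apply: continuousD; apply: Ck_cont; eassumption.
move=> i; split => [x|].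
  by apply: derivableD; apply: Ck_derivable; eassumption.
rewrite (_ : partial i _ = fun x => partial i f x + partial i g x).
  by apply: IH; exact: Ck_partial.
by apply/funext => x; apply: partialD; apply: Ck_derivable; eassumption.
Qed.

Lemma CkM n f g : Ck n f -> Ck n g -> Ck n (fun x => f x * g x).
Proof.
elim: n f g => [|n IH] f g Cf Cg; split => //;
  try by move=> x; apply: continuousM; apply: Ck_cont; eassumption.
move=> i; split => [x|].
  by apply: derivableM; apply: Ck_derivable; eassumption.
rewrite (_ : partial i _ = fun x => f x * partial i g x + g x * partial i f x).
  by apply: CkD; apply: IH; do 1?[exact: CkS]; exact: Ck_partial.
by apply/funext => x; apply: partialM; apply: Ck_derivable; eassumption.
Qed.

Lemma CkN n f : Ck n f -> Ck n (fun x => - f x).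
Proof.
move=> Cf; rewrite (_ : (fun x => - f x) = fun x => (-1) * f x).
  by apply: CkM => //; exact: Ck_cst.
by apply/funext => x; rewrite mulN1r.
Qed.

Lemma CkB n f g : Ck n f -> Ck n g -> Ck n (fun x => f x - g x).
Proof. by move=> Cf Cg; apply: CkD => //; exact: CkN. Qed.

Lemma Ck_sum n m (F : 'I_m -> R3 R -> R) : (forall k, Ck n (F k)) ->
  Ck n (fun x => \sum_j F j x).
Proof.
elim: m F => [|m IH] F CF.
  by under eq_fun do rewrite big_ord0; exact: Ck_cst.
by under eq_fun do rewrite big_ord_recr/=; apply: CkD => //; exact: IH.
Qed.

Lemma partial_sum m (F : 'I_m -> R3 R -> R) i x :
  (forall k, derivable (F k) x (e3 R i)) ->
  partial i (fun x => \sum_j F j x) x = \sum_j partial i (F j) x.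
Proof.
move=> dF; rewrite /partial -derive_sum//; congr ('D__ _ _).
by apply/funext => y; rewrite fct_sumE.
Qed.

(** The line through [x] in direction [i] is parametrized by the coordinate itself and not by the
    displacement from [x], so that integrals over [t] are exactly the inner integrals of Fubini's
    theorem. *)
Definition upd i x (t : R) : R3 R :=
  (if i == 0 then t else x.1.1, if i == 1 then t else x.1.2, if i == 2 then t else x.2).

Lemma updD i x t s : upd i x (s + t) = s *: e3 R i + upd i x t.
Proof.
by case: i => -[|[|[|//]]] ?; rewrite /upd /e3/=;
  congr (_, _, _); rewrite /= ?mulr1n ?mulr0n ?scaler1 ?scaler0 ?add0r.
Qed.

Lemma is_derive_upd f i x t : derivable f (upd i x t) (e3 R i) ->
  is_derive t 1 (fun s => f (upd i x s)) (partial i f (upd i x t)).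
Proof.
move=> df.
have E : (fun h : R => h^-1 *: (f (upd i x (h *: 1 + t)) - f (upd i x t))) =
  (fun h : R => h^-1 *: (f (h *: e3 R i + upd i x t) - f (upd i x t))).
  by apply/funext => h; rewrite scaler1 updD.
apply: DeriveDef; last by rewrite /partial /derive/= E.
by move: df; rewrite /derivable /= E.
Qed.

Lemma upd_continuous i x : continuous (upd i x).
Proof.
move=> t; rewrite /upd.
have c b (c : R) : (if b then s else c) @[s --> t] --> (if b then t else c).
  by case: b; [exact: cvg_id|exact: cvg_cst].
exact: (cvg_pair (cvg_pair (c _ _) (c _ _)) (c _ _)).
Qed.

Definition crd i x : R := if i == 0 then x.1.1 else if i == 1 then x.1.2 else x.2.

Lemma upd_crd i x : upd i x (crd i x) = x.
Proof. by case: i => -[|[|[|//]]] ?; case: x => -[]. Qed.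

End calculus.

(* Naming the planar measure lets its sigma-finiteness be inferred, as the
   product-measure lemmas for leb3 require. *)
Definition leb2 (R : realType) : set (measurableTypeR R * measurableTypeR R)%type -> \bar R :=
  (@lebesgue_measure R \x @lebesgue_measure R)%E.

HB.instance Definition _ (R : realType) := Measure.copy (@leb2 R)
  (@lebesgue_measure R \x @lebesgue_measure R)%E.

Lemma sigma_finite_leb2 (R : realType) : sigma_finite setT (@leb2 R).
Proof.
exists (fun n => `[- n%:R, n%:R] `*` `[- n%:R, n%:R]).
  apply/seteqP; split=> [[x y] _|//]; exists (Num.trunc (`|x| + `|y|)).+1 => //.
  have h : `|x| + `|y| < (Num.trunc (`|x| + `|y|)).+1%:R by exact: truncnS_gt.
  split; rewrite /= in_itv/= -ler_norml (le_trans _ (ltW h))//.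
    by rewrite lerDl.
  by rewrite lerDr.
move=> n; split; first exact: measurableX.
pose B : set R := `[- n%:R, n%:R]%classic.
have -> : leb2 (B `*` B) = (lebesgue_measure B * lebesgue_measure B)%E.
  by apply: (product_measure1E (@lebesgue_measure R) (@lebesgue_measure R)); exact: measurable_itv.
rewrite !lebesgue_measure_itv/=; case: ifP => _; rewrite ?mule0//.
by rewrite -EFinD -EFinM ltry.
Qed.

HB.instance Definition _ (R : realType) := Measure_isSigmaFinite.Build _ _ _ (@leb2 R)
  (@sigma_finite_leb2 R).

(** * Fubini on R^3 and vanishing integrals of derivatives *)

Section ibp.
Variable R : realType.
Local Notation mu := (leb3 R).
Local Notation lam := (@lebesgue_measure R).
Implicit Types (f g : R3 R -> R) (i j : 'I_3).

Local Notation lam2 := (@leb2 R).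

Lemma leb3_tonelli1 (f : R3 (measurableTypeR R) -> \bar R) : measurable_fun setT f ->
  (forall x, 0 <= f x)%E ->
  (\int[mu]_x f x = \int[lam2]_x \int[lam]_y f (x, y))%E.
Proof. by move=> mf f0; exact: (@fubini_tonelli1 _ _ _ _ R lam2 lam f mf f0). Qed.

Lemma leb3_tonelli2 (f : R3 (measurableTypeR R) -> \bar R) : measurable_fun setT f ->
  (forall x, 0 <= f x)%E ->
  (\int[mu]_x f x = \int[lam]_y \int[lam2]_x f (x, y))%E.
Proof. by move=> mf f0; exact: (@fubini_tonelli2 _ _ _ _ R lam2 lam f mf f0). Qed.

Lemma leb3_fubini1 (f : R3 (measurableTypeR R) -> \bar R) : mu.-integrable setT f ->
  (\int[mu]_x f x = \int[lam2]_x \int[lam]_y f (x, y))%E.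
Proof. by move=> mf; symmetry; exact: (@integral12_prod_meas1 _ _ _ _ R lam2 lam f mf). Qed.

Lemma leb3_fubini2 (f : R3 (measurableTypeR R) -> \bar R) : mu.-integrable setT f ->
  (\int[mu]_x f x = \int[lam]_y \int[lam2]_x f (x, y))%E.
Proof. by move=> mf; symmetry; exact: (@integral21_prod_meas1 _ _ _ _ R lam2 lam f mf). Qed.

(** Slices of an integrable function are integrable only for almost every [y]; the hypothesis may
    therefore use the integrability of the slice, which a second application of Fubini inside the
    slice needs. *)
Lemma leb3_fubini_eq0 (f : R3 (measurableTypeR R) -> \bar R) : mu.-integrable setT f ->
  (forall y : measurableTypeR R, lam2.-integrable setT (fun x : (measurableTypeR R * measurableTypeR R)%type => f (x, y)) ->
     \int[lam2]_x f (x, y) = 0)%E ->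
  (\int[mu]_x f x = 0)%E.
Proof.
move=> fi h; rewrite leb3_fubini2//.
rewrite (ae_eq_integral (cst 0%E))//; first by rewrite integral0.
  exact: (@measurable_fubini_G _ _ _ _ R lam2 lam f fi).
have := @ae_integrable2 _ _ _ _ R lam2 lam f fi.
by apply: filterS => y /h.
Qed.

Lemma FTC_zero (g dg : R -> R) (r : R) : (forall t : R, is_derive t 1 g (dg t)) ->
  continuous dg -> (forall t : R, r < `|t| -> g t = 0) ->
  (\int[lam]_t (dg t)%:E = 0)%E.
Proof.
move=> gd cdg g0.
have gc : continuous g.
  by move=> t; apply: differentiable_continuous; apply/derivable1_diffP; case: (gd t).
(* Since [r] may be negative, |r| + 1 is taken: it is positive and exceeds [r], so [g] vanishes at
   both endpoints. *)
pose s : R := `|r| + 1.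
have rs : r < s by rewrite (le_lt_trans (ler_norm r))// ltrDl.
have s0 : 0 < s by rewrite ltr_wpDl.
have dg0 t : r < `|t| -> dg t = 0.
  move=> rt; have [_ <-] := gd t.
  rewrite (@near_eq_derive _ _ _ _ (cst 0))//; first exact: derive_cst.
  have : \forall u \near t, r < `|u|.
    have : continuous (fun u : R => `|u|) by exact: norm_continuous.
    by move=> /(_ t) /(cvgr_gt _); apply.
  by apply: filterS => u /g0.
have -> : (\int[lam]_t (dg t)%:E = \int[lam]_(t in `[(- s)%R, s%R]) (dg t)%:E)%E.
  rewrite [RHS]integral_mkcond; apply: eq_integral => t _.
  rewrite patchE; case: ifPn => //; rewrite notin_setE/= in_itv/= -ler_norml => /negP.
  by rewrite -ltNge => st; rewrite dg0// (lt_trans rs).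
rewrite (@continuous_FTC2 _ _ g)//.
- by rewrite !g0 ?normrN ?(gtr0_norm s0)// sube0.
- lra.
- exact: continuous_subspaceT.
- split; [by move=> t _; case: (gd t)|apply: cvg_at_right_filter; exact: gc|apply: cvg_at_left_filter; exact: gc].
- by move=> t _; rewrite derive1E; have [_ ->] := gd t.
Qed.

Lemma cube_closed (r : R) : closed (cube r).
Proof. apply: compact_closed; [exact: norm_hausdorff|exact: cube_compact]. Qed.

Lemma partial_out f i (r : R) x : (forall x, ~ cube r x -> f x = 0) -> ~ cube r x ->
  partial i f x = 0.
Proof.
move=> f0 nx; rewrite /partial (@near_eq_derive _ _ _ _ (cst 0))//; first exact: derive_cst.
have : \forall y \near x, (~` cube r) y.
  by apply: open_nbhs_nbhs; split => //; rewrite openC; exact: cube_closed.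
by apply: filterS => y /f0.
Qed.

Lemma csupp_partial f i : csupp f -> csupp (partial i f).
Proof. by move=> [r fr]; exists r => x; exact: partial_out. Qed.

Lemma csuppM f g : csupp f -> csupp (fun x => f x * g x).
Proof. by move=> [r fr]; exists r => x /fr ->; rewrite mul0r. Qed.

Lemma csuppMr f g : csupp g -> csupp (fun x => f x * g x).
Proof. by move=> [r fr]; exists r => x /fr ->; rewrite mulr0. Qed.

Lemma cube_le (r s : R) : r <= s -> cube r `<=` cube s.
Proof.
move=> rs x [[h1 h2] h3]; move: h1 h2 h3; rewrite /= !in_itv/= -!ler_norml => h1 h2 h3.
by split; [split|]; rewrite /= !in_itv/= -!ler_norml (le_trans _ rs).
Qed.

Lemma csuppD f g : csupp f -> csupp g -> csupp (fun x => f x + g x).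
Proof.
move=> [r fr] [s gs]; exists (Num.max r s) => x nx.
rewrite fr ?gs ?addr0// => cx; apply: nx; apply: cube_le cx; by rewrite le_max lexx ?orbT.
Qed.

Lemma csuppN f : csupp f -> csupp (fun x => - f x).
Proof. by move=> [r fr]; exists r => x /fr ->; rewrite oppr0. Qed.

Lemma crd_cube i (r : R) x : cube r x -> `|crd i x| <= r.
Proof.
by case: i => -[|[|[|//]]] ? [[]]; rewrite /crd/= !in_itv/= -!ler_norml.
Qed.

Lemma crd_upd i (x : R3 R) t : crd i (upd i x t) = t.
Proof. by case: i => -[|[|[|//]]]. Qed.

Lemma line_integral_partial f i (x : R3 R) : csupp f -> continuous (partial i f) ->
  (forall y, derivable f y (e3 R i)) ->
  (\int[lam]_t (partial i f (upd i x t))%:E = 0)%E.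
Proof.
move=> [r fr] cf df; apply: (@FTC_zero (fun t => f (upd i x t)) _ r).
- by move=> t; exact: is_derive_upd.
- by move=> t; apply: continuous_comp; [exact: upd_continuous|exact: cf].
- move=> t rt; apply: fr => /(crd_cube i); rewrite crd_upd => /(lt_le_trans rt).
  by rewrite ltxx.
Qed.

(** Integrating first in direction [i], each line integral vanishes by the fundamental theorem of
    calculus. As [leb3] is an iterated product, the three directions call for three different orders
    of integration. *)
Lemma integral_partial f i : csupp f -> continuous (partial i f) ->
  (forall y, derivable f y (e3 R i)) ->
  \int[mu]_x partial i f x = 0.
Proof.
move=> sf cf df; have pi := integrable_cc cf (csupp_partial i sf).
have L x := line_integral_partial x sf cf df.
suff : (\int[mu]_x (partial i f x)%:E = 0)%E by rewrite /Rintegral => ->.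
case: i pi L {cf df} => -[|[|[|//]]] pi0 pi L.
- apply: leb3_fubini_eq0 => // z fz.
  rewrite -(@integral21_prod_meas1 _ _ _ _ R lam lam _ fz).
  apply: integral0_eq => y _; rewrite /fubini_G/=.
  exact: (L ((0, y), z)).
- apply: leb3_fubini_eq0 => // z fz.
  rewrite -(@integral12_prod_meas1 _ _ _ _ R lam lam _ fz).
  apply: integral0_eq => y _; rewrite /fubini_F/=.
  exact: (L ((y, 0), z)).
- rewrite leb3_fubini1//; apply: integral0_eq => -[y z] _.
  exact: (L ((y, z), 0)).
Qed.

End ibp.

(** * Symmetry of second derivatives *)

Section clairaut.
Variable R : realType.
Implicit Types (f g : R3 R -> R) (i j : 'I_3).

Lemma is_derive_line f (v y : R3 R) (s : R) : derivable f (y + s *: v) v ->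
  is_derive s 1 (fun t : R => f (y + t *: v)) ('D_v f (y + s *: v)).
Proof.
move=> df.
have E : (fun h : R => h^-1 *: (f (y + (h *: 1 + s) *: v) - f (y + s *: v))) =
  (fun h : R => h^-1 *: (f (h *: v + (y + s *: v)) - f (y + s *: v))).
  by apply/funext => h; rewrite scaler1 scalerDl addrCA.
apply: DeriveDef; last by rewrite /derive/= E.
by move: df; rewrite /derivable /= E.
Qed.

Lemma is_derive_cont (g dg : R -> R) : (forall t : R, is_derive t 1 g (dg t)) -> continuous g.
Proof.
by move=> gd t; apply: differentiable_continuous; apply/derivable1_diffP; case: (gd t).
Qed.

Lemma MVT0 (g dg : R -> R) (h : R) : 0 < h -> (forall t : R, is_derive t 1 g (dg t)) ->
  exists2 c : R, 0 < c < h & g h - g 0 = h * dg c.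
Proof.
move=> h0 gd; have [c ch E] := @MVT R g dg 0 h h0 (fun t _ => gd t)
  (continuous_subspaceT (is_derive_cont gd)).
by exists c; rewrite ?E ?subr0 1?mulrC//; move: ch; rewrite in_itv.
Qed.

(** The mean value theorem is applied twice: in direction [i] to the increment of [f] in direction
    [j], then in direction [j] to [partial i f]. The left side is symmetric in [i] and [j], which
    [clairaut] exploits. *)
Lemma second_difference f i j (x : R3 R) (h : R) : 0 < h -> Ck 2 f ->
  exists c d : R, [/\ 0 < c < h, 0 < d < h &
    f (x + h *: e3 R i + h *: e3 R j) - f (x + h *: e3 R i)
      - f (x + h *: e3 R j) + f x =
    h * (h * partial j (partial i f) (x + c *: e3 R i + d *: e3 R j))].
Proof.
move=> h0 Cf.
have d1 y k : derivable f y (e3 R k) by exact: Ck_derivable (CkS Cf).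
have d2 y k l : derivable (partial k f) y (e3 R l) by exact: Ck_derivable (Ck_partial k Cf).
pose g (s : R) := f (x + h *: e3 R j + s *: e3 R i) - f (x + s *: e3 R i).
pose dg (s : R) := partial i f (x + h *: e3 R j + s *: e3 R i) - partial i f (x + s *: e3 R i).
have gd (t : R) : is_derive t 1 g (dg t) by apply: is_deriveB; exact: is_derive_line.
have [c ch Ec] := MVT0 h0 gd.
pose k (s : R) := partial i f (x + c *: e3 R i + s *: e3 R j).
pose dk (s : R) := partial j (partial i f) (x + c *: e3 R i + s *: e3 R j).
have kd (t : R) : is_derive t 1 k (dk t) by exact: is_derive_line.
have [d dh Ed] := MVT0 h0 kd.
exists c, d; split => //; rewrite -[h * partial j _ _]Ed.
have -> : k h - k 0 = dg c by rewrite /k /dg scale0r addr0 addrAC.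
rewrite -Ec /g !scale0r !addr0 (addrAC x); ring.
Qed.

(** Both mixed derivatives equal the same second difference divided by h^2, at points that approach
    [x] as h tends to 0; their continuity identifies the two values at [x]. *)
Lemma clairaut f i j x : Ck 2 f -> partial i (partial j f) x = partial j (partial i f) x.
Proof.
move=> Cf; apply/eqP; rewrite -subr_eq0 -normr_eq0; apply/eqP/le_anti.
rewrite normr_ge0 andbT; apply/(@ler_addgt0Pl R) => e e0; rewrite addr0.
have nr k l : exists2 r : R, 0 < r & forall h, h < r -> forall c d : R, 0 < c < h -> 0 < d < h ->
   `|partial k (partial l f) x - partial k (partial l f) (x + c *: e3 R l + d *: e3 R k)| < e / 2.
  have := Ck_cont (Ck_partial k (Ck_partial l Cf)).
  move=> /(_ x)/cvgrPdist_lt/(_ (e / 2) (divr_gt0 e0 (ltr0Sn _ 1))).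
  move=> /nbhs_ballP[r /= r0 br].
  exists (r / 2) => [|h hr c d /andP[c0 ch] /andP[d0 dh]]; first exact: divr_gt0.
  have B (a b : bool) (u : R) : `|u - (u + c * a%:R + d * b%:R)| < r.
    rewrite -addrA opprD addNKr normrN.
    rewrite (le_lt_trans (ler_normD _ _))// !normrM (gtr0_norm c0) (gtr0_norm d0).
    by case: a; case: b; rewrite /= ?mulr1n ?mulr0n ?normr0 ?normr1; lra.
  by apply: br; split; [split|]; exact: B.
have [r1 r10 N1] := nr i j; have [r2 r20 N2] := nr j i.
have [h h0 /andP[hr1 hr2]] : exists2 h : R, 0 < h & (h < r1) && (h < r2).
  exists (Num.min r1 r2 / 2); first by rewrite divr_gt0// lt_min r10.
  have : Num.min r1 r2 / 2 < Num.min r1 r2 by rewrite ltr_pdivrMr// ltr_pMr ?ltr1n// lt_min r10.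
  by rewrite lt_min.
have [c [d [ch dh E1]]] := second_difference i j x h0 Cf.
have [c' [d' [ch' dh' E2]]] := second_difference j i x h0 Cf.
have E : partial j (partial i f) (x + c *: e3 R i + d *: e3 R j) =
   partial i (partial j f) (x + c' *: e3 R j + d' *: e3 R i).
  apply: (mulfI (lt0r_neq0 h0)); apply: (mulfI (lt0r_neq0 h0)).
  apply: (eq_trans (esym E1)); apply: (eq_trans _ E2).
  have -> : x + h *: e3 R i + h *: e3 R j = x + h *: e3 R j + h *: e3 R i by exact: addrAC.
  by congr (_ + _); exact: addrAC.
have := N1 h hr1 _ _ ch' dh'; have := N2 h hr2 _ _ ch dh; rewrite E.
move: (partial i (partial j f) x) (partial j (partial i f) x) (partial i _ _) => u v w.
move=> /ltW a /ltW b; rewrite [leRHS]splitr (_ : u - v = (u - w) - (v - w)); last by ring.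
exact: le_trans (ler_normB _ _) (lerD b a).
Qed.

End clairaut.

(** * Integral calculus for continuous compactly supported functions *)

Section integral_toolbox.
Variable R : realType.
Local Notation mu := (leb3 R).
Implicit Types (f g : R3 R -> R) (i j : 'I_3).

Definition cc f := continuous f /\ csupp f.

Lemma cc_integrable f : cc f -> mu.-integrable setT (EFin \o f).
Proof. by case; exact: integrable_cc. Qed.

Lemma ccD f g : cc f -> cc g -> cc (fun x => f x + g x).
Proof.
move=> [cf sf] [cg sg]; split; last exact: csuppD.
by move=> x; apply: continuousD; [exact: cf|exact: cg].
Qed.

Lemma ccMl f g : cc f -> continuous g -> cc (fun x => f x * g x).
Proof.
move=> [cf sf] cg; split; last exact: csuppM.
by move=> x; apply: continuousM; [exact: cf|exact: cg].
Qed.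

Lemma ccMr f g : continuous f -> cc g -> cc (fun x => f x * g x).
Proof.
move=> cf [cg sg]; split; last exact: csuppMr.
by move=> x; apply: continuousM; [exact: cf|exact: cg].
Qed.

Lemma ccN f : cc f -> cc (fun x => - f x).
Proof.
by move=> [cf sf]; split; [move=> x; apply: continuousN; exact: cf|exact: csuppN].
Qed.

Lemma ccB f g : cc f -> cc g -> cc (fun x => f x - g x).
Proof. by move=> cf cg; apply: ccD => //; exact: ccN. Qed.

Lemma ccZ c f : cc f -> cc (fun x => c * f x).
Proof. by move=> cf; apply: ccMr => // x; exact: cst_continuous. Qed.

Lemma cc0 : cc (fun=> 0 : R).
Proof. by split; [move=> x; exact: cst_continuous|exists 0]. Qed.

Lemma intD f g : cc f -> cc g ->
  \int[mu]_x (f x + g x) = \int[mu]_x f x + \int[mu]_x g x.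
Proof. by move=> cf cg; rewrite RintegralD//; exact: cc_integrable. Qed.

Lemma intB f g : cc f -> cc g ->
  \int[mu]_x (f x - g x) = \int[mu]_x f x - \int[mu]_x g x.
Proof. by move=> cf cg; rewrite RintegralB//; exact: cc_integrable. Qed.

Lemma intZ c f : cc f -> \int[mu]_x (c * f x) = c * \int[mu]_x f x.
Proof. by move=> cf; rewrite RintegralZl//; exact: cc_integrable. Qed.

Lemma intN f : cc f -> \int[mu]_x (- f x) = - \int[mu]_x f x.
Proof. by move=> cf; under eq_Rintegral do rewrite -mulN1r; rewrite intZ// mulN1r. Qed.

Lemma int_le f g : cc f -> cc g -> (forall x, f x <= g x) ->
  \int[mu]_x f x <= \int[mu]_x g x.
Proof. by move=> cf cg fg; apply: le_Rintegral => //; exact: cc_integrable. Qed.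

Lemma int_ge0 f : (forall x, 0 <= f x) -> 0 <= \int[mu]_x f x.
Proof. by move=> f0; apply: Rintegral_ge0. Qed.

Lemma cc_partial f i : csupp f -> Ck 1 f -> cc (partial i f).
Proof. by move=> sf Cf; split; [exact: Ck_cont (Ck_partial i Cf)|exact: csupp_partial]. Qed.

Lemma int_partial f i : csupp f -> Ck 1 f -> \int[mu]_x partial i f x = 0.
Proof.
move=> sf Cf; apply: integral_partial => //; first exact: Ck_cont (Ck_partial i Cf).
by move=> y; exact: Ck_derivable Cf.
Qed.

Lemma int_by_parts f g i : csupp g -> Ck 1 f -> Ck 1 g ->
  \int[mu]_x (f x * partial i g x) = - \int[mu]_x (partial i f x * g x).
Proof.
move=> sg Cf Cg; apply/eqP; rewrite -subr_eq0 opprK -intD; last 2 first.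
- by apply: ccMr; [exact: Ck_cont Cf|exact: cc_partial].
- by apply: ccMr; [exact: Ck_cont (Ck_partial i Cf)|split => //; exact: Ck_cont Cg].
have <- : \int[mu]_x partial i (fun y => f y * g y) x = 0.
  by apply: int_partial; [exact: csuppMr|exact: CkM].
apply/eqP; apply: eq_Rintegral => x _.
by rewrite partialM; [rewrite [g x * _]mulrC|exact: Ck_derivable Cf|exact: Ck_derivable Cg].
Qed.

End integral_toolbox.

(** * Smooth cutoff functions *)

Section bump1.
Variable R : realType.
Implicit Types p : {poly R}.

Lemma cvg_seq_comp (G : R -> R) (s : nat -> R) (l : R) : continuous_at l G ->
  s @ \oo --> l -> G (s n) @[n --> \oo] --> G l.
Proof. exact: continuous_cvg. Qed.

(* Closed under differentiation, with p replaced by X^2 (p - p'), so that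
   bump1 is smooth across 0. *)
Definition Fexp p (x : R) : R := if 0 < x then p.[x^-1] * expR (- x^-1) else 0.

(** With u = 1/x, the exponential series gives e^u >= u^(i+2) / (i+2)!, so that u^i e^(-u) <= (i+2)!
    x^2 for each monomial of [p]. Quadratic decay is what makes the derivative at 0 exist and
    vanish. *)
Lemma Fexp_bound p : exists2 C : R, 0 < C & forall x : R, `|Fexp p x| <= C * x ^+ 2.
Proof.
exists (1 + \sum_(i < size p) `|p`_i| * (i.+2)`!%:R).
  by rewrite ltr_pwDl// sumr_ge0// => i _; rewrite mulr_ge0.
move=> x; rewrite /Fexp; case: ifPn => x0; last first.
  by rewrite normr0 mulr_ge0 ?sqr_ge0// addr_ge0// sumr_ge0// => i _; rewrite mulr_ge0.
have u0 : 0 < x^-1 by rewrite invr_gt0.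
rewrite horner_coef normrM (ger0_norm (expR_ge0 _)) mulrDl mul1r.
apply: (@le_trans _ _ ((\sum_(i < size p) `|p`_i| * (i.+2)`!%:R) * x ^+ 2)); last by rewrite lerDr sqr_ge0.
rewrite (le_trans (ler_wpM2r (expR_ge0 _) (ler_norm_sum _ _ _)))//.
rewrite !mulr_suml; apply: ler_sum => i _.
rewrite normrM -!mulrA ler_wpM2l// (ger0_norm (exprn_ge0 _ (ltW u0))).
have h : x^-1 ^+ i.+2 / (i.+2)`!%:R <= expR x^-1.
  by rewrite (le_trans _ (expR_ge1Dxn i.+1 (ltW u0)))// lerDr.
rewrite expRN ler_pdivrMr ?expR_gt0//.
have f0 : 0 < (i.+2)`!%:R :> R by rewrite ltr0n fact_gt0.
rewrite ler_pdivrMr// in h.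
have -> : x^-1 ^+ i = x ^+ 2 * x^-1 ^+ i.+2.
  by rewrite -(addn2 i) exprD mulrCA -exprMn divff ?gt_eqF// expr1n mulr1.
by rewrite -[leRHS]mulrA [leRHS]mulrCA; apply: ler_wpM2l; rewrite ?sqr_ge0// mulrC.
Qed.

Definition dFexp p := ('X ^+ 2 * (p - p^`()))%R.

Lemma is_derive_Fexp p (x : R) : is_derive x 1 (Fexp p) (Fexp (dFexp p) x).
Proof.
have [x0|x0|x0] := ltgtP x 0.
- have -> : Fexp (dFexp p) x = 0 by rewrite /Fexp ltNge (ltW x0).
  have N : \near x, cst 0 x = Fexp p x.
    near=> y; rewrite /Fexp ltNge (_ : y <= 0 = true)//.
    by apply/ltW; near: y; exact: (cvgr_lt x (@cvg_id _ (nbhs x))).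
  exact: near_eq_is_derive N (is_derive_cst (0 : R) x 1).
- have -> : Fexp (dFexp p) x = (dFexp p).[x^-1] * expR (- x^-1) by rewrite /Fexp x0.
  apply: (@near_eq_is_derive _ _ _ (fun y : R => p.[y^-1] * expR (- y^-1))).
    near=> y; rewrite /Fexp (_ : 0 < y = true)//.
    by near: y; exact: (cvgr_gt x (@cvg_id _ (nbhs x))).
  have xn0 : x != 0 by rewrite gt_eqF.
  have dV : is_derive x (1 : R) (fun y : R => y^-1) (- x ^- 2).
    have := @is_deriveV R id x 1 1 xn0 (is_derive_id _ _).
    by rewrite scaler1.
  have d1 := is_derive1_comp (is_derive_poly p x^-1) dV.
  have dVN : is_derive x (1 : R) (fun y : R => - y^-1) (x ^- 2).
    by have := is_deriveN dV; rewrite opprK.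
  have d2 := @is_derive1_comp R expR (fun y : R => - y^-1) x _ _ (is_derive_expR _) dVN.
  apply: (@is_derive_eq _ _ _ ((horner p \o GRing.inv) * (expR \o (fun y : R => - y^-1))) _ _ _ _ (is_deriveM d1 d2)).
  by rewrite /dFexp hornerM hornerXn hornerD hornerN /= /GRing.scale/= exprVn; ring.
- rewrite x0 {2}/Fexp ltxx.
  have [C C0 FC] := Fexp_bound p.
  have F0 : Fexp p 0 = 0 by rewrite /Fexp ltxx.
  have L : h^-1 *: (Fexp p (h *: 1 + 0) - Fexp p 0) @[h --> (0 : R)^'] --> (0 : R).
    apply/cvgr0Pnorm_le => e e0.
    near=> h.
    have hn0 : h != 0 by near: h; exact: nbhs_dnbhs_neq.
    rewrite F0 subr0 addr0 scaler1 normrM normfV.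
    rewrite ler_pdivrMl ?normr_gt0// (le_trans (FC h))//.
    rewrite -real_normK ?num_real// expr2 mulrA [leRHS]mulrC ler_wpM2r//.
    rewrite -ler_pdivlMl//.
    near: h; apply: dnbhs0_le; by rewrite mulr_gt0// invr_gt0.
  apply: DeriveDef; first by apply/cvg_ex; exists 0.
  exact/cvg_lim.
Unshelve. all: by end_near. Qed.

Lemma Fexp_continuous p : continuous (Fexp p).
Proof. exact: is_derive_cont (is_derive_Fexp p). Qed.

Definition bump1 (x : R) := Fexp 1 x.

Lemma bump1E (x : R) : 0 < x -> bump1 x = expR (- x^-1).
Proof. by move=> x0; rewrite /bump1 /Fexp x0 hornerC mul1r. Qed.

Lemma bump1_le0 (x : R) : x <= 0 -> bump1 x = 0.
Proof. by move=> x0; rewrite /bump1 /Fexp ltNge x0. Qed.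

Lemma bump1_ge0 (x : R) : 0 <= bump1 x.
Proof. by have [x0|x0] := ltP 0 x; [rewrite bump1E// expR_ge0|rewrite bump1_le0]. Qed.

Lemma bump1_le1 (x : R) : bump1 x <= 1.
Proof.
have [x0|x0] := ltP 0 x; last by rewrite bump1_le0.
by rewrite bump1E// -expR0 ler_expR oppr_le0 invr_ge0 ltW.
Qed.

Lemma bump1_cvg (x : R) : bump1 (n.+1%:R * x) @[n --> \oo] --> ((0 < x)%R%:R : R).
Proof.
have [x0|x0] := ltP 0 x; last first.
  under eq_fun do rewrite bump1_le0 ?mulr_ge0_le0//.
  exact: cvg_cst.
under eq_fun do rewrite bump1E ?mulr_gt0//.
have := @cvg_seq_comp expR (fun n => - (n.+1%:R * x)^-1) 0 (@continuous_expR R 0).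
rewrite expR0; apply.
rewrite -oppr0; apply: cvgN.
under eq_fun do rewrite invfM.
rewrite -(mul0r x^-1); apply: cvgMl.
exact: cvg_harmonic.
Qed.

End bump1.

Section bump3.
Variable R : realType.
Implicit Types (i j : 'I_3).

Lemma is_derive_vline (f : R3 R -> R) (x v : R3 R) (d : R) :
  is_derive (0 : R) 1 (fun h : R => f (h *: v + x)) d -> is_derive x v f d.
Proof.
have E : (fun h : R => h^-1 *: (f ((h *: 1 + 0) *: v + x) - f (0 *: v + x))) =
  (fun h : R => h^-1 *: (f (h *: v + x) - f x)).
  by apply/funext => h; rewrite scaler1 addr0 scale0r add0r.
move=> [D1 D2]; apply: DeriveDef; first by move: D1; rewrite /derivable /= E.
by move: D2; rewrite /derive/= E.
Qed.

Lemma is_derive_affine (a b t : R) : is_derive t (1 : R) (fun h : R => a * h + b) a.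
Proof.
have := is_deriveD (is_deriveM (is_derive_cst a t 1) (is_derive_id t 1)) (is_derive_cst b t 1).
by move=> h; apply: (@is_derive_eq _ _ _ (cst a * id + cst b) _ _ _ _ h); rewrite scaler1 scaler0 !addr0.
Qed.

Lemma crd_scale i (a : R) (x : R3 R) : crd i (a *: x) = a * crd i x.
Proof. by case: i => -[|[|[|//]]]. Qed.

Lemma crd_line i j (h : R) x : crd i (h *: e3 R j + x) = h * (i == j)%:R + crd i x.
Proof.
by case: i => -[|[|[|//]]] ?; case: j => -[|[|[|//]]] ?; rewrite /crd /e3/=.
Qed.

Lemma crd_continuous i : continuous (@crd R i).
Proof.
case: i => -[|[|[|//]]] ? x; rewrite /crd/=.
- by apply: (@cvg_comp _ _ _ fst fst); [exact: cvg_fst|exact: cvg_fst].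
- by apply: (@cvg_comp _ _ _ fst snd); [exact: cvg_fst|exact: cvg_snd].
- exact: cvg_snd.
Qed.

Lemma is_derive_Fexp_crd p i j (k c : R) x :
  is_derive x (e3 R j) (fun x => Fexp p (k * crd i x + c))
    ((k * (i == j)%:R) * Fexp (dFexp p) (k * crd i x + c)).
Proof.
apply: is_derive_vline.
have -> : (fun h : R => Fexp p (k * crd i (h *: e3 R j + x) + c)) =
    Fexp p \o (fun h => (k * (i == j)%:R) * h + (k * crd i x + c)).
  by apply/funext => h /=; rewrite crd_line; congr (Fexp p _); ring.
rewrite (mulrC (k * _)); apply: is_derive1_comp; last exact: is_derive_affine.
by rewrite mulr0 add0r; exact: is_derive_Fexp.
Qed.

Lemma Ck_Fexp n p i (k c : R) : Ck n (fun x => Fexp p (k * crd i x + c)).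
Proof.
have cF q : continuous (fun x => Fexp q (k * crd i x + c)).
  move=> x; apply: (@continuous_comp _ _ _ (fun x => k * crd i x + c)); last exact: Fexp_continuous.
  by apply: cvgD; [apply: cvgMr; exact: crd_continuous|exact: cvg_cst].
elim: n p => [|n IH] p; split => // j; split.
  by move=> x; have [] := is_derive_Fexp_crd p i j k c x.
rewrite (_ : partial j _ = fun x => (k * (i == j)%:R) * Fexp (dFexp p) (k * crd i x + c)).
  by apply: CkM => //; exact: Ck_cst.
by apply/funext => x; have [_ <-] := is_derive_Fexp_crd p i j k c x.
Qed.

(* The factors exp 2 normalise the value at the origin to 1. *)
Definition cutoff (r : R) (x : R3 R) : R :=
  \prod_(i < 3) (expR 2 * (bump1 (r^-1 * crd i x + 1) * bump1 (- r^-1 * crd i x + 1))).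

Lemma Ck_prod3 n (F : 'I_3 -> R3 R -> R) : (forall k, Ck n (F k)) -> Ck n (fun x => \prod_k F k x).
Proof.
move=> CF; under eq_fun do rewrite !big_ord_recr big_ord0/=.
by do !apply: CkM => //; exact: Ck_cst.
Qed.

Lemma cutoff_Ck n r : Ck n (cutoff r).
Proof.
apply: Ck_prod3 => i; apply: CkM; first exact: Ck_cst.
by apply: CkM; exact: Ck_Fexp.
Qed.

(** Since 1/(1 + s) + 1/(1 - s) = 2/(1 - s^2), the exponent is at most 0 and equals 0 at s = 0:
    hence the bound of [cutoff] by 1 and its value 1 at the origin. *)
Lemma bump2 (s : R) : `|s| < 1 ->
  expR 2 * (bump1 (s + 1) * bump1 (- s + 1)) = expR (2 - 2 / (1 - s ^+ 2)).
Proof.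
rewrite ltr_norml => /andP[s1 s2]; rewrite !bump1E; [|lra|lra].
rewrite -!expRD; congr expR; field.
by rewrite !lt0r_neq0//; nra.
Qed.

Lemma bump2_out (s : R) : 1 <= `|s| -> expR 2 * (bump1 (s + 1) * bump1 (- s + 1)) = 0.
Proof.
rewrite ler_normr => /orP[s1|s1]; first by rewrite (@bump1_le0 _ (- s + 1)) ?mulr0//; lra.
by rewrite (@bump1_le0 _ (s + 1)) ?mul0r ?mulr0//; lra.
Qed.

Lemma cutoff_ge0 r x : 0 <= cutoff r x.
Proof. by apply: prodr_ge0 => i _; rewrite !mulr_ge0 ?expR_ge0 ?bump1_ge0. Qed.

Lemma cutoff_le1 r x : cutoff r x <= 1.
Proof.
pose F i : R := expR 2 * (bump1 (r^-1 * crd i x + 1) * bump1 (- r^-1 * crd i x + 1)).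
suff F01 i : 0 <= F i <= 1.
  have F0 i : 0 <= F i by case/andP: (F01 i).
  have F1 i : F i <= 1 by case/andP: (F01 i).
  rewrite /cutoff (eq_bigr F)// !big_ord_recr big_ord0/= mul1r.
  exact: (mulr_ile1 (mulr_ge0 (F0 _) (F0 _)) (F0 _) (mulr_ile1 (F0 _) (F0 _) (F1 _) (F1 _)) (F1 _)).
rewrite /F !mulr_ge0 ?expR_ge0 ?bump1_ge0//= mulNr.
have [h|h] := ltP `|r^-1 * crd i x| 1; last by rewrite bump2_out.
rewrite bump2// -[leRHS]expR0 ler_expR; move: (_ * _) h => s.
rewrite ltr_norml => /andP[s1 s2].
have p : 0 < 1 - s ^+ 2 by nra.
by rewrite subr_le0 ler_pdivlMr//; nra.
Qed.

Lemma cutoff_gt0 r x : 0 < r -> (forall i, `|crd i x| < r) -> 0 < cutoff r x.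
Proof.
move=> r0 h; apply: prodr_gt0 => i _; rewrite mulNr bump2 ?expR_gt0//.
by rewrite normrM gtr0_norm ?invr_gt0// ltr_pdivrMl// mulr1.
Qed.

Lemma cube_crd r (x : R3 R) : (forall i, `|crd i x| <= r) -> cube r x.
Proof.
move=> h; have := h 0; have := h 1; have := h 2%:R; rewrite /crd/= => h1 h2 h3.
by split; [split|]; rewrite /= in_itv/= -ler_norml.
Qed.

Lemma cutoff_out r x : 0 < r -> ~ cube r x -> cutoff r x = 0.
Proof.
move=> r0 nx; have [i h] : exists i, r < `|crd i x|.
  apply/not_existsP => h; apply: nx; apply: cube_crd => i.
  by rewrite leNgt; apply/negP; exact: h.
rewrite /cutoff (bigD1 i)//= mulNr bump2_out ?mul0r//.
by rewrite normrM gtr0_norm ?invr_gt0// ler_pdivlMl// mulr1 ltW.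
Qed.

Lemma cutoff_cc r : 0 < r -> cc (cutoff r).
Proof. by move=> r0; split; [exact: Ck_cont (cutoff_Ck 0 r)|exists r => x; exact: cutoff_out]. Qed.

Lemma cutoff_scale r x : cutoff r x = cutoff 1 (r^-1 *: x).
Proof.
apply: eq_bigr => i _; rewrite invr1 mul1r mulN1r mulNr.
by rewrite crd_scale.
Qed.

Lemma cutoff_cvg x : cutoff n.+1%:R x @[n --> \oo] --> (1 : R).
Proof.
pose G (s : R) : R := expR 2 * (bump1 (s + 1) * bump1 (- s + 1)).
have G0 : G 0 = 1 by rewrite /G bump2 ?normr0// expr0n/= subr0 divr1 subrr expR0.
have cG : continuous G.
  move=> s; apply: cvgMr; apply: cvgM.
    apply: (@continuous_comp _ _ _ (fun s : R => s + 1)); last exact: Fexp_continuous.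
    by apply: cvgD; [exact: cvg_id|exact: cvg_cst].
  apply: (@continuous_comp _ _ _ (fun s : R => - s + 1)); last exact: Fexp_continuous.
  by apply: cvgD; [apply: cvgN; exact: cvg_id|exact: cvg_cst].
have Gi i : G (n.+1%:R^-1 * crd i x) @[n --> \oo] --> (1 : R).
  have := @cvg_seq_comp _ G (fun n => n.+1%:R^-1 * crd i x) 0 (cG 0).
  rewrite G0; apply; by rewrite -(mul0r (crd i x)); apply: cvgMl; exact: cvg_harmonic.
have -> : (fun n => cutoff n.+1%:R x) = (fun n => G (n.+1%:R^-1 * crd 0 x) * G (n.+1%:R^-1 * crd 1 x) * G (n.+1%:R^-1 * crd 2%:R x)).
  apply/funext => n; rewrite /cutoff !big_ord_recr big_ord0/= mul1r !mulNr.
  by congr (_ * _ * _); rewrite /G; congr (_ * (bump1 (_ * crd _ x + _) * bump1 (- (_ * crd _ x) + _))); exact/val_inj.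
suff H : (fun n : nat => G (n.+1%:R^-1 * crd 0 x) * G (n.+1%:R^-1 * crd 1 x) * G (n.+1%:R^-1 * crd 2%:R x)) @ \oo
    --> (1 * 1 * 1 : R) by rewrite !mulr1 in H.
by apply: cvgM; [apply: cvgM|].
Qed.

Lemma partial_scale (f : R3 R -> R) (k : R) i x : Ck 1 f ->
  partial i (fun y => f (k *: y)) x = k * partial i f (k *: x).
Proof.
move=> Cf; suff [_ <-//] : is_derive x (e3 R i) (fun y => f (k *: y)) (k * partial i f (k *: x)).
apply: is_derive_vline.
have -> : (fun h : R => f (k *: (h *: e3 R i + x))) =
    (fun t : R => f (k *: x + t *: e3 R i)) \o (fun h : R => k * h).
  by apply/funext => h /=; rewrite scalerDr scalerA addrC.
rewrite (mulrC k); apply: is_derive1_comp; last first.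
  by have := is_derive_affine k 0 0; under eq_fun do rewrite addr0.
rewrite mulr0 -[in partial i f _](addr0 (k *: x)) -[X in partial i f (_ + X)](scale0r (e3 R i)).
by apply: is_derive_line; exact: Ck_derivable Cf.
Qed.

(** By scaling, the derivative is 1/r times that of the fixed function [cutoff 1], which is bounded.
    That [C] does not depend on [r] is what makes all localization errors O(1/r). *)
Lemma cutoff_partial : exists2 C : R, 0 < C &
  forall (r : R) i x, 0 < r -> `|partial i (cutoff r) x| <= C / r.
Proof.
have B i : exists2 C : R, 0 < C & forall x, `|partial i (cutoff 1) x| <= C.
  apply: csupp_bounded; first exact: Ck_cont (Ck_partial i (cutoff_Ck 1 1)).
  by apply: csupp_partial; case: (cutoff_cc ltr01).
have [C0 C00 B0] := B 0; have [C1 C10 B1] := B 1; have [C2 C20 B2] := B 2%:R.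
exists (C0 + C1 + C2) => [|r i x r0]; first by rewrite !addr_gt0.
have -> : cutoff r = fun y => cutoff 1 (r^-1 *: y) by apply/funext => y; exact: cutoff_scale.
rewrite partial_scale; last exact: cutoff_Ck.
rewrite normrM gtr0_norm ?invr_gt0// mulrC ler_wpM2r ?invr_ge0 ?(ltW r0)//.
have : [\/ i = 0, i = 1 | i = 2%:R].
  by case: i => -[|[|[|//]]] ?; [apply: Or31|apply: Or32|apply: Or33]; exact/val_inj.
case=> ->.
- by rewrite (le_trans (B0 _))//; lra.
- by rewrite (le_trans (B1 _))//; lra.
- by rewrite (le_trans (B2 _))//; lra.
Qed.

End bump3.

(** * The fundamental lemma of the calculus of variations *)

Section fundamental.
Variable R : realType.
Local Notation mu := (leb3 R).
Implicit Types (f g phi : R3 R -> R) (i j : 'I_3).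

Definition test phi := (forall n, Ck n phi) /\ csupp phi.

Lemma test_functionP phi : test_function phi <-> test phi.
Proof.
split=> [[sp [K cK K0]]|[Cp sp]].
  by split; [move=> n; exact: smooth_Ck|exact: compact_csupp K0].
by split; [exact: Ck_smooth|exact: csupp_compact].
Qed.

Lemma test_cc phi : test phi -> cc phi.
Proof. by move=> [Cp sp]; split => //; exact: Ck_cont (Cp 0%N). Qed.

Lemma testM phi f : test phi -> (forall n, Ck n f) -> test (fun x => phi x * f x).
Proof. by move=> [Cp sp] Cf; split; [move=> n; exact: CkM|exact: csuppM]. Qed.

Lemma cutoff_test (r : R) : 0 < r -> test (cutoff r).
Proof. by move=> r0; split; [move=> n; exact: cutoff_Ck|case: (cutoff_cc r0)]. Qed.

(* Slabs are bounded pointwise limits of test functions, so this pi-system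
   generates the Borel sets. *)
Definition limclass (A : set (R3 (measurableTypeR R))) := measurable A /\
  exists2 phi : nat -> R3 R -> R, (forall n, test (phi n) /\ forall x, `|phi n x| <= 1) &
    forall x, phi n x @[n --> \oo] --> (\1_A x : R).

Lemma limclassI : setI_closed limclass.
Proof.
move=> A B [mA [p hp pA]] [mB [q hq qB]]; split; first exact: measurableI.
exists (fun n x => p n x * q n x) => [n|x].
  have [[tp p1] [[tq _] q1]] := (hp n, hq n); split; first exact: testM.
  by move=> x; rewrite normrM mulr_ile1.
by rewrite indicI; apply: cvgM; [exact: pA|exact: qB].
Qed.

Lemma limclassT : limclass setT.
Proof.
split => //; exists (fun n => cutoff n.+1%:R) => [n|x].
  split => [|x]; first exact: cutoff_test.
  by rewrite ger0_norm ?cutoff_ge0// cutoff_le1.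
by rewrite indicT; exact: cutoff_cvg.
Qed.

Lemma crd_measurable i : measurable_fun setT (@crd R i : R3 (measurableTypeR R) -> R).
Proof. exact: continuous_R3_measurable (@crd_continuous R i). Qed.

(** The two bumps tend to the indicators of a < x_i and of x_i < b. A slab is unbounded, hence the
    additional factor [cutoff n.+1%:R], which provides compact support and tends to 1. *)
Lemma limclass_slab i (a b : R) : limclass (@crd R i @^-1` `]a, b[).
Proof.
split; first by rewrite -[X in measurable X]setTI; exact: (crd_measurable i).
exists (fun n x => cutoff n.+1%:R x * (bump1 (n.+1%:R * (crd i x - a)) * bump1 (n.+1%:R * (b - crd i x)))) => [n|x].
  split.
    apply: testM; first exact: cutoff_test.
    have -> : (fun x => bump1 (n.+1%:R * (crd i x - a)) * bump1 (n.+1%:R * (b - crd i x))) =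
      (fun x => Fexp 1 (n.+1%:R * crd i x + (- (n.+1%:R * a))) * Fexp 1 (- n.+1%:R * crd i x + n.+1%:R * b)).
      by apply/funext => x; rewrite /bump1; congr (Fexp _ _ * Fexp _ _); ring.
    by move=> m; apply: CkM; exact: Ck_Fexp.
  move=> x; rewrite ger0_norm ?mulr_ge0 ?cutoff_ge0 ?bump1_ge0//.
  by rewrite !mulr_ile1 ?mulr_ge0 ?cutoff_ge0 ?bump1_ge0 ?cutoff_le1 ?bump1_le1// mulr_ile1 ?bump1_ge0 ?bump1_le1.
have -> : \1_(@crd R i @^-1` `]a, b[) x = 1 * (((0 < crd i x - a)%R%:R : R) * ((0 < b - crd i x)%R%:R : R)) :> R.
  rewrite mul1r indicE !subr_gt0 -natrM mulnb; congr (_%:R); congr nat_of_bool.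
  by apply/idP/idP; rewrite inE /= in_itv.
apply: cvgM; first exact: cutoff_cvg.
by apply: cvgM; exact: bump1_cvg.
Qed.

(** The slabs make the coordinates measurable for the sigma-algebra generated by [limclass]. So is
    the identity, being the triple of the coordinates, and the preimage of a measurable set under it
    is the set itself. *)
Lemma limclass_generates : @measurable _ (R3 (measurableTypeR R)) = <<s limclass >>.
Proof.
apply/seteqP; split; last first.
  by apply: smallest_sub; [exact: sigma_algebra_measurable|move=> A []].
pose T' := g_sigma_algebraType limclass.
have mc i : measurable_fun setT (@crd R i : T' -> measurableTypeR R).
  apply: (measurability _ (measurable_realfun.RGenOpens.measurableE R)).
  move=> _ [_ [a [b ->] <-]]; rewrite setTI.
  by apply: sub_sigma_algebra; exact: limclass_slab.
have mid : measurable_fun setT ((fun x => ((crd 0 x, crd 1 x), crd 2%:R x)) : T' -> R3 (measurableTypeR R)).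
  by apply: measurable_fun_pair => //; apply: measurable_fun_pair.
move=> A mA; have := mid measurableT A mA; rewrite setTI.
by rewrite (_ : _ @^-1` A = A)//; apply/seteqP; split => -[[x y] z].
Qed.

(** Dominated convergence with majorant |h|; the bound |phi n| <= 1 in [limclass] serves this
    purpose. *)
Lemma test_zero_limclass (h : R3 R -> R) A : mu.-integrable setT (EFin \o h) ->
  (forall phi, test phi -> \int[mu]_x (h x * phi x) = 0) -> limclass A ->
  (\int[mu]_(x in A) (h x)%:E = 0)%E.
Proof.
move=> ih h0 [mA [phi tphi cphi]].
have mh : measurable_fun setT (h : R3 (measurableTypeR R) -> R).
  by case/integrableP: ih => /measurable_EFinP.
have mphi n : measurable_fun setT (phi n : R3 (measurableTypeR R) -> R).
  by apply: continuous_R3_measurable; case: (tphi n) => /test_cc[].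
have E n : (\int[mu]_x (h x * phi n x)%:E = 0)%E.
  have [tp p1] := tphi n.
  have ihp : mu.-integrable setT (fun x => (h x * phi n x)%:E).
    apply: (le_integrable _ _ _ ih) => //.
      by apply/measurable_EFinP; exact: measurable_funM.
    by move=> x _; rewrite /= lee_fin normrM ler_piMr.
  have := h0 _ tp; rewrite /Rintegral => /eqP; rewrite fine_eq0; first by move/eqP.
  exact: integrable_fin_num.
have : (\int[mu]_x (h x * phi n x)%:E)%E @[n --> \oo] --> (\int[mu]_x (h x * \1_A x)%:E)%E.
  apply: (@dominated_cvg _ _ _ mu setT _ _ _ (fun x => `|(h x)%:E|)%E) => //.
  - by move=> n; apply/measurable_EFinP; exact: measurable_funM.
  - move=> x _; apply: cvg_EFin; first exact: nearW.
    by apply: cvgMr; exact: cphi.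
  - exact: integrable_abse.
  - move=> n x _; rewrite /= lee_fin normrM ler_piMr//.
    by have [_] := tphi n; apply.
under eq_fun do rewrite E.
move=> /cvg_lim => /(_ (@ereal_hausdorff R)); rewrite lim_cst//.
move=> E0; rewrite integral_mkcond [RHS]E0; apply: eq_integral => x _.
by rewrite patchE indicE; case: ifPn => xA; rewrite ?mulr1 ?mulr0.
Qed.

(** The sets over which [h] integrates to 0 are closed under complements and disjoint countable
    unions and contain the pi-system [limclass], so by Dynkin's theorem they are all measurable
    sets. *)
Lemma fundamental_lemma (h : R3 R -> R) : mu.-integrable setT (EFin \o h) ->
  (forall phi, test phi -> \int[mu]_x (h x * phi x) = 0) ->
  {ae mu, forall x, h x = 0}.
Proof.
move=> ih h0.
have Z A : measurable (A : set (R3 (measurableTypeR R))) -> (\int[mu]_(x in A) (h x)%:E = 0)%E.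
  rewrite limclass_generates.
  apply: (@dynkin_induction _ _ limclass (fun A => (\int[mu]_(x in A) (h x)%:E = 0)%E) limclass_generates limclassI).
  - exact: test_zero_limclass h0 limclassT.
  - by move=> B; exact: test_zero_limclass h0.
  - move=> S mS S0.
    have : (\int[mu]_(x in S `|` ~` S) (h x)%:E = 0)%E.
      rewrite setUv; exact: test_zero_limclass h0 limclassT.
    rewrite integral_setU//; first by rewrite S0 add0e.
    + exact: measurableC.
    + by rewrite setUv; exact: measurable_int ih.
    + by apply/disj_setPS; rewrite setICr.
  - move=> F mF tF F0; rewrite integral_bigcup//; last first.
      by apply: integrableS ih => //; exact: bigcup_measurable.
    by rewrite eseries0.
have := @integral_ae_eq _ _ _ mu setT measurableT (cst 0%E) (EFin \o h) ih.
move=> /(_ (measurable_cst _)); have Z' E : E `<=` setT ->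
  measurable (E : set (R3 (measurableTypeR R))) -> (\int[mu]_(x in E) (EFin \o h) x = \int[mu]_(x in E) (cst 0%E x))%E.
  by move=> _ mE; rewrite Z// integral0.
move=> /(_ Z'); apply: filterS => x /(_ I) /=.
by case.
Qed.

End fundamental.

(** * L^2 fields and weak derivatives *)

Section l2.
Variable R : realType.
Local Notation mu := (leb3 R).
Implicit Types (f g phi : R3 R -> R) (i j : 'I_3) (u w : vfield R).

Lemma ae3_filter : Filter (nbhs (almost_everywhere mu)).
Proof. exact: ae_filter_ringOfSetsType. Qed.

Lemma ae3S (P Q : R3 R -> Prop) : (forall x, P x -> Q x) ->
  {ae mu, forall x, P x} -> {ae mu, forall x, Q x}.
Proof. exact: (@filterS _ _ ae3_filter). Qed.

Definition intg f := mu.-integrable setT (EFin \o f).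
Definition mfun3 f := measurable_fun setT (f : R3 (measurableTypeR R) -> R).

Lemma Lnorm2E f : mfun3 f -> intg (fun x => f x ^+ 2) ->
  ('N[mu]_2%:E [EFin \o f] = (Num.sqrt (\int[mu]_x (f x ^+ 2)))%:E)%E.
Proof.
move=> mf if2; rewrite unlock.
have -> : (\int[mu]_x `|(EFin \o f) x| `^ 2 = (\int[mu]_x (f x ^+ 2))%:E)%E.
  rewrite /Rintegral fineK; last exact: integrable_fin_num.
  by apply: eq_integral => x _; rewrite /= powR_mulrn// real_normK ?num_real.
rewrite poweR_EFin powR12_sqrt//.
by apply: Rintegral_ge0 => x _; exact: sqr_ge0.
Qed.

Lemma L2P f : L2 f <-> mfun3 f /\ intg (fun x => f x ^+ 2).
Proof.
split=> [fL2|[mf if2]].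
  split; last exact: Lfun2_integrable_sqr fL2.
  by move: fL2; rewrite /L2 inE => /andP[]; rewrite inE.
rewrite /L2 inE; apply/andP; split; rewrite inE//=.
by rewrite /finite_norm Lnorm2E// ltry.
Qed.

Lemma L2_mfun f : L2 f -> mfun3 f. Proof. by case/L2P. Qed.

Lemma L2_sqr f : L2 f -> intg (fun x => f x ^+ 2). Proof. by case/L2P. Qed.

Lemma L2_mul f g : L2 f -> L2 g -> intg (fun x => f x * g x).
Proof. by move=> Lf Lg; apply/Lfun1_integrable; exact: Lfun2_mul_Lfun1. Qed.

Lemma intgD f g : intg f -> intg g -> intg (fun x => f x + g x).
Proof. by move=> fi gi; exact: (@integrableD _ _ _ mu setT measurableT _ _ fi gi). Qed.

Lemma intgB f g : intg f -> intg g -> intg (fun x => f x - g x).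
Proof. by move=> fi gi; exact: (@integrableB _ _ _ mu setT measurableT _ _ fi gi). Qed.

Lemma intgZ (c : R) f : intg f -> intg (fun x => c * f x).
Proof. by move=> fi; exact: (@integrableZl _ _ _ mu setT measurableT c _ fi). Qed.

Lemma intg_sum m (F : 'I_m -> R3 R -> R) : (forall k, intg (F k)) ->
  intg (fun x => \sum_k F k x).
Proof.
elim: m F => [|m IH] F IF.
  under eq_fun do rewrite big_ord0; exact: cc_integrable (@cc0 R).
by under eq_fun do rewrite big_ord_recr/=; apply: intgD => //; exact: IH.
Qed.

Lemma L2D f g : L2 f -> L2 g -> L2 (fun x => f x + g x).
Proof.
move=> Lf Lg; apply/L2P; split.
  by apply: measurable_funD; exact: L2_mfun.
have -> : (fun x => (f x + g x) ^+ 2) = (fun x => f x ^+ 2 + (2 * (f x * g x) + g x ^+ 2)).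
  by apply/funext => x; ring.
by apply: intgD; [exact: L2_sqr|apply: intgD; [apply: intgZ; exact: L2_mul|exact: L2_sqr]].
Qed.

Lemma L2Z (c : R) f : L2 f -> L2 (fun x => c * f x).
Proof.
move=> Lf; apply/L2P; split.
  by apply: measurable_funM; [exact: measurable_cst|exact: L2_mfun].
under eq_fun do rewrite exprMn; apply: intgZ; exact: L2_sqr.
Qed.

Lemma L2B f g : L2 f -> L2 g -> L2 (fun x => f x - g x).
Proof.
move=> Lf Lg; under eq_fun do rewrite -[- g _]mulN1r.
by apply: L2D => //; exact: L2Z.
Qed.

Lemma cc_L2 f : cc f -> L2 f.
Proof.
move=> cf; apply/L2P; split; first exact: continuous_R3_measurable (proj1 cf).
by apply: cc_integrable; apply: ccMl => //; exact: (proj1 cf).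
Qed.

Lemma ae_L2 f g : mfun3 g -> L2 f -> {ae mu, forall x, f x = g x} -> L2 g.
Proof.
move=> mg Lf fg; apply/L2P; split => //.
have [mf /integrableP[mf2 fi]] := proj1 (L2P f) Lf.
apply/integrableP; split; first by apply/measurable_EFinP; exact: measurable_funX.
rewrite (@ae_eq_integral _ _ _ mu setT (fun x => `|(f x ^+ 2)%:E|)%E)//.
- by apply: measurableT_comp => //; apply/measurable_EFinP; exact: measurable_funX.
- by apply: measurableT_comp => //; apply/measurable_EFinP; exact: measurable_funX.
- by move: fg; apply: ae3S => x -> _.
Qed.

Lemma ae_Rintegral f g : mfun3 f -> mfun3 g -> {ae mu, forall x, f x = g x} ->
  \int[mu]_x f x = \int[mu]_x g x.
Proof.
move=> mf mg fg; rewrite /Rintegral; congr fine.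
apply: ae_eq_integral => //; [exact/measurable_EFinP|exact/measurable_EFinP|].
by move: fg; apply: ae3S => x -> _.
Qed.

Lemma discriminant (a b c : R) : 0 <= c -> (forall l : R, 0 <= a + 2 * l * b + l ^+ 2 * c) ->
  b ^+ 2 <= a * c.
Proof.
rewrite le_eqVlt => /orP[/eqP <- h|c0 h].
  rewrite mulr0; have [->|b0] := eqVneq b 0; first by rewrite expr0n.
  (* For c = 0 the expression is affine in l with slope 2b; at this point its value is -1,
     contradicting nonnegativity. *)
  have := h (- (a + 1) / (2 * b)).
  have -> : 2 * (- (a + 1) / (2 * b)) * b = - (a + 1) by field.
  by move: (_ ^+ 2) => k H; exfalso; lra.
have := h (- b / c).
have -> : a + 2 * (- b / c) * b + (- b / c) ^+ 2 * c = (a * c - b ^+ 2) / c by field; rewrite gt_eqF.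
by rewrite pmulr_lge0 ?invr_gt0// subr_ge0.
Qed.

Definition ip u w : R := \int[mu]_x (\sum_i u i x * w i x).

Definition VL2 u := forall i, L2 (u i).

Lemma ip_intg u w : VL2 u -> VL2 w -> intg (fun x => \sum_i u i x * w i x).
Proof. by move=> Lu Lw; apply: intg_sum => i; exact: L2_mul. Qed.

Lemma ip_ge0 u : 0 <= ip u u.
Proof. by apply: Rintegral_ge0 => x _; apply: sumr_ge0 => i _; rewrite -expr2 sqr_ge0. Qed.

Lemma ip_line u w (l : R) : VL2 u -> VL2 w ->
  ip (fun i x => u i x + l * w i x) (fun i x => u i x + l * w i x) =
  ip u u + 2 * l * ip u w + l ^+ 2 * ip w w.
Proof.
move=> Lu Lw; rewrite /ip -!RintegralZl//; [|exact: ip_intg..].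
rewrite -!RintegralD//; [|by [exact: ip_intg|apply: intgZ; exact: ip_intg|
  apply: intgD; [exact: ip_intg|apply: intgZ; exact: ip_intg]]..].
by apply: eq_Rintegral => x _; rewrite !big_ord_recr !big_ord0/=; ring.
Qed.

Lemma ip_CS u w : VL2 u -> VL2 w -> ip u w ^+ 2 <= ip u u * ip w w.
Proof.
move=> Lu Lw; apply: discriminant => [|l]; first exact: ip_ge0.
by rewrite -ip_line//; exact: ip_ge0.
Qed.

Lemma L2normE u : VL2 u -> L2norm u = Num.sqrt (ip u u).
Proof.
move=> Lu; rewrite /L2norm.
have E : (fun x => Num.sqrt (\sum_i u i x ^+ 2) ^+ 2) = (fun x => \sum_i u i x * u i x).
  apply/funext => x; rewrite sqr_sqrtr; first by apply: eq_bigr => i _; rewrite expr2.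
  by apply: sumr_ge0 => i _; exact: sqr_ge0.
rewrite Lnorm2E /=; first by rewrite E.
  apply: (@measurableT_comp _ _ _ _ _ _ (@Num.sqrt R)).
    exact: continuous_measurable_fun (@sqrt_continuous R).
  rewrite /mfun3; apply: measurable_sum => i; apply: measurable_funX; exact: L2_mfun.
by rewrite E; exact: ip_intg.
Qed.

Lemma L2norm_ge0 u : 0 <= L2norm u.
Proof. by rewrite /L2norm fine_ge0 ?Lnorm_ge0. Qed.

Lemma L2norm_sqr u : VL2 u -> L2norm u ^+ 2 = ip u u.
Proof. by move=> Lu; rewrite L2normE// sqr_sqrtr// ip_ge0. Qed.

Lemma L2norm_triangle u w : VL2 u -> VL2 w ->
  L2norm (fun i x => u i x + w i x) <= L2norm u + L2norm w.
Proof.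
move=> Lu Lw.
have Luw : VL2 (fun i x => u i x + w i x) by move=> i; exact: L2D.
rewrite -(@ler_pXn2r _ 2)// ?nnegrE ?addr_ge0 ?L2norm_ge0//.
rewrite sqrrD !L2norm_sqr//.
have := @ip_line u w 1 Lu Lw.
have -> : (fun i x => u i x + 1 * w i x) = (fun i x => u i x + w i x).
  by apply/funext => i; apply/funext => x; rewrite mul1r.
move=> ->; rewrite expr1n mul1r mulr1 lerD2r lerD2l -[leRHS]mulr_natl; apply: ler_wpM2l => //.
rewrite (le_trans (ler_norm _))// -(@ler_pXn2r _ 2)// ?nnegrE ?mulr_ge0 ?L2norm_ge0//.
by rewrite real_normK ?num_real// exprMn !L2norm_sqr//; exact: ip_CS.
Qed.

Lemma L2normN u : L2norm (fun i x => - u i x) = L2norm u.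
Proof.
rewrite /L2norm; congr (fine (Lnorm _ _ _)); apply/funext => x; congr (Num.sqrt _)%:E.
by apply: eq_bigr => i _; rewrite sqrrN.
Qed.

Lemma L2norm_dist u w : VL2 u -> VL2 w ->
  `|L2norm u - L2norm w| <= L2norm (fun i x => u i x - w i x).
Proof.
move=> Lu Lw.
have Luw : VL2 (fun i x => u i x - w i x) by move=> i; exact: L2B.
have Lwu : VL2 (fun i x => w i x - u i x) by move=> i; exact: L2B.
have h a b : VL2 a -> VL2 b -> L2norm a <= L2norm b + L2norm (fun i x => a i x - b i x).
  move=> La Lb; have := L2norm_triangle Lb (fun i => L2B (La i) (Lb i)).
  rewrite (_ : (fun i x => b i x + (a i x - b i x)) = a)//.
  by apply/funext => i; apply/funext => x; rewrite addrC subrK.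
have := h u w Lu Lw; have := h w u Lw Lu.
rewrite (_ : (fun i x => w i x - u i x) = (fun i x => - (u i x - w i x))); last first.
  by apply/funext => i; apply/funext => x; rewrite opprB.
by rewrite L2normN ler_norml => *; apply/andP; split; lra.
Qed.

Lemma ae_L2norm u w : (forall i, mfun3 (w i)) -> VL2 u ->
  (forall i, {ae mu, forall x, u i x = w i x}) -> L2norm u = L2norm w.
Proof.
move=> mw Lu uw; have Lw : VL2 w by move=> i; apply: ae_L2 (uw i).
rewrite !L2normE//; congr Num.sqrt; apply: ae_Rintegral.
- by apply: measurable_sum => i; apply: measurable_funM; exact: L2_mfun.
- by apply: measurable_sum => i; apply: measurable_funM; exact: L2_mfun.
- have := uw 0; have := uw 1; have := uw 2%:R.
  apply: (@filterS3 _ _ ae3_filter) => x h2 h1 h0; apply: eq_bigr => i _.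
  have : [\/ i = 0, i = 1 | i = 2%:R].
    by case: i => -[|[|[|//]]] ?; [apply: Or31|apply: Or32|apply: Or33]; exact/val_inj.
  by case=> ->; rewrite ?h0 ?h1 ?h2.
Qed.

End l2.

Section weak.
Variable R : realType.
Local Notation mu := (leb3 R).
Implicit Types (f g phi : R3 R -> R) (i j : 'I_3) (u w : vfield R).

(** A common class for the weak derivative, which lies in L^2, and the classical one, which is a
    priori only continuous; uniqueness has to compare the two. *)
Definition locint g := mfun3 g /\ forall phi, test phi -> intg (fun x => g x * phi x).

Lemma L2_locint g : L2 g -> locint g.
Proof.
move=> Lg; split => [|phi tp]; first exact: L2_mfun.
by apply: L2_mul => //; apply: cc_L2; exact: test_cc.
Qed.

Lemma continuous_locint g : continuous g -> locint g.
Proof.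
move=> cg; split => [|phi tp]; first exact: continuous_R3_measurable.
by apply: cc_integrable; apply: ccMr => //; exact: test_cc.
Qed.

(** The fundamental lemma needs an integrable function, so it is applied to (g - h) times a cutoff,
    for each of countably many radii. Every point lies in some open cube on which the cutoff is
    positive. *)
Lemma locint_unique g h : locint g -> locint h ->
  (forall phi, test phi -> \int[mu]_x (g x * phi x) = \int[mu]_x (h x * phi x)) ->
  {ae mu, forall x, g x = h x}.
Proof.
move=> [mg ig] [mh ih] gh.
have H n : {ae mu, forall x, (g x - h x) * cutoff n.+1%:R x = 0}.
  have tn := @cutoff_test R n.+1%:R (ltr0Sn _ n).
  have E : (fun x => (g x - h x) * cutoff n.+1%:R x) =
     (fun x => g x * cutoff n.+1%:R x - h x * cutoff n.+1%:R x).
    by apply/funext => x; rewrite mulrBl.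
  apply: (@fundamental_lemma R (fun x => (g x - h x) * cutoff n.+1%:R x)).
    by rewrite E; apply: intgB; [exact: ig|exact: ih].
  move=> phi tp; have tnp : test (fun x => cutoff n.+1%:R x * phi x).
    by apply: testM => //; case: tp.
  transitivity (\int[mu]_x (g x * (cutoff n.+1%:R x * phi x) - h x * (cutoff n.+1%:R x * phi x))).
    by apply: eq_Rintegral => x _; ring.
  by rewrite RintegralB//; [rewrite gh// subrr|exact: ig|exact: ih].
have := ae_foralln H; apply: ae3S => x hx.
pose M : R := `|crd 0 x| + `|crd 1 x| + `|crd 2%:R x|.
have := hx (Num.trunc M); move=> /eqP; rewrite mulf_eq0 subr_eq0 => /orP[/eqP //|/eqP c0].
suff : 0 < cutoff (Num.trunc M).+1%:R x by rewrite c0 ltxx.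
apply: cutoff_gt0 => // i; apply: le_lt_trans (truncnS_gt _).
have : [\/ i = 0, i = 1 | i = 2%:R].
  by case: i => -[|[|[|//]]] ?; [apply: Or31|apply: Or32|apply: Or33]; exact/val_inj.
by case=> ->; rewrite /M ?lerDr ?addr_ge0// -addrA ?lerDl ?addr_ge0// addrCA lerDl addr_ge0.
Qed.

Lemma weak_partial_spec i f : H1 f ->
  L2 (weak_partial i f) /\ is_weak_partial i f (weak_partial i f).
Proof.
move=> [_ /(_ i)[g Lg wg]]; rewrite /weak_partial.
by apply: (@xgetPex _ _ [set g | L2 g /\ is_weak_partial i f g]); exists g.
Qed.

Lemma weak_partial_unique i f g h : locint g -> locint h ->
  is_weak_partial i f g -> is_weak_partial i f h -> {ae mu, forall x, g x = h x}.
Proof.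
move=> lg lh wg wh; apply: locint_unique => // phi /test_functionP tp.
by apply: oppr_inj; rewrite -wg// -wh.
Qed.

Lemma classical_weak_partial i f : Ck 1 f -> is_weak_partial i f (partial i f).
Proof.
by move=> Cf phi /test_functionP[Cp sp]; apply: int_by_parts.
Qed.

Lemma weak_partial_classical i f : H1 f -> Ck 1 f ->
  {ae mu, forall x, weak_partial i f x = partial i f x}.
Proof.
move=> Hf Cf; have [Lw ww] := weak_partial_spec i Hf.
apply: weak_partial_unique ww (classical_weak_partial i Cf); first exact: L2_locint.
by apply: continuous_locint; exact: Ck_cont (Ck_partial i Cf).
Qed.

(** Square integrability is inherited from the weak derivative, with which the classical one agrees
    almost everywhere. *)
Lemma L2_partial i f : H1 f -> Ck 1 f -> L2 (partial i f).
Proof.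
move=> Hf Cf; have [Lw _] := weak_partial_spec i Hf.
apply: ae_L2 (weak_partial_classical i Hf Cf) => //.
by apply: continuous_R3_measurable; exact: Ck_cont (Ck_partial i Cf).
Qed.

Lemma weak_partialB i f g df dg : L2 f -> L2 g -> L2 df -> L2 dg ->
  is_weak_partial i f df -> is_weak_partial i g dg ->
  is_weak_partial i (fun x => f x - g x) (fun x => df x - dg x).
Proof.
move=> Lf Lg Ldf Ldg wf wg phi tp.
have t : test phi by exact/test_functionP.
have tc : cc phi by exact: test_cc.
have pc : cc (partial i phi) by case: t => Cp sp; exact: cc_partial (Cp 1%N).
have E a b c : L2 a -> L2 b -> cc c ->
    \int[mu]_x ((a x - b x) * c x) = \int[mu]_x (a x * c x) - \int[mu]_x (b x * c x).
  move=> La Lb /cc_L2 Lc; rewrite -RintegralB//; [|exact: L2_mul..].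
  by apply: eq_Rintegral => x _; rewrite mulrBl.
by rewrite !E// wf// wg// opprB opprK addrC.
Qed.

Lemma H1B f g : H1 f -> H1 g -> H1 (fun x => f x - g x).
Proof.
move=> Hf Hg; split; first by apply: L2B; [case: Hf|case: Hg].
move=> i; have [Lf wf] := weak_partial_spec i Hf; have [Lg wg] := weak_partial_spec i Hg.
exists (fun x => weak_partial i f x - weak_partial i g x); first exact: L2B.
by apply: weak_partialB => //; [case: Hf|case: Hg].
Qed.

Lemma weak_partialBE i f g : H1 f -> H1 g ->
  {ae mu, forall x, weak_partial i (fun x => f x - g x) x = weak_partial i f x - weak_partial i g x}.
Proof.
move=> Hf Hg; have [Lf wf] := weak_partial_spec i Hf; have [Lg wg] := weak_partial_spec i Hg.
have [Lfg wfg] := weak_partial_spec i (H1B Hf Hg).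
apply: weak_partial_unique wfg _; try by apply: L2_locint => //; exact: L2B.
by apply: weak_partialB => //; [case: Hf|case: Hg].
Qed.

(** Both functions have the same set of weak derivatives, so [xget] makes the same choice for both;
    hence an equality of functions and not merely almost everywhere. *)
Lemma ae_weak_partial i f g : mfun3 f -> mfun3 g -> {ae mu, forall x, f x = g x} ->
  weak_partial i f = weak_partial i g.
Proof.
move=> mf mg fg; rewrite /weak_partial; congr xget; apply/seteqP.
have E phi : test phi -> \int[mu]_x (f x * partial i phi x) = \int[mu]_x (g x * partial i phi x).
  move=> [Cp sp]; have mp : mfun3 (partial i phi).
    by apply: continuous_R3_measurable; exact: Ck_cont (Ck_partial i (Cp 1%N)).
  apply: ae_Rintegral; [exact: measurable_funM|exact: measurable_funM|].
  by move: fg; apply: ae3S => x ->.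
by split=> h /= [Lh wh]; split => // phi tp; rewrite -wh// E//; exact/test_functionP.
Qed.

End weak.

(** * Ladyzhenskaya's inequality in R^3 *)

Section generic.
Variable R : realType.

Lemma cauchy_schwarz d (T : measurableType d) (m : {measure set T -> \bar R}) (f g : T -> R) :
  measurable_fun setT f -> measurable_fun setT g ->
  m.-integrable setT (EFin \o (fun x => f x ^+ 2)) ->
  m.-integrable setT (EFin \o (fun x => g x ^+ 2)) ->
  m.-integrable setT (EFin \o (fun x => f x * g x)) /\
  (\int[m]_x `|f x * g x|) ^+ 2 <= (\int[m]_x f x ^+ 2) * (\int[m]_x g x ^+ 2).
Proof.
move=> mf mg if2 ig2.
have ifg : m.-integrable setT (EFin \o (fun x => f x * g x)).
  have is2 := @integrableD _ _ _ m setT measurableT _ _ if2 ig2.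
  apply: le_integrable is2 => //; first by apply/measurable_EFinP; exact: measurable_funM.
  move=> x _; rewrite /= lee_fin normrM [leRHS]ger0_norm ?addr_ge0 ?sqr_ge0//.
  rewrite -(real_normK (num_real (f x))) -(real_normK (num_real (g x))).
  by have := sqr_ge0 (`|f x| - `|g x|); have := normr_ge0 (f x); have := normr_ge0 (g x); nra.
split => //.
have iafg : m.-integrable setT (EFin \o (fun x => `|f x * g x|)) by exact: integrable_norm.
apply: discriminant => [|l]; first by apply: Rintegral_ge0 => x _; exact: sqr_ge0.
rewrite -!RintegralZl//.
have i1 := @integrableZl _ _ _ m setT measurableT (2 * l) _ iafg.
have i2 := @integrableZl _ _ _ m setT measurableT (l ^+ 2) _ ig2.
rewrite -RintegralD// -RintegralD//; last by exact: (@integrableD _ _ _ m setT measurableT _ _ if2 i1).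
apply: Rintegral_ge0 => x _; rewrite normrM.
rewrite -(real_normK (num_real (f x))) -(real_normK (num_real (g x))).
have -> : `|f x| ^+ 2 + 2 * l * (`|f x| * `|g x|) + l ^+ 2 * `|g x| ^+ 2 = (`|f x| + l * `|g x|) ^+ 2 by ring.
exact: sqr_ge0.
Qed.

Lemma integral_lin2 d (T : measurableType d) (m : {measure set T -> \bar R}) (f g : T -> R) (c : R) :
  m.-integrable setT (EFin \o f) -> m.-integrable setT (EFin \o g) ->
  (\int[m]_x (c * (f x + g x))%:E = (c * (\int[m]_x f x + \int[m]_x g x)%R)%:E)%E.
Proof.
move=> ifi igi; have isum := @integrableD _ _ _ m setT measurableT _ _ ifi igi.
have ic := @integrableZl _ _ _ m setT measurableT c _ isum.
rewrite -RintegralD// -(RintegralZl _ _ isum)// /Rintegral fineK//.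
exact: integrable_fin_num ic.
Qed.

(** By Tonelli, a majorant with separated variables integrates to the product of the one-dimensional
    integrals. [A] and [B] are parameters so that finite values can be supplied for these
    integrals. *)
Lemma slice_product d1 d2 (T1 : measurableType d1) (T2 : measurableType d2)
  (m1 : {sigma_finite_measure set T1 -> \bar R}) (m2 : {sigma_finite_measure set T2 -> \bar R})
  (F : T1 * T2 -> \bar R) (a : T2 -> \bar R) (b : T1 -> \bar R) (A B : \bar R) :
  measurable_fun setT F -> measurable_fun setT a -> measurable_fun setT b ->
  (forall x, 0 <= F x)%E -> (forall y, 0 <= a y)%E -> (forall x, 0 <= b x)%E ->
  (forall x y, F (x, y) <= a y * b x)%E ->
  (\int[m2]_y a y = A)%E -> (\int[m1]_x b x = B)%E ->
  (\int[m1 \x m2]_z F z <= A * B)%E.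
Proof.
move=> mF ma mb F0 a0 b0 Fab <- <-; rewrite fubini_tonelli1//.
rewrite -ge0_integralZl//; last exact: integral_ge0.
apply: ge0_le_integral => //.
- by move=> x _; apply: integral_ge0 => y _; exact: F0.
- exact: measurable_fun_fubini_tonelli_F.
- by apply: emeasurable_funM => //; exact: measurable_cst.
- move=> x _; rewrite -ge0_integralZr//; apply: ge0_le_integral => //.
  + exact: measurable_fun_pair2.
  + by apply: emeasurable_funM => //; exact: measurable_cst.
Qed.

End generic.

Section ladyzhenskaya.
Variable R : realType.
Local Notation mu := (leb3 R).
Local Notation lam := (@lebesgue_measure R).
Local Notation lam2 := (@leb2 R).
Implicit Types (f g phi : R3 R -> R) (i j : 'I_3).

(** g(t)^2 is the integral of (g^2)' = 2 g g' from a point left of the support up to t. *)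
Lemma sup_le_integral_deriv (g dg : R -> R) (r : R) : (forall t : R, is_derive t 1 g (dg t)) ->
  continuous dg -> (forall t : R, r < `|t| -> g t = 0) ->
  forall t, ((g t ^+ 2)%:E <= \int[lam]_s (`|2 * (g s * dg s)|)%:E)%E.
Proof.
move=> gd cdg g0 t.
have gc := is_derive_cont gd.
have I0 : (0 <= \int[lam]_s (`|2 * (g s * dg s)|)%:E)%E by apply: integral_ge0 => s _; rewrite lee_fin.
have [rt|tr] := ltP r `|t|; first by rewrite g0// expr0n.
(* This point lies to the left of the support and of [t], because |t| <= r in this branch. *)
pose s : R := - (`|r| + 1).
have st : s < t.
  have := ler_norm (- t); have := ler_norm r; rewrite normrN /s => h1 h2; lra.
have s0 : g s = 0.
  by apply: g0; rewrite /s normrN ger0_norm ?addr_ge0// (le_lt_trans (ler_norm r))// ltrDl.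
pose h (u : R) : R := 2 * (g u * dg u).
have ch : continuous h.
  by move=> u; apply: cvgMr; apply: cvgM; [exact: gc|exact: cdg].
have E : (\int[lam]_(u in `[s, t]) (h u)%:E = (g t ^+ 2)%:E)%E.
  have g2d (u : R) : is_derive u (1 : R) (fun u => g u ^+ 2) (h u).
    have := is_deriveM (gd u) (gd u) => H.
    apply: (@is_derive_eq _ _ _ (g * g) _ _ _ _ H).
    by rewrite /h /GRing.scale/=; ring.
  rewrite (@continuous_FTC2 _ _ (fun u => g u ^+ 2))//.
  - by rewrite s0 expr0n/= sube0.
  - exact: continuous_subspaceT.
  - have c2 := is_derive_cont g2d.
    split; [by move=> u _; case: (g2d u)|apply: cvg_at_right_filter; exact: c2|apply: cvg_at_left_filter; exact: c2].
  - by move=> u _; rewrite derive1E; have [_ ->] := g2d u.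
have mh : measurable_fun setT (EFin \o h) by apply/measurable_EFinP; exact: continuous_measurable_fun.
rewrite -E (le_trans (lee_abs _))// (le_trans (le_abse_integral _ _ _))//.
  exact: measurable_funS mh.
by apply: ge0_subset_integral => //; exact: measurableT_comp.
Qed.

Lemma line_sqr_le f i (x : R3 R) : csupp f -> Ck 1 f ->
  ((f x ^+ 2)%:E <= \int[lam]_t (`|2 * (f (upd i x t) * partial i f (upd i x t))|)%:E)%E.
Proof.
move=> [r fr] Cf; rewrite -[in leLHS](upd_crd i x).
apply: (@sup_le_integral_deriv (fun t => f (upd i x t)) (fun t => partial i f (upd i x t)) r).
- by move=> t; apply: is_derive_upd; exact: Ck_derivable Cf.
- move=> t; apply: continuous_comp; first exact: upd_continuous.
  exact: Ck_cont (Ck_partial i Cf) _.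
- move=> t rt; apply: fr => /(crd_cube i); rewrite crd_upd => /(lt_le_trans rt).
  by rewrite ltxx.
Qed.

Let Dpart f i : R := \int[mu]_x (partial i f x ^+ 2).

(** 4 s0 s1 <= 2 (s0^2 + s1^2) <= 2 n (d0 + d1). Here n is the integral of f^2 over a slice;
    replacing it by [K], which does not depend on the slice, allows integration over the slices. *)
Lemma lady_arith0 (n K d0 d1 s0 s1 : R) : n <= K -> 0 <= d0 -> 0 <= d1 ->
  s0 ^+ 2 <= n * d0 -> s1 ^+ 2 <= n * d1 -> 2 * s0 * (2 * s1) <= 2 * K * (d0 + d1).
Proof.
move=> nK d00 d10 cs0 cs1.
have h1 : n * d0 <= K * d0 by exact: ler_wpM2r.
have h2 : n * d1 <= K * d1 by exact: ler_wpM2r.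
have := sqr_ge0 (s0 - s1); nra.
Qed.

(* On the slice z = const, f^2 is at most the line integral of |2 f d_0 f| and
   that of |2 f d_1 f|, so f^4 is bounded by a product of a function of y and a
   function of x. *)
Lemma ladyzhenskaya_aux f (K : R) : csupp f -> Ck 1 f ->
  K = \int[mu]_x `|2 * (f x * partial 2%:R f x)| ->
  \int[mu]_x (f x ^+ 4) <= \int[mu]_x (2 * K * (partial 0 f x ^+ 2 + partial 1 f x ^+ 2)).
Proof.
move=> sf Cf KE.
have cf : cc f by split => //; exact: Ck_cont Cf.
have cd i : cc (partial i f) by exact: cc_partial.
have cX n g : cc g -> cc (fun x => g x ^+ n.+1).
  move=> cg; elim: n => [//|n IH]; under eq_fun do rewrite exprS.
  by apply: ccMl => //; case: IH.
have cn i : cc (fun x => `|2 * (f x * partial i f x)|).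
  have [c0 [r s0]] : cc (fun x => 2 * (f x * partial i f x)) by apply: ccZ; apply: ccMl => //; case: (cd i).
  split; last by exists r => x /s0 ->; rewrite normr0.
  by move=> x; apply: cvg_norm; exact: c0.
have mE g : cc g -> measurable_fun [set: R3 (measurableTypeR R)] (fun x => (g x)%:E).
  by case=> cg _; apply/measurable_EFinP; exact: continuous_R3_measurable.
have K0 : 0 <= K by rewrite KE; apply: Rintegral_ge0.
have cg : cc (fun x => 2 * K * (partial 0 f x ^+ 2 + partial 1 f x ^+ 2)).
  by apply: ccZ; apply: ccD; exact: (cX 1%N).
have c4 := cX 3%N _ cf; have c2 := cX 1%N _ cf.
have cd2 i := cX 1%N _ (cd i).
suff : (\int[mu]_x (f x ^+ 4)%:E <= \int[mu]_x (2 * K * (partial 0 f x ^+ 2 + partial 1 f x ^+ 2))%:E)%E.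
  by apply: fine_le; apply: integrable_fin_num => //; exact: cc_integrable.
rewrite (leb3_tonelli2 (mE _ c4)); last by move=> x; rewrite lee_fin exprn_even_ge0.
rewrite (leb3_tonelli2 (mE _ cg)); last first.
  by move=> x; rewrite lee_fin !mulr_ge0// addr_ge0// sqr_ge0.
have f40 x : (0 <= (f x ^+ 4)%:E)%E by rewrite lee_fin exprn_even_ge0.
have g0 x : (0 <= (2 * K * (partial 0 f x ^+ 2 + partial 1 f x ^+ 2))%:E)%E.
  by rewrite lee_fin !mulr_ge0// addr_ge0// sqr_ge0.
apply: ae_ge0_le_integral => //.
- by move=> z _; apply: integral_ge0.
- exact: (@measurable_fun_fubini_tonelli_G _ _ _ _ R lam2 _ (mE _ c4) f40).
- by move=> z _; apply: integral_ge0.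
- exact: (@measurable_fun_fubini_tonelli_G _ _ _ _ R lam2 _ (mE _ cg) g0).
have I2 g : cc g -> {ae lam, forall z, lam2.-integrable setT (fun x => (g (x, z))%:E)}.
  by move=> /cc_integrable ig; exact: (@ae_integrable2 _ _ _ _ R lam2 lam _ ig).
have lamF : Filter (nbhs (almost_everywhere lam)) by exact: ae_filter_ringOfSetsType.
apply: (@filterS3 _ _ lamF) (I2 _ c2) (I2 _ (cd2 0)) (I2 _ (cd2 1)) => z if2 id0 id1 _.
have ms g : cc g -> measurable_fun setT ((fun x => g (x, z)) : (measurableTypeR R * measurableTypeR R)%type -> R).
  by case=> cg' _; apply: measurable_fun_pair1; exact: continuous_R3_measurable.
have [i0 cs0] := cauchy_schwarz (ms _ cf) (ms _ (cd 0)) if2 id0.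
have [i1 cs1] := cauchy_schwarz (ms _ cf) (ms _ (cd 1)) if2 id1.
pose n : R := \int[lam2]_x (f (x, z) ^+ 2).
pose d0 : R := \int[lam2]_x (partial 0 f (x, z) ^+ 2).
pose d1 : R := \int[lam2]_x (partial 1 f (x, z) ^+ 2).
pose s0 : R := \int[lam2]_x `|f (x, z) * partial 0 f (x, z)|.
pose s1 : R := \int[lam2]_x `|f (x, z) * partial 1 f (x, z)|.
have {}cs0 : s0 ^+ 2 <= n * d0 := cs0.
have {}cs1 : s1 ^+ 2 <= n * d1 := cs1.
have nE : (\int[lam2]_x (f (x, z) ^+ 2)%:E = n%:E)%E.
  by rewrite /n /Rintegral fineK//; exact: integrable_fin_num.
have SE i (s : R) : lam2.-integrable setT (EFin \o (fun x => f (x, z) * partial i f (x, z))) ->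
    s = (\int[lam2]_x `|f (x, z) * partial i f (x, z)|)%R ->
    (\int[lam2]_x `|2 * (f (x, z) * partial i f (x, z))|%:E = (2 * s)%:E)%E.
  move=> ii ->; rewrite -RintegralZl//; last exact: integrable_norm.
  rewrite /Rintegral fineK; last first.
    apply: integrable_fin_num => //.
    by apply: (@integrableZl _ _ _ lam2 setT measurableT 2 (fun x => (`|f (x, z) * partial i f (x, z)|)%:E)); exact: integrable_norm.
  by apply: eq_integral => x _; rewrite normrM ger0_norm.
(* At each point of the slice f^2 is at most the integral of |2 f d_2 f| along the vertical line;
   integrating this over the plane gives a bound uniform in [z]. *)
have nK : n <= K.
  rewrite -lee_fin -nE KE /Rintegral fineK; last by apply: integrable_fin_num => //; exact: cc_integrable.
  rewrite leb3_tonelli1//; last exact: mE.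
  apply: ge0_le_integral => //.
  - by move=> x _; rewrite lee_fin sqr_ge0.
  - by apply/measurable_EFinP; exact: (ms _ c2).
  - apply: (@measurable_fun_fubini_tonelli_F _ _ _ _ R lam _ (mE _ (cn _))).
    by move=> x; rewrite lee_fin.
  - by move=> [x y] _; exact: (line_sqr_le 2%:R ((x, y), z) sf Cf).
have -> : (\int[lam2]_x (2 * K * (partial 0 f (x, z) ^+ 2 + partial 1 f (x, z) ^+ 2))%:E = (2 * K * (d0 + d1))%:E)%E.
  exact: (integral_lin2 (2 * K) id0 id1).
pose a0 (y : measurableTypeR R) := (\int[lam]_x `|2 * (f ((x, y), z) * partial 0 f ((x, y), z))|%:E)%E.
pose a1 (x : measurableTypeR R) := (\int[lam]_y `|2 * (f ((x, y), z) * partial 1 f ((x, y), z))|%:E)%E.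
have mn i : measurable_fun setT ((fun x => (`|2 * (f (x, z) * partial i f (x, z))|)%:E) : (measurableTypeR R * measurableTypeR R)%type -> \bar R).
  by apply/measurable_EFinP; exact: (ms _ (cn i)).
have n0 i (x : (measurableTypeR R * measurableTypeR R)%type) : (0 <= (`|2 * (f (x, z) * partial i f (x, z))|)%:E)%E by rewrite lee_fin.
have ma0 : measurable_fun setT a0 by exact: (@measurable_fun_fubini_tonelli_G _ _ _ _ R lam _ (mn 0) (n0 0)).
have ma1 : measurable_fun setT a1 by exact: (@measurable_fun_fubini_tonelli_F _ _ _ _ R lam _ (mn 1) (n0 1)).
have A0 : (\int[lam]_y a0 y = (2 * s0)%:E)%E.
  exact: (eq_trans (esym (@fubini_tonelli2 _ _ _ _ R lam lam _ (mn 0) (n0 0))) (SE 0 s0 i0 erefl)).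
have A1 : (\int[lam]_x a1 x = (2 * s1)%:E)%E.
  exact: (eq_trans (esym (@fubini_tonelli1 _ _ _ _ R lam lam _ (mn 1) (n0 1))) (SE 1 s1 i1 erefl)).
have mf4 : measurable_fun setT ((fun x => (f (x, z) ^+ 4)%:E) : (measurableTypeR R * measurableTypeR R)%type -> \bar R).
  by apply/measurable_EFinP; exact: (ms _ c4).
have a00 y : (0 <= a0 y)%E by apply: integral_ge0 => x _; exact: n0.
have a10 x : (0 <= a1 x)%E by apply: integral_ge0 => y _; exact: n0.
have Fab (x y : measurableTypeR R) : ((f ((x, y), z) ^+ 4)%:E <= a0 y * a1 x)%E.
  have -> : f (x, y, z) ^+ 4 = f (x, y, z) ^+ 2 * f (x, y, z) ^+ 2 by rewrite -exprD.
  rewrite EFinM; apply: lee_pmul.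
  - by rewrite lee_fin sqr_ge0.
  - by rewrite lee_fin sqr_ge0.
  - exact: (line_sqr_le 0 ((x, y), z) sf Cf).
  - exact: (line_sqr_le 1 ((x, y), z) sf Cf).
have H : (\int[lam2]_x (f (x, z) ^+ 4)%:E <= (2 * s0)%:E * (2 * s1)%:E)%E.
  exact: (@slice_product R _ _ _ _ lam lam (fun x => (f (x, z) ^+ 4)%:E) a0 a1 _ _ mf4 ma0 ma1
    (fun x => f40 (x, z)) a00 a10 Fab A0 A1).
apply: (le_trans H).
rewrite -EFinM lee_fin.
have d00 : 0 <= d0 by apply: Rintegral_ge0 => x _; exact: sqr_ge0.
have d10 : 0 <= d1 by apply: Rintegral_ge0 => x _; exact: sqr_ge0.
exact: (lady_arith0 nK d00 d10 cs0 cs1).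
Qed.

(** Here F is the integral of f^4, n that of f^2, k that of |f d_2 f|, and a, b, c those of the
    squared derivatives. Squaring F <= 4 k (a + b) and using k^2 <= n c leaves 16 n c (a + b)^2, at
    most 16 n (a + b + c)^3. *)
Lemma lady_arith (n F k a b c : R) : 0 <= n -> 0 <= F -> 0 <= k -> 0 <= a -> 0 <= b -> 0 <= c ->
  k ^+ 2 <= n * c -> F <= 2 * (2 * k) * (a + b) -> F ^+ 2 <= 16 * n * (a + b + c) ^+ 3.
Proof.
move=> n0 F0 k0 a0 b0 c0 kc FK.
have h : F ^+ 2 <= (2 * (2 * k) * (a + b)) ^+ 2 by rewrite ler_sqr ?nnegrE// !mulr_ge0// addr_ge0.
rewrite (le_trans h)//.
have -> : (2 * (2 * k) * (a + b)) ^+ 2 = 16 * (k ^+ 2 * (a + b) ^+ 2) by ring.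
rewrite -mulrA ler_wpM2l//.
apply: (@le_trans _ _ (n * c * (a + b) ^+ 2)); first by rewrite ler_wpM2r ?sqr_ge0.
rewrite -mulrA ler_wpM2l// exprS ler_pM ?sqr_ge0 ?lerDr ?addr_ge0//.
by rewrite ler_sqr ?nnegrE ?addr_ge0// lerDl.
Qed.

Lemma ladyzhenskaya f : csupp f -> Ck 1 f ->
  (\int[mu]_x (f x ^+ 4)) ^+ 2 <=
  16 * (\int[mu]_x (f x ^+ 2)) * (\sum_i \int[mu]_x (partial i f x ^+ 2)) ^+ 3.
Proof.
move=> sf Cf.
have cf : cc f by split => //; exact: Ck_cont Cf.
have cd i : cc (partial i f) by exact: cc_partial.
have cs g : cc g -> cc (fun x => g x ^+ 2) by move=> cg; apply: ccMl => //; case: cg.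
pose k : R := \int[mu]_x `|f x * partial 2%:R f x|.
have [i2 cs2] := cauchy_schwarz (continuous_R3_measurable (proj1 cf)) (continuous_R3_measurable (proj1 (cd 2%:R)))
  (cc_integrable (cs _ cf)) (cc_integrable (cs _ (cd 2%:R))).
have k0 : 0 <= k by apply: Rintegral_ge0.
have KE : 2 * k = \int[mu]_x `|2 * (f x * partial 2%:R f x)|.
  rewrite -RintegralZl//; last exact: integrable_norm.
  by apply: eq_Rintegral => x _; rewrite [RHS]normrM [in RHS]ger0_norm.
have := ladyzhenskaya_aux sf Cf KE.
rewrite intZ; last by apply: ccD; exact: cs.
rewrite intD; [|exact: cs..].
have f40 : 0 <= \int[mu]_x (f x ^+ 4) by apply: Rintegral_ge0 => x _; rewrite exprn_even_ge0.
have D0 i : 0 <= Dpart f i by apply: Rintegral_ge0 => x _; exact: sqr_ge0.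
rewrite !big_ord_recr big_ord0/= add0r.
have E3 : [/\ (widen_ord (leqnSn 2) (widen_ord (leqnSn 1) ord_max)) = 0 :> 'I_3,
   widen_ord (leqnSn 2) ord_max = 1 :> 'I_3 & ord_max = 2%:R :> 'I_3] by split; exact/val_inj.
have [-> -> ->] := E3.
move=> FK; apply: (lady_arith _ f40 k0 (D0 0) (D0 1) (D0 2%:R) cs2 FK).
by apply: Rintegral_ge0 => x _; exact: sqr_ge0.
Qed.

End ladyzhenskaya.

(** * The differential inequality *)

Section ode.
Variable R : realType.
Local Notation lam := (@lebesgue_measure R).
Implicit Types f g : R -> R.

Definition prim f (t : R) : R := \int[lam]_(s in `[0, t]) f s.

Lemma prim_deriv f (t : R) : continuous f -> 0 < t -> is_derive t (1 : R) (prim f) (f t).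
Proof.
move=> cf t0.
have i : lam.-integrable `[0, t + 1] (EFin \o f).
  apply: continuous_compact_integrable; first exact: segment_compact.
  exact: continuous_subspaceT.
have tt : t < t + 1 by rewrite ltrDl.
have [d1 d2] := continuous_FTC1_closed tt i t0 (cf t).
by apply: DeriveDef; [exact: d1|rewrite -derive1E; exact: d2].
Qed.

(** The interval is empty, so the integral is 0. Together with [prim0] this makes [prim f]
    continuous on the whole line, as the monotonicity lemma below demands. *)
Lemma prim_neg f (t : R) : t < 0 -> prim f t = 0.
Proof. by move=> t0; rewrite /prim set_itv_ge ?Rintegral_set0// bnd_simp -ltNge. Qed.

Lemma prim0 f : prim f 0 = 0.
Proof. by rewrite /prim set_itv1 Rintegral_set1. Qed.

Lemma is_derive_continuous_at g (t d : R) : is_derive t (1 : R) g d -> continuous_at t g.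
Proof. by move=> [gd _]; apply: differentiable_continuous; apply/derivable1_diffP. Qed.

Lemma prim_continuous f : continuous f -> continuous (prim f).
Proof.
move=> cf t; have [t0|t0|->] := ltgtP t 0.
- have H : \forall s \near t, prim f s = 0.
    near=> s; apply: prim_neg; near: s; exact: (cvgr_lt t (@cvg_id _ (nbhs t))).
  by rewrite /continuous_at prim_neg//; apply: cvg_near_cst.
- exact: is_derive_continuous_at (prim_deriv cf t0).
have i : lam.-integrable `[0, 1] (EFin \o f).
  apply: continuous_compact_integrable; first exact: segment_compact.
  exact: continuous_subspaceT.
have := parameterized_integral_continuous (@ler01 R) i.
move=> /(continuous_within_itvP _ (@ltr01 R))[_ cr _].
rewrite /continuous_at prim0; apply/cvgrPdist_le => e e0.
move/cvgrPdist_le : cr => /(_ e e0).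
rewrite near_withinE; apply: filterS => s hs.
have [s0|s0|->] := ltgtP s 0; last by rewrite prim0 subrr normr0 ltW.
  by rewrite prim_neg// subrr normr0 ltW.
have := hs s0; rewrite /parameterized_integral -/(prim f s) -[X in X - _]/(prim f 0) prim0.
exact.
Unshelve. all: by end_near. Qed.

Lemma is_derive_approx g (s d e : R) : is_derive s (1 : R) g d -> 0 < e ->
  exists2 r : R, 0 < r & forall t, `|t - s| < r -> `|g t - g s - d * (t - s)| <= e * `|t - s|.
Proof.
move=> [gd gE] e0.
have := gd; rewrite /derivable => /cvg_ex[l hl].
have dl : l = d by rewrite -gE /derive; apply/esym/cvg_lim.
rewrite {}dl in hl.
move/cvgrPdist_le : hl => /(_ e e0); rewrite near_withinE => /nbhs_ballP[r /= r0 hr].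
exists r => // t tr; have [->|ts] := eqVneq t s; first by rewrite !subrr mulr0 subrr normr0 mulr0.
have ts0 : t - s != 0 by rewrite subr_eq0.
have : `|d - (t - s)^-1 *: (g ((t - s) *: 1 + s) - g s)| <= e.
  by apply: hr => //; rewrite /ball /= sub0r normrN.
rewrite scaler1 subrK /GRing.scale/= => h.
have -> : g t - g s - d * (t - s) = - ((d - (t - s)^-1 * (g t - g s)) * (t - s)) by field.
by rewrite normrN normrM ler_wpM2r.
Qed.

Lemma continuous_at_approx g (s e : R) : continuous_at s g -> 0 < e ->
  exists2 r : R, 0 < r & forall t, `|t - s| < r -> `|g t - g s| <= e.
Proof.
move=> cg e0; have /cvgrPdist_le/(_ e e0)/nbhs_ballP[r /= r0 h] := cg.
by exists r => // t tr; rewrite distrC; apply: h; rewrite /ball /= distrC.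
Qed.

(** Only an upper bound on right difference quotients is assumed, and only at interior points. For a
    small slope e', the last time up to t1 at which k t <= k a + e' (t - a) cannot precede t1, since
    the assumption would extend it; the left end 0 is reached by continuity. *)
Lemma dini_nonincreasing (k : R -> R) (t1 : R) : 0 <= t1 -> continuous k ->
  (forall s e : R, 0 < s < t1 -> 0 < e ->
    exists2 r : R, 0 < r & forall t, s < t < s + r -> t <= t1 -> k t - k s <= e * (t - s)) ->
  k t1 <= k 0.
Proof.
move=> t10 ck dk; move: t10; rewrite le_eqVlt => /orP[/eqP <-//|t10].
suff H a : 0 < a < t1 -> k t1 <= k a.
  rewrite leNgt; apply/negP => kk.
  have e0 : 0 < (k t1 - k 0) / 2 by rewrite divr_gt0// subr_gt0.
  have [r r0 hr] := continuous_at_approx (ck 0) e0.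
  pose a : R := Num.min (r / 2) (t1 / 2).
  have a0 : 0 < a by rewrite lt_min !divr_gt0.
  have at1 : a < t1 by rewrite gt_min [t1 / 2 < _]ltr_pdivrMr ?mulr2n//; apply/orP; right; lra.
  have ar : a < r by rewrite gt_min; apply/orP; left; rewrite ltr_pdivrMr//; lra.
  have := hr a; rewrite subr0 (gtr0_norm a0) => /(_ ar); rewrite ler_norml => /andP[_ h].
  have : k t1 <= k a by apply: H; rewrite a0.
  move: h; move: (k t1) (k a) (k 0) kk => u v z; lra.
move=> /andP[a0 at1]; apply/(@ler_addgt0Pr R) => e e0.
pose e' : R := e / (t1 - a).
have e'0 : 0 < e' by rewrite divr_gt0// subr_gt0.
pose phi (t : R) : R := k t - k a - e' * (t - a).
suff : phi t1 <= 0 by rewrite /phi /e' divfK ?gt_eqF ?subr_gt0//; lra.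
have cphi : continuous phi.
  move=> t; apply: cvgB; first by apply: cvgB; [exact: ck|exact: cvg_cst].
  by apply: cvgMr; apply: cvgB; [exact: cvg_id|exact: cvg_cst].
rewrite leNgt; apply/negP => p1.
pose S : set R := [set t | a <= t <= t1 /\ phi t <= 0].
have Sa : S a by split; [rewrite lexx ltW|rewrite /phi !subrr mulr0 subrr].
have ubS : ubound S t1 by move=> t [/andP[]].
have hS : has_sup S by split; [exists a|exists t1].
pose s := sup S.
have as_ : a <= s by apply: ub_le_sup => //; exists t1.
have st1 : s <= t1 by apply: ge_sup => //; exists a.
have ps : phi s <= 0.
  rewrite leNgt; apply/negP => p0.
  have [r r0 hr] := continuous_at_approx (cphi s) (divr_gt0 p0 (ltr0Sn _ 1)).
  have [u Su us] := sup_adherent r0 hS.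
  have uls : u <= s by apply: ub_le_sup => //; exists t1.
  have := hr u; rewrite ler0_norm ?subr_le0// => h.
  have {}h : `|phi u - phi s| <= phi s / 2 by apply: h; rewrite -/s in us; lra.
  by case: Su => _ pu; move: h; rewrite ler_norml => /andP[]; lra.
have {}st1 : s < t1.
  by rewrite lt_neqAle st1 andbT; apply/eqP => E; move: p1; rewrite -E ltNge ps.
have [r r0 hr] := dk s e' (introT andP (conj (lt_le_trans a0 as_) st1)) e'0.
pose t : R := Num.min (s + r / 2) t1.
have st : s < t by rewrite lt_min st1 ltrDl divr_gt0.
have tt1 : t <= t1 by rewrite ge_min lexx orbT.
have tr : t < s + r by rewrite gt_min ltrD2l ltr_pdivrMr//; apply/orP; left; lra.
have kt : k t - k s <= e' * (t - s) by apply: hr => //; rewrite st.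
have : S t.
  split; first by rewrite tt1 (le_trans as_) ?ltW.
  by move: ps; rewrite /phi; move: (k t) (k s) (k a) kt => x y z; nra.
by move=> St; have := ub_le_sup hS.2 St; rewrite -/s leNgt st.
Qed.

(** In [key] the increment of X = w^4 is bounded with w s + d and A s + d in place of w s and A s;
    continuity in d keeps the loss below e. The exponent 8 comes from X' <= C0 X^2. *)
Lemma poly8_approx (C A x e : R) : 0 < e -> exists2 d : R, 0 < d &
  C * (x + d) ^+ 8 * (A + d) <= C * x ^+ 8 * A + e.
Proof.
move=> e0; pose q (d : R) : R := C * (x + d) ^+ 8 * (A + d).
have cq : continuous q.
  move=> d; apply: cvgM; last by apply: cvgD; [exact: cvg_cst|exact: cvg_id].
  apply: cvgMr; apply: (@continuous_comp _ _ _ (fun d => x + d) (fun y : R => y ^+ 8)).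
    by apply: cvgD; [exact: cvg_cst|exact: cvg_id].
  exact: exprn_continuous.
have [r r0 hr] := continuous_at_approx (cq 0) e0.
exists (r / 2); first by rewrite divr_gt0.
have := hr (r / 2); rewrite subr0 gtr0_norm ?divr_gt0// ltr_pdivrMr// => h.
have {}h : `|q (r / 2) - q 0| <= e by apply: h; lra.
by move: h; rewrite /q !addr0 ler_norml => /andP[_]; lra.
Qed.

(* Only increments of w are controlled, so w need not be differentiable and the
   monotonicity argument goes through one-sided difference quotients. *)
Section core.
Variables (C0 g t1 : R) (w : R -> R).
Hypothesis C00 : 0 < C0.
Hypothesis gC : C0 <= g.
Hypothesis t10 : 0 <= t1.
Hypothesis cw : continuous w.
Hypothesis w0 : forall t, 0 <= w t.
Hypothesis dw : forall s t M : R, 0 < s -> s < t -> t <= t1 ->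
  (forall u, s <= u <= t -> w u <= M) -> w t ^+ 2 - w s ^+ 2 <= C0 / 2 * (t - s) * M ^+ 6.

Let X (t : R) : R := w t ^+ 4.
Let I := prim X.
Let E (t : R) : R := expR (g * I t).
Let J := prim E.
Let D (t : R) : R := 1 + (g - C0) * X 0 * J t.

Let X0 t : 0 <= X t. Proof. by rewrite exprn_ge0. Qed.

Let cX : continuous X.
Proof. by move=> t; apply: (@continuous_comp _ _ _ w (fun y : R => y ^+ 4)); [exact: cw|exact: exprn_continuous]. Qed.

Let cI : continuous I. Proof. exact: prim_continuous. Qed.

Let cexp (c : R) : continuous (fun t => expR (c * I t)).
Proof.
move=> t; apply: (@continuous_comp _ _ _ (fun t => c * I t) expR); last exact: continuous_expR.
by apply: cvgMr; exact: cI.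
Qed.

Let cE : continuous E. Proof. exact: cexp. Qed.
Let cJ : continuous J. Proof. exact: prim_continuous. Qed.

Let cD : continuous D.
Proof. by move=> t; apply: cvgD; [exact: cvg_cst|apply: cvgMr; exact: cJ]. Qed.

Let dI (t : R) : 0 < t -> is_derive t (1 : R) I (X t). Proof. exact: prim_deriv. Qed.

Let dexp (c t : R) : 0 < t -> is_derive t (1 : R) (fun t => expR (c * I t)) (expR (c * I t) * (c * X t)).
Proof.
move=> t0; apply: (@is_derive1_comp R expR (fun t => c * I t)).
have := is_deriveZ c (dI t0); exact.
Qed.

Let dJ (t : R) : 0 < t -> is_derive t (1 : R) J (E t). Proof. exact: prim_deriv. Qed.

Let dD (t : R) : 0 < t -> is_derive t (1 : R) D ((g - C0) * X 0 * E t).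
Proof.
move=> t0; have := is_deriveD (is_derive_cst (1 : R) t 1) (is_deriveZ ((g - C0) * X 0) (dJ t0)).
by rewrite add0r.
Qed.

Let D1 t : 1 <= D t.
Proof.
have J0 : 0 <= J t by apply: Rintegral_ge0 => s _; exact: expR_ge0.
by rewrite lerDl !mulr_ge0// subr_ge0.
Qed.

(** This is X' <= C0 X^2 in incremental form: w^4 increases by the increment of w^2 times a sum of
    two squares, and that sum is at most 2 M^2. *)
Let dX (s t M : R) : 0 < s -> s < t -> t <= t1 -> 0 <= M ->
  (forall u, s <= u <= t -> w u <= M) -> X t - X s <= C0 * (t - s) * M ^+ 8.
Proof.
move=> s0 st tt1 M0 h; have := dw s0 st tt1 h.
have ws : w s ^+ 2 <= M ^+ 2 by rewrite ler_sqr ?nnegrE//; apply: h; rewrite lexx ltW.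
have wt : w t ^+ 2 <= M ^+ 2 by rewrite ler_sqr ?nnegrE//; apply: h; rewrite lexx ltW.
have -> : X t - X s = (w t ^+ 2 - w s ^+ 2) * (w t ^+ 2 + w s ^+ 2) by rewrite /X; ring.
move=> h1; apply: (@le_trans _ _ (C0 / 2 * (t - s) * M ^+ 6 * (w t ^+ 2 + w s ^+ 2))).
  by rewrite ler_wpM2r ?addr_ge0 ?sqr_ge0.
have -> : C0 * (t - s) * M ^+ 8 = C0 / 2 * (t - s) * M ^+ 6 * (M ^+ 2 + M ^+ 2) by field.
rewrite ler_wpM2l ?lerD// !mulr_ge0 ?exprn_ge0 ?subr_ge0 ?invr_ge0// ltW//.
Qed.

(** With G = (g - C0) X(0) exp((g - C0) I), one has A' = -C0 X A + G and B' = X G. Under X' <= C0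
    X^2 all terms of (X A - B)' cancel, which is the reason for this pair. *)
Let A (t : R) : R := expR (- C0 * I t) * D t.
Let B (t : R) : R := X 0 * expR ((g - C0) * I t).

Let A0 t : 0 <= A t.
Proof. by rewrite mulr_ge0 ?expR_ge0// (le_trans ler01). Qed.

Let dA (t : R) : 0 < t -> is_derive t (1 : R) A
  (- C0 * X t * A t + (g - C0) * X 0 * expR ((g - C0) * I t)).
Proof.
move=> t0; have H := is_deriveM (dexp (- C0) t0) (dD t0).
apply: (@is_derive_eq _ _ _ ((fun t => expR (- C0 * I t)) * D) _ _ _ _ H).
rewrite /GRing.scale/= /A /E (_ : (g - C0) * I t = - C0 * I t + g * I t); last by ring.
by rewrite expRD; ring.
Qed.

Let dB (t : R) : 0 < t -> is_derive t (1 : R) B (X 0 * (expR ((g - C0) * I t) * ((g - C0) * X t))).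
Proof. by move=> t0; have := is_deriveZ (X 0) (dexp (g - C0) t0); exact. Qed.

Let key : X t1 * A t1 - B t1 <= X 0 * A 0 - B 0.
Proof.
apply: (@dini_nonincreasing (fun t => X t * A t - B t)) => //.
  move=> t; apply: cvgB; first by apply: cvgM; [exact: cX|apply: cvgM; [exact: cexp|exact: cD]].
  by apply: cvgMr; exact: cexp.
move=> s e /andP[s0 st1] e0.
have e2 : 0 < e / 2 by rewrite divr_gt0.
have [d d0 hd] := poly8_approx C0 (A s) (w s) e2.
(* The error in A is multiplied by X s and that in B by 1, so this share adds up to e/2;
   [poly8_approx] spends the other half. *)
have m0 : 0 < e / 2 / (X s + 1) by rewrite divr_gt0// ltr_wpDl.
have [r1 r10 h1] := is_derive_approx (dA s0) m0.
have [r2 r20 h2] := is_derive_approx (dB s0) (divr_gt0 m0 (ltr0Sn _ 0)).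
have [r3 r30 h3] := continuous_at_approx (is_derive_continuous_at (dA s0)) d0.
have [r4 r40 h4] := continuous_at_approx (@cw s) d0.
exists (Num.min (Num.min r1 r2) (Num.min r3 r4)); first by rewrite !lt_min r10 r20 r30 r40.
move=> t /andP[st]; rewrite -ltrBlDl !lt_min => /andP[/andP[tr1 tr2] /andP[tr3 tr4]] tt1.
have ts0 : 0 < t - s by rewrite subr_gt0.
have tsN : `|t - s| = t - s by rewrite gtr0_norm.
have H1 := h1 t; rewrite tsN in H1; have {}H1 := H1 tr1.
have H2 := h2 t; rewrite tsN divr1 in H2; have {}H2 := H2 tr2.
have H3 := h3 t; rewrite tsN in H3; have {}H3 := H3 tr3.
have HX : X t - X s <= C0 * (t - s) * (w s + d) ^+ 8.
  apply: dX => //; first by rewrite addr_ge0// ltW.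
  move=> u /andP[su ut]; have := h4 u; rewrite ger0_norm ?subr_ge0// => h.
  have {}h : `|w u - w s| <= d by apply: h; lra.
  by move: h; rewrite ler_norml => /andP[_]; lra.
have Xs0 := X0 s; have As0 := A0 s; have At0 := A0 t.
have Bs : X 0 * (expR ((g - C0) * I s) * ((g - C0) * X s)) = X s * ((g - C0) * X 0 * expR ((g - C0) * I s)) by ring.
rewrite Bs in H2.
have Xw : X s * X s = w s ^+ 8 by rewrite /X -exprD.
move: H1 H2; move: ((g - C0) * X 0 * expR _) => G.
move: (A t) (A s) (B t) (B s) (X t) (X s) (t - s) H3 HX hd As0 At0 Xs0 m0 Xw ts0 => At As Bt Bs' Xt Xs h H3 HX hd As0 At0 Xs0 m0 Xw hp.
move: H3; rewrite ler_norml => /andP[_ H3].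
rewrite !ler_norml => /andP[_ H1] /andP[H2 _].
have E1 : (Xt - Xs) * At <= C0 * h * (w s + d) ^+ 8 * (As + d).
  apply: (@le_trans _ _ (C0 * h * (w s + d) ^+ 8 * At)); first exact: ler_wpM2r.
  apply: ler_wpM2l; last by lra.
  by rewrite !mulr_ge0 ?exprn_ge0 ?addr_ge0 ?(ltW d0) ?(ltW hp) ?(ltW C00).
have E1' : (Xt - Xs) * At <= h * (C0 * w s ^+ 8 * As + e / 2).
  apply: (le_trans E1); rewrite (_ : C0 * h * _ * _ = h * (C0 * (w s + d) ^+ 8 * (As + d))); last by ring.
  by rewrite ler_wpM2l// ltW.
have E2 : Xs * (At - As) <= Xs * ((- C0 * Xs * As + G) * h + e / 2 / (Xs + 1) * h).
  by apply: ler_wpM2l => //; lra.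
have -> : Xt * At - Bt - (Xs * As - Bs') = (Xt - Xs) * At + Xs * (At - As) - (Bt - Bs') by ring.
apply: (@le_trans _ _ (h * (C0 * w s ^+ 8 * As + e / 2) + Xs * ((- C0 * Xs * As + G) * h + e / 2 / (Xs + 1) * h) - (Xs * G * h - e / 2 / (Xs + 1) * h))).
  by apply: lerD; [exact: lerD|rewrite lerN2; lra].
rewrite -Xw le_eqVlt; apply/orP; left; apply/eqP; field.
by rewrite gt_eqF// ltr_wpDl.
Qed.

(** At time 0 the integrals I and J vanish, so X A - B starts at 0 and [key] gives X A <= B; the
    common factor exp(-C0 I) is then cancelled. *)
Lemma ode_bound4 : w t1 ^+ 4 * D t1 <= w 0 ^+ 4 * expR (g * I t1).
Proof.
have := key; rewrite /A /B /D /I /J !prim0 !mulr0 expR0 addr0 !mulr1 subrr subr_le0.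
rewrite (_ : (g - C0) * prim X t1 = - C0 * prim X t1 + g * prim X t1); last by ring.
rewrite expRD mulrCA [leRHS]mulrCA ler_pM2l ?expR_gt0//.
Qed.

Lemma ode_bound : w t1 <= w 0 * expR (g * I t1 / 4) / D t1 `^ (4^-1).
Proof.
have Dp : 0 < D t1 by rewrite (lt_le_trans ltr01).
rewrite ler_pdivlMr ?powR_gt0//.
rewrite -(@ler_pXn2r _ 4)// ?nnegrE ?mulr_ge0 ?powR_ge0 ?expR_ge0//.
rewrite !exprMn -expRM_natl (_ : 4%:R * (g * I t1 / 4) = g * I t1); last by field.
have -> : (D t1 `^ 4^-1) ^+ 4 = D t1.
  by rewrite -powR_mulrn ?powR_ge0// -powRrM mulVf ?pnatr_eq0// powRr1 ?(ltW Dp).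
exact: ode_bound4.
Qed.

End core.

Section core2.
Variables (C0 g t1 : R) (w : R -> R).
Hypothesis C00 : 0 < C0.
Hypothesis gC : C0 <= g.
Hypothesis t10 : 0 <= t1.
Hypothesis cw : continuous w.
Hypothesis w0 : forall t, 0 <= w t.
Hypothesis dw : forall s t M : R, 0 < s -> s < t -> t <= t1 ->
  (forall u, s <= u <= t -> w u <= M) -> w t ^+ 2 - w s ^+ 2 <= C0 / 2 * (t - s) * M ^+ 6.

Let X (t : R) : R := w t ^+ 4.
Let I := prim X.
Let cX : continuous X.
Proof. by move=> t; apply: (@continuous_comp _ _ _ w (fun y : R => y ^+ 4)); [exact: cw|exact: exprn_continuous]. Qed.
Let X0 t : 0 <= X t. Proof. by rewrite exprn_ge0. Qed.

Lemma ode_exp_lower (t : R) : 0 <= t -> t <= t1 -> 1 - C0 * X 0 * t <= expR (- C0 * I t).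
Proof.
move=> t0 tt1; pose G (s : R) : R := expR (- C0 * I s) + C0 * X 0 * s.
have dG (s : R) : 0 < s -> is_derive s (1 : R) G (expR (- C0 * I s) * (- C0 * X s) + C0 * X 0).
  move=> s0; apply: is_deriveD.
    apply: (@is_derive1_comp R expR (fun t => - C0 * I t)).
    by have := is_deriveZ (- C0) (prim_deriv cX s0); exact.
  have := is_deriveZ (C0 * X 0) (is_derive_id s (1 : R)).
  by rewrite /GRing.scale/= mulr1.
have cG : continuous G.
  move=> s; apply: cvgD; last by apply: cvgMr; exact: cvg_id.
  apply: (@continuous_comp _ _ _ (fun t => - C0 * I t) expR); last exact: continuous_expR.
  by apply: cvgMr; exact: prim_continuous cX _.
have : G 0 <= G t.
  apply: (@ger0_derive1_ndecr _ G 0 t) => //.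
  - by move=> s; rewrite in_itv/= => /andP[s0 _]; case: (dG s s0).
  - move=> s; rewrite in_itv/= => /andP[s0 st]; rewrite derive1E; have [_ ->] := dG s s0.
    have st1 : s <= t1 by rewrite (le_trans (ltW st)).
    (* With g = C0 the bracket D is 1; the final time is [s] instead of [t1]. *)
    have := @ode_bound4 C0 C0 s w C00 (lexx _) (ltW s0) cw w0
      (fun a b M a0 ab bs => dw a0 ab (le_trans bs st1)).
    rewrite subrr !mul0r addr0 mulr1 -/(X 0) -/(X s) -/I => h.
    have ef : expR (- C0 * I s) * X s <= X 0 by rewrite mulNr expRN ler_pdivrMl ?expR_gt0// mulrC.
    rewrite (_ : _ + _ = C0 * (X 0 - expR (- C0 * I s) * X s)); last by ring.
    by rewrite mulr_ge0 ?subr_ge0// ltW.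
  - exact: continuous_subspaceT.
by rewrite /G /I prim0 !mulr0 expR0 addr0; lra.
Qed.

(** With u = 1 - C0 X(0) t and p = (g - C0)/C0, the right side is Q = u^(-p), and Q' = (g - C0) X(0)
    u^(-g/C0) since p + 1 = g/C0. By [ode_exp_lower], 1/u >= exp(C0 I), so Q' >= D', while Q and D
    both start at 1. *)
Lemma ode_bound2 : C0 * X 0 * t1 < 1 ->
  1 + (g - C0) * X 0 * prim (fun t => expR (g * I t)) t1 <= ((1 - C0 * X 0 * t1) `^ ((g - C0) / C0))^-1.
Proof.
move=> ht1.
pose u (t : R) : R := 1 - C0 * X 0 * t.
have u0 t : t <= t1 -> 0 < u t.
  move=> tt; rewrite subr_gt0 (le_lt_trans _ ht1)// ler_wpM2l// mulr_ge0//; exact: ltW.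
pose p : R := (g - C0) / C0.
have p0 : 0 <= p by rewrite divr_ge0 ?subr_ge0// ltW.
pose Q (t : R) : R := expR (- p * ln (u t)).
have du (t : R) : is_derive t (1 : R) u (- (C0 * X 0)).
  have := is_derive_affine (- (C0 * X 0)) 1 t.
  by rewrite (_ : (fun h => - (C0 * X 0) * h + 1) = u)//; apply/funext => h; rewrite /u mulNr addrC.
have dQ (t : R) : t <= t1 -> is_derive t (1 : R) Q (Q t * (- p * ((u t)^-1 * - (C0 * X 0)))).
  move=> tt; apply: (@is_derive1_comp R expR (fun t => - p * ln (u t))).
  have H := @is_derive1_comp R (@ln R) u t _ _ (is_derive1_ln (u0 t tt)) (du t).
  by have := is_deriveZ (- p) H; exact.
have cE : continuous (fun t => expR (g * I t)).
  move=> t; apply: (@continuous_comp _ _ _ (fun t => g * I t) expR); last exact: continuous_expR.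
  by apply: cvgMr; exact: prim_continuous cX _.
pose D (t : R) : R := 1 + (g - C0) * X 0 * prim (fun t => expR (g * I t)) t.
have dD (t : R) : 0 < t -> is_derive t (1 : R) D ((g - C0) * X 0 * expR (g * I t)).
  move=> t0; have := is_deriveD (is_derive_cst (1 : R) t 1) (is_deriveZ ((g - C0) * X 0) (prim_deriv cE t0)).
  by rewrite add0r.
have cD : continuous D.
  by move=> t; apply: cvgD; [exact: cvg_cst|apply: cvgMr; exact: prim_continuous cE _].
have -> : ((1 - C0 * X 0 * t1) `^ ((g - C0) / C0))^-1 = Q t1.
  by rewrite -/(u t1) /powR gt_eqF ?u0// -expRN /Q mulNr.
rewrite -subr_ge0 -/(D t1).
have H0 : Q 0 - D 0 = 0.
  by rewrite /Q /D /u prim0 !mulr0 subr0 ln1 mulr0 expR0 addr0 subrr.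
rewrite -H0.
pose H (t : R) : R := Q t - D t.
have d1 t : t \in `]0, t1[ -> derivable H t 1.
  by rewrite in_itv/= => /andP[t0 tt]; have [] := is_deriveB (dQ t (ltW tt)) (dD t t0).
have d2 t : t \in `]0, t1[ -> 0 <= derive1 H t.
  rewrite in_itv/= => /andP[t0 tt]; rewrite derive1E.
  have [_ ->] := is_deriveB (dQ t (ltW tt)) (dD t t0).
  have up := u0 t (ltW tt).
  have -> : Q t * (- p * ((u t)^-1 * - (C0 * X 0))) = (g - C0) * X 0 * (Q t * (u t)^-1).
    by rewrite /p; field; rewrite !gt_eqF.
  rewrite -mulrBr; apply: mulr_ge0; first by rewrite mulr_ge0 ?subr_ge0.
  rewrite subr_ge0 -[(u t)^-1](lnK) ?posrE ?invr_gt0// lnV ?posrE// /Q -expRD ler_expR.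
  have := ode_exp_lower (ltW t0) (ltW tt); rewrite -/(u t) => h.
  have {}h : ln (u t) <= - C0 * I t by rewrite -(expRK (- C0 * I t)) ler_ln ?posrE ?expR_gt0.
  rewrite (_ : - p * ln (u t) - ln (u t) = - (g / C0) * ln (u t)); last by rewrite /p; field; rewrite gt_eqF.
  rewrite (_ : g * I t = - (g / C0) * (- C0 * I t)); last by field; rewrite gt_eqF.
  have gC0 : 0 <= g / C0 by rewrite divr_ge0 ?(ltW C00)// (le_trans (ltW C00)).
  by apply: ler_wnM2l; rewrite // oppr_le0.
have d3 : {within `[0, t1], continuous H}.
  apply: continuous_in_subspaceT => t; rewrite inE/= in_itv/= => /andP[_ tt].
  by apply: cvgB; [exact: is_derive_continuous_at (dQ t tt)|exact: cD].
exact: (@ger0_derive1_ndecr _ H 0 t1 d1 d2 d3 0 t1 (lexx _) t10 (lexx _)).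
Qed.

End core2.

(** * From functions on the line to functions on [0, T) *)

Section wrap.
Variables (C0 : R) (T : \bar R) (w : R -> R).
Hypothesis C00 : 0 < C0.
Hypothesis w0 : forall t, 0 <= w t.
Hypothesis cw : forall t, time_dom T t -> w s @[s --> within (time_dom T) (nbhs t)] --> w t.
Hypothesis dw : forall s t M : R, 0 < s -> s < t -> (t%:E < T)%E ->
  (forall u, s <= u <= t -> w u <= M) -> w t ^+ 2 - w s ^+ 2 <= C0 / 2 * (t - s) * M ^+ 6.

(** [w] is continuous only relative to [0, T), whereas the preceding bounds take a function
    continuous on the line. Freezing [w] outside [0, t1] supplies one and leaves the integrals up to
    [t1] unchanged. *)
Let clamp (t1 t : R) : R := Num.max 0 (Num.min t t1).

Let clamp_id (t1 t : R) : 0 <= t -> t <= t1 -> clamp t1 t = t.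
Proof. by move=> t0 tt1; rewrite /clamp min_l// max_r. Qed.

Let clamp_range (t1 t : R) : 0 <= t1 -> 0 <= clamp t1 t <= t1.
Proof. by move=> h; rewrite /clamp le_max lexx /= ge_max h /= ge_min lexx orbT. Qed.

Let clamp_dist (t1 s t : R) : `|clamp t1 s - clamp t1 t| <= `|s - t|.
Proof.
rewrite /clamp; case: (leP s t1) => h1; case: (leP t t1) => h2;
  case: (leP 0 s) => ?; case: (leP 0 t) => ?; case: (leP 0 t1) => ?; rewrite ler_norml; apply/andP;
  have := ler_norm (s - t); have := ler_norm (- (s - t)); rewrite normrN => *; split; lra.
Qed.

Let clamp_cont (t1 : R) : time_dom T t1 -> continuous (fun t => w (clamp t1 t)).
Proof.
move=> [t10 t1T] t; apply/cvgrPdist_le => e e0.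
have /andP[c0 c1] := clamp_range t t10.
have dc : time_dom T (clamp t1 t) by split => //; apply: le_lt_trans t1T; rewrite lee_fin.
have /cvgrPdist_le/(_ e e0) := cw dc; rewrite near_withinE => /nbhs_ballP[r /= r0 hr].
apply/nbhs_ballP; exists r => //= s; rewrite /ball/= => ts.
have /andP[s0 s1] := clamp_range s t10.
apply: hr; first by rewrite /ball/=; apply: le_lt_trans ts; exact: clamp_dist.
by split => //; apply: le_lt_trans t1T; rewrite lee_fin.
Qed.

Lemma ode_bounds : let a := w 0 in
    let W := fun gamma t : R =>
      gamma * \int[@lebesgue_measure R]_(s in `[0, t]) (w s ^+ 4) in
    let D := fun gamma t : R =>
      1 + (gamma - C0) * a ^+ 4
          * \int[@lebesgue_measure R]_(tau in `[0, t]) expR (W gamma tau) in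
    (forall gamma t : R, C0 <= gamma -> time_dom T t ->
       w t <= a * expR (W gamma t / 4) / D gamma t `^ (4^-1)) /\
    (forall gamma t : R, C0 <= gamma -> time_dom T t -> C0 * a ^+ 4 * t < 1 ->
       D gamma t <= ((1 - C0 * a ^+ 4 * t) `^ ((gamma - C0) / C0))^-1).
Proof.
move=> a W D.
have H (g t : R) : C0 <= g -> time_dom T t -> exists wc : R -> R,
  [/\ continuous wc, forall s, 0 <= wc s, wc 0 = w 0, wc t = w t &
     (forall s u M : R, 0 < s -> s < u -> u <= t ->
       (forall v, s <= v <= u -> wc v <= M) -> wc u ^+ 2 - wc s ^+ 2 <= C0 / 2 * (u - s) * M ^+ 6) /\
     (W g t = g * prim (fun s => wc s ^+ 4) t /\
     D g t = 1 + (g - C0) * wc 0 ^+ 4 * prim (fun s => expR (g * prim (fun s => wc s ^+ 4) s)) t)].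
  move=> gC dt; have [t0 tT] := dt.
  pose wc (s : R) : R := w (clamp t s).
  have wcE s : 0 <= s -> s <= t -> wc s = w s by move=> s0 st; rewrite /wc clamp_id.
  have WE s : s <= t -> W g s = g * prim (fun s => wc s ^+ 4) s.
    move=> st; rewrite /W /prim; congr (_ * _); apply: eq_Rintegral => u.
    by rewrite inE/= in_itv/= => /andP[u0 us]; rewrite wcE// (le_trans us).
  exists wc; split.
  - exact: clamp_cont.
  - by move=> s; exact: w0.
  - exact: wcE.
  - exact: wcE.
  - split.
  - move=> s u M s0 su ut h.
    have [u0 st] : 0 <= u /\ s <= t by split; [rewrite ltW// (lt_trans s0)|rewrite ltW// (lt_le_trans su)].
    rewrite !wcE ?(ltW s0)//; apply: dw => //; first by apply: le_lt_trans tT; rewrite lee_fin.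
    move=> v /andP[sv vu]; rewrite -wcE; first by apply: h; rewrite sv.
      by rewrite (le_trans (ltW s0)).
    by rewrite (le_trans vu).
  - split; first exact: WE.
    have E1 : \int[lam]_(tau in `[0, t]) expR (W g tau) =
        prim (fun s => expR (g * prim (fun s => wc s ^+ 4) s)) t.
      apply: eq_Rintegral => u.
      by rewrite inE/= in_itv/= => /andP[_ ut]; rewrite WE.
    exact: (congr2 (fun x y => 1 + (g - C0) * x ^+ 4 * y) (esym (wcE 0 (lexx _) t0)) E1).
split=> g t gC dt.
  have [wc [cwc wc0 E0 Et [dwc [EW ED]]]] := H g t gC dt.
  rewrite EW ED /a -E0 -Et.
  exact: (ode_bound C00 gC (proj1 dt) cwc wc0 dwc).
have [wc [cwc wc0 E0 Et [dwc [EW ED]]]] := H g t gC dt.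
rewrite ED /a -E0 => ht.
exact: (ode_bound2 C00 gC (proj1 dt) cwc wc0 dwc ht).
Qed.

End wrap.
End ode.

(** * The localized vorticity estimate *)

Section static_tools.
Variable R : realType.
Local Notation mu := (leb3 R).
Implicit Types (f g h d : R3 R -> R) (i j a b : 'I_3).

Lemma ord3 (i : 'I_3) : [\/ i = 0, i = 1 | i = 2%:R].
Proof. by case: i => -[|[|[|//]]] ?; [apply: Or31|apply: Or32|apply: Or33]; exact/val_inj. Qed.

Lemma sum3 (F : 'I_3 -> R) : \sum_i F i = F 0 + F 1 + F 2%:R.
Proof.
rewrite !big_ord_recr big_ord0/= add0r.
by congr (F _ + F _ + F _); exact/val_inj.
Qed.

Lemma sumB_eq (F1 G1 F2 G2 F G K : 'I_3 -> R) :
  (forall j, F1 j - G1 j - (F2 j - G2 j) = F j - G j - K j) ->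
  \sum_j F1 j - \sum_j G1 j - (\sum_j F2 j - \sum_j G2 j) = \sum_j F j - \sum_j G j - \sum_j K j.
Proof. by move=> H; rewrite -!sumrB; apply: eq_bigr. Qed.

Lemma RI_D f g : intg f -> intg g ->
  \int[mu]_x (f x + g x) = \int[mu]_x f x + \int[mu]_x g x.
Proof. by move=> fi gi; rewrite RintegralD. Qed.

Lemma RI_B f g : intg f -> intg g ->
  \int[mu]_x (f x - g x) = \int[mu]_x f x - \int[mu]_x g x.
Proof. by move=> fi gi; rewrite RintegralB. Qed.

Lemma RI_Z (c : R) f : intg f -> \int[mu]_x (c * f x) = c * \int[mu]_x f x.
Proof. by move=> fi; rewrite RintegralZl. Qed.

Lemma RI_le f g : intg f -> intg g -> (forall x, f x <= g x) ->
  \int[mu]_x f x <= \int[mu]_x g x.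
Proof. by move=> fi gi fg; apply: le_Rintegral. Qed.

Lemma RI_sum (F : 'I_3 -> R3 R -> R) : (forall k, intg (F k)) ->
  \int[mu]_x (\sum_k F k x) = \sum_k \int[mu]_x F k x.
Proof.
move=> IF; under eq_Rintegral do rewrite sum3.
rewrite sum3 RI_D; [|exact: intgD|exact: IF].
by rewrite RI_D.
Qed.

Lemma cc_intg f : cc f -> intg f. Proof. exact: cc_integrable. Qed.

Lemma intg_norm f : intg f -> intg (fun x => `|f x|).
Proof. by move=> fi; exact: integrable_norm fi. Qed.

Lemma cc_sqr f : cc f -> cc (fun x => f x ^+ 2).
Proof. by move=> cf; apply: ccMl => //; case: cf. Qed.

Lemma le_sum3 (F : 'I_3 -> R) i : (forall k, 0 <= F k) -> F i <= \sum_k F k.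
Proof. by move=> F0; rewrite (bigD1 i)//= lerDl sumr_ge0. Qed.

Lemma sum3_cst (k : R) : \sum_(i < 3) k = 3 * k.
Proof. by rewrite sumr_const card_ord mulr_natl. Qed.

Lemma L2_CS f g : L2 f -> L2 g ->
  (\int[mu]_x `|f x * g x|) ^+ 2 <= (\int[mu]_x (f x ^+ 2)) * \int[mu]_x (g x ^+ 2).
Proof.
move=> Lf Lg; exact: (proj2 (cauchy_schwarz (L2_mfun Lf) (L2_mfun Lg) (L2_sqr Lf) (L2_sqr Lg))).
Qed.

Lemma RI_sqr_ge0 f : 0 <= \int[mu]_x (f x ^+ 2).
Proof. by apply: Rintegral_ge0 => x _; exact: sqr_ge0. Qed.

Lemma RI_norm_ge0 f : 0 <= \int[mu]_x `|f x|.
Proof. by apply: Rintegral_ge0. Qed.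

Lemma RI_pow4_ge0 f : 0 <= \int[mu]_x (f x ^+ 4).
Proof. by apply: Rintegral_ge0 => x _; rewrite exprn_even_ge0. Qed.

(** Cauchy-Schwarz twice: it first splits off [d], then separates g^2 from h^2. The fourth power
    keeps the inequality free of roots. *)
Lemma triple_CS g h d : cc g -> cc h -> L2 d ->
  (\int[mu]_x `|g x * h x * d x|) ^+ 4 <=
  (\int[mu]_x (g x ^+ 4)) * (\int[mu]_x (h x ^+ 4)) * (\int[mu]_x (d x ^+ 2)) ^+ 2.
Proof.
move=> cg ch Ld.
have sq (k : R3 R -> R) : cc k -> cc (fun x => k x ^+ 2) by move=> ck; apply: ccMl => //; case: ck.
have cgh : cc (fun x => g x * h x) by apply: ccMl => //; case: ch.
have h1 := L2_CS (cc_L2 cgh) Ld.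
have h2 := L2_CS (cc_L2 (sq _ cg)) (cc_L2 (sq _ ch)).
have E0 : \int[mu]_x ((g x * h x) ^+ 2) = \int[mu]_x `|g x ^+ 2 * h x ^+ 2|.
  by apply: eq_Rintegral => x _; rewrite -exprMn ger0_norm ?sqr_ge0.
have E1 (k : R3 R -> R) : \int[mu]_x ((k x ^+ 2) ^+ 2) = \int[mu]_x (k x ^+ 4).
  by apply: eq_Rintegral => x _; rewrite -exprM.
rewrite E0 in h1; rewrite !E1 in h2.
move: h1 h2 (RI_norm_ge0 (fun x => g x ^+ 2 * h x ^+ 2)) (RI_sqr_ge0 d) (RI_norm_ge0 (fun x => g x * h x * d x)).
move: (\int[mu]_x `|g x * h x * d x|) (\int[mu]_x `|_ ^+ 2 * _ ^+ 2|) (\int[mu]_x (d x ^+ 2)) => S q D h1 h2 q0 D0 S0.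
have -> : S ^+ 4 = (S ^+ 2) ^+ 2 by rewrite -exprM.
apply: (@le_trans _ _ ((q * D) ^+ 2)); first by rewrite ler_sqr ?nnegrE ?sqr_ge0 ?mulr_ge0.
by rewrite exprMn ler_wpM2r ?sqr_ge0.
Qed.

(** Dominated convergence. The exponent is 4 for the localized enstrophy and 1 in
    [gradient_bound]. *)
Lemma cutoff_limit f k : intg f ->
  \int[mu]_x (cutoff n.+1%:R x ^+ k * f x) @[n --> \oo] --> \int[mu]_x f x.
Proof.
move=> fi.
have mf : mfun3 f by case/integrableP: fi => /measurable_EFinP.
have me n : mfun3 (fun x => cutoff n.+1%:R x ^+ k * f x).
  apply: measurable_funM => //; apply: measurable_funX.
  by apply: continuous_R3_measurable; exact: Ck_cont (cutoff_Ck 0 _).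
have le1 n x : `|cutoff n.+1%:R x ^+ k * f x| <= `|f x|.
  rewrite normrM ler_piMl// ger0_norm ?exprn_ge0 ?cutoff_ge0//.
  by rewrite exprn_ile1 ?cutoff_ge0 ?cutoff_le1.
have ie n : intg (fun x => cutoff n.+1%:R x ^+ k * f x).
  apply: (le_integrable _ _ _ fi) => //; first by apply/measurable_EFinP; exact: me.
  by move=> x _; rewrite lee_fin.
have H : (\int[mu]_x (cutoff n.+1%:R x ^+ k * f x)%:E)%E @[n --> \oo] --> (\int[mu]_x (f x)%:E)%E.
  apply: (@dominated_cvg _ _ _ mu setT measurableT (fun n x => (cutoff n.+1%:R x ^+ k * f x)%:E) _ (fun x => `|(f x)%:E|)%E).
  - by move=> n; apply/measurable_EFinP; exact: me.
  - move=> x _; apply: cvg_EFin; first exact: nearW.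
    rewrite -[X in _ --> X]mul1r; apply: cvgMl.
    have H := @cvg_seq_comp R (fun y => y ^+ k) (fun n => cutoff n.+1%:R x) 1 (@exprn_continuous R k 1) (@cutoff_cvg R x).
    by rewrite expr1n in H.
  - by move=> x _.
  - exact: (@integrable_abse _ _ _ mu setT _ fi).
  - by move=> n x _; rewrite lee_fin.
apply: fine_cvg; rewrite [X in _ --> X](_ : _ = (\int[mu]_x (f x)%:E)%E)//.
by rewrite /Rintegral fineK//; exact: integrable_fin_num fi.
Qed.

End static_tools.

Section static_arith.
Variable R : realType.

(** V_j stands for d_j u_j. Its sum vanishes, so the term f^2 V_j / 2 can be inserted under the sum,
    where it completes the transport term to a divergence. *)
Lemma energy_alg (k f : R) (P U W V : 'I_3 -> R) : \sum_j V j = 0 ->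
  k * (f * (\sum_j P j - \sum_j U j - \sum_j W j)) =
  \sum_j (k * f * (P j - U j - W j) - k * f * f / 2 * V j).
Proof.
move=> V0; have E : \sum_j (k * f * f / 2 * V j) = 0 by rewrite -mulr_sumr V0 mulr0.
by rewrite [RHS]sumrB E subr0 -!sumrB !mulr_sumr; apply: eq_bigr => j _; rewrite mulrA.
Qed.

(** Product rule in one direction, with e = eta, f = Om_ab, v = u_j. The terms e^4 df^2 and 4 e^3 de
    f df belong to the square of d(e^2 f), which leaves 4 e^2 de^2 f^2; the transport part is a
    divergence up to 2 e^3 de v f^2. Both leftovers contain de, hence a factor [c]. *)
Lemma energy_term (e de c f df ddf v dv X Y s t : R) : 0 <= e <= 1 -> `|de| <= c ->
  e ^+ 4 * f * (ddf - v * df - (X * s - Y * t)) - e ^+ 4 * f * f / 2 * dv <=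
  e * e * (e * e) * (f * ddf + df * df - 1 / 2 * (v * (f * df + f * df) + f * f * dv))
  + (f * df - 1 / 2 * (v * (f * f))) * (e * e * (e * de + e * de) + e * e * (e * de + e * de))
  - (e * e * df + f * (e * de + e * de)) ^+ 2
  + (4 * c ^+ 2 * f ^+ 2 + 2 * c * `|e * e * f * (e * v) * f|
  + (`|e * e * f * (e * e * s) * X| + `|e * e * f * (e * e * t) * Y|)).
Proof.
move=> /andP[e0 e1] dec.
have h1 : e ^+ 2 * de ^+ 2 * f ^+ 2 <= c ^+ 2 * f ^+ 2.
  rewrite ler_wpM2r ?sqr_ge0// -[leRHS]mul1r ler_pM ?sqr_ge0//; first by rewrite exprn_ile1.
  by rewrite -(real_normK (num_real de)) ler_sqr ?nnegrE// (le_trans _ dec).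
have h2 : de * (e * e * f * (e * v) * f) <= c * `|e * e * f * (e * v) * f|.
  by rewrite (le_trans (ler_norm _))// normrM ler_wpM2r.
have h3 := ler_norm (- (e * e * f * (e * e * s) * X)); rewrite normrN in h3.
have h4 := ler_norm (e * e * f * (e * e * t) * Y).
move: h2 h3 h4.
move: `|e * e * f * (e * v) * f| `|e * e * f * (e * e * s) * X| `|e * e * f * (e * e * t) * Y| => z1 z2 z3 h2 h3 h4.
rewrite -subr_ge0.
have -> : e * e * (e * e) * (f * ddf + df * df - 1 / 2 * (v * (f * df + f * df) + f * f * dv))
  + (f * df - 1 / 2 * (v * (f * f))) * (e * e * (e * de + e * de) + e * e * (e * de + e * de))
  - (e * e * df + f * (e * de + e * de)) ^+ 2
  + (4 * c ^+ 2 * f ^+ 2 + 2 * c * z1 + (z2 + z3))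
  - (e ^+ 4 * f * (ddf - v * df - (X * s - Y * t)) - e ^+ 4 * f * f / 2 * dv) =
  4 * (c ^+ 2 * f ^+ 2 - e ^+ 2 * de ^+ 2 * f ^+ 2) + 2 * (c * z1 - de * (e * e * f * (e * v) * f))
  + (z2 - - (e * e * f * (e * e * s) * X)) + (z3 - e * e * f * (e * e * t) * Y).
  by field.
apply: addr_ge0; last by rewrite subr_ge0.
apply: addr_ge0; last by rewrite subr_ge0.
by apply: addr_ge0; apply: mulr_ge0; rewrite ?subr_ge0.
Qed.

(* Young: (x + y)^4 >= 4 x^3 y with x = A / 216, y = 8 * 216^3 w^6; there will be
   54 such terms to be absorbed by the dissipation A. *)
Lemma triple_bound (S G H A w : R) : 0 <= S -> 0 <= G -> 0 <= H -> 0 <= A -> 0 <= w ->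
  G ^+ 2 <= 32 * w ^+ 2 * A ^+ 3 -> H ^+ 2 <= 32 * w ^+ 2 * A ^+ 3 ->
  S ^+ 4 <= G * H * (w ^+ 2) ^+ 2 -> S <= A / 216 + 8 * 216 ^+ 3 * w ^+ 6.
Proof.
move=> S0 G0 H0 A0 w0 hG hH hS.
have GH : G * H <= 32 * w ^+ 2 * A ^+ 3.
  have K0 : 0 <= 32 * w ^+ 2 * A ^+ 3 by rewrite !mulr_ge0// exprn_ge0.
  rewrite -ler_sqr ?nnegrE ?mulr_ge0// exprMn [leRHS]expr2.
  by apply: ler_pM => //; exact: sqr_ge0.
have hS4 : S ^+ 4 <= 32 * w ^+ 6 * A ^+ 3.
  apply: (le_trans hS); apply: (le_trans (ler_wpM2r (sqr_ge0 _) GH)).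
  by rewrite le_eqVlt; apply/orP; left; apply/eqP; ring.
pose y := 8 * 216 ^+ 3 * w ^+ 6.
have y0 : 0 <= y by apply: mulr_ge0; [lra|exact: exprn_ge0].
pose x := A / 216.
have x0 : 0 <= x by apply: divr_ge0 => //; lra.
rewrite -/y -/x -(@ler_pXn2r _ 4)// ?nnegrE ?addr_ge0//.
apply: (le_trans hS4).
have -> : 32 * w ^+ 6 * A ^+ 3 = 4 * (x ^+ 3 * y) by rewrite /x /y; field.
have h : (x + y) ^+ 4 = 4 * (x ^+ 3 * y) + (x ^+ 4 + 6 * x ^+ 2 * y ^+ 2 + 4 * (x * y ^+ 3) + y ^+ 4) by ring.
rewrite h lerDl; clear h hS4 GH; clearbody x y.
have p1 : 0 <= x ^+ 4 by apply: exprn_ge0.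
have p2 : 0 <= y ^+ 4 by apply: exprn_ge0.
have p3 : 0 <= x * y ^+ 3 by apply: mulr_ge0 => //; apply: exprn_ge0.
have p4 : 0 <= 6 * x ^+ 2 * y ^+ 2 by rewrite !mulr_ge0 ?sqr_ge0.
lra.
Qed.

(** The hypotheses give Z^8 <= L A^3 with L the constant in the bound, and L A^3 <= (1 + L + A)^4 <=
    (1 + L + A)^8. This is crude, but Z only occurs multiplied by [c]; all that matters is that A
    enters at most linearly, to be absorbed by the dissipation. *)
Lemma error_bound (Z G H A M K : R) : 0 <= Z -> 0 <= G -> 0 <= H -> 0 <= A -> 0 <= K ->
  G ^+ 2 <= 32 * M ^+ 2 * A ^+ 3 -> H ^+ 2 <= K ->
  Z ^+ 4 <= G * H * (2 * M ^+ 2) ^+ 2 -> Z <= 1 + 32 * M ^+ 2 * K * (2 * M ^+ 2) ^+ 4 + A.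
Proof.
move=> Z0 G0 H0 A0 K0 hG hH hZ.
have Z8 : Z ^+ 8 <= 32 * M ^+ 2 * K * (2 * M ^+ 2) ^+ 4 * A ^+ 3.
  have -> : Z ^+ 8 = (Z ^+ 4) ^+ 2 by rewrite -exprM.
  apply: (@le_trans _ _ ((G * H * (2 * M ^+ 2) ^+ 2) ^+ 2)).
    have Z4 : 0 <= Z ^+ 4 by exact: exprn_ge0.
    by rewrite ler_sqr// nnegrE; apply: mulr_ge0; [exact: mulr_ge0|exact: sqr_ge0].
  rewrite !exprMn.
  have : G ^+ 2 * H ^+ 2 <= 32 * M ^+ 2 * A ^+ 3 * K by apply: ler_pM => //; exact: sqr_ge0.
  move/(ler_wpM2r (_ : 0 <= ((2 * M ^+ 2) ^+ 2) ^+ 2)).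
  move=> /(_ (sqr_ge0 _)) h; apply: le_trans (le_trans _ h) _; first by rewrite !exprMn.
  by rewrite le_eqVlt; apply/orP; left; apply/eqP; ring.
have L0 : 0 <= 32 * M ^+ 2 * K * (2 * M ^+ 2) ^+ 4.
  apply: mulr_ge0; last by apply: exprn_ge0; apply: mulr_ge0 => //; exact: sqr_ge0.
  by apply: mulr_ge0 => //; apply: mulr_ge0 => //; exact: sqr_ge0.
move: Z8 L0; clear - Z0 A0; generalize (32 * M ^+ 2 * K * (2 * M ^+ 2) ^+ 4) => L Z8 L0.
have one : 1 <= 1 + L + A by rewrite -addrA lerDl addr_ge0.
rewrite -(@ler_pXn2r _ 8)// ?nnegrE ?addr_ge0//.
apply: (le_trans Z8); apply: (@le_trans _ _ ((1 + L + A) ^+ 4)); last by rewrite ler_weXn2l.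
rewrite [leRHS]exprS ler_pM ?exprn_ge0//; first by rewrite addrAC lerDr addr_ge0.
by rewrite lerXn2r ?nnegrE ?addr_ge0// lerDr addr_ge0.
Qed.

Lemma etau_arith (e de v dv : R) : 0 <= e <= 1 -> `|de| <= 1 ->
  (e * dv + v * de) ^+ 2 <= 2 * v ^+ 2 + 2 * dv ^+ 2.
Proof.
move=> /andP[e0 e1] d1.
have h : (e * dv + v * de) ^+ 2 <= 2 * (e * dv) ^+ 2 + 2 * (v * de) ^+ 2.
  by have := sqr_ge0 (e * dv - v * de); nra.
apply: (le_trans h); rewrite addrC !exprMn; apply: lerD; apply: ler_wpM2l => //.
  rewrite ler_piMr ?sqr_ge0// -(real_normK (num_real de)) exprn_ile1//.
by rewrite ler_piMl ?sqr_ge0// exprn_ile1.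
Qed.

(** The 9 pairs and 3 directions yield 54 A/216 = A/4 from stretching and 54 c A <= A/2 from
    transport, which explains 108; the term -A absorbs both. The remaining terms are 54 8 216^3 M^6
    and terms proportional to c, with c^2 <= c. *)
Lemma static_arith (c Z A M : R) : 0 <= c -> c <= 108^-1 -> 0 <= A ->
  - A + 9 * (3 * (4 * c ^+ 2 * (2 * M ^+ 2) + 2 * c * (Z + A)
     + 2 * (A / 216 + 8 * 216 ^+ 3 * M ^+ 6)))
  <= 432 * 216 ^+ 3 * M ^+ 6 + c * (216 * M ^+ 2 + 54 * Z).
Proof.
move=> c0 c1 A0.
have h1 : c * A <= 108^-1 * A by exact: ler_wpM2r.
have h2 : c * (c * M ^+ 2) <= 1 * (c * M ^+ 2).
  apply: ler_wpM2r; first by apply: mulr_ge0 => //; exact: sqr_ge0.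
  by apply: (le_trans c1); rewrite invf_le1// ler1n.
rewrite -subr_ge0.
have -> : 432 * 216 ^+ 3 * M ^+ 6 + c * (216 * M ^+ 2 + 54 * Z) -
  (- A + 9 * (3 * (4 * c ^+ 2 * (2 * M ^+ 2) + 2 * c * (Z + A)
     + 2 * (A / 216 + 8 * 216 ^+ 3 * M ^+ 6)))) =
  216 * (1 * (c * M ^+ 2) - c * (c * M ^+ 2)) + 54 * (108^-1 * A - c * A) + A / 4 by field.
apply: addr_ge0; last by apply: divr_ge0.
by apply: addr_ge0; apply: mulr_ge0; rewrite ?subr_ge0.
Qed.

End static_arith.

Section static.
Variable R : realType.
Local Notation mu := (leb3 R).
Implicit Types (f g h d : R3 R -> R) (i j a b : 'I_3).
Variable u : vfield R.
Hypothesis Cu : forall i n, Ck n (u i).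
Hypothesis Hu : forall i, H1 (u i).
Hypothesis div0 : forall x, \sum_i partial i (u i) x = 0.

Definition Om a b : R3 R -> R := fun x => partial a (u b) x - partial b (u a) x.

Lemma Om_Ck a b n : Ck n (Om a b).
Proof. by apply: CkB; apply: Ck_partial; exact: Cu. Qed.

Lemma Om_anti a b x : Om b a x = - Om a b x.
Proof. by rewrite /Om opprB. Qed.

Lemma Om_diag a x : Om a a x = 0.
Proof. by rewrite /Om subrr. Qed.

Lemma du_L2 i j : L2 (partial i (u j)).
Proof. exact: (L2_partial i (Hu j) (Cu j 1)). Qed.

Lemma u_L2 i : L2 (u i). Proof. by case: (Hu i). Qed.

Lemma Om_L2 a b : L2 (Om a b).
Proof. by apply: L2B; exact: du_L2. Qed.

Let D a i x : derivable (u i) x (e3 R a).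
Proof. exact: Ck_derivable (Cu i 1). Qed.

Let DD a b i x : derivable (partial b (u i)) x (e3 R a).
Proof. exact: Ck_derivable (Ck_partial b (Cu i 2)). Qed.

(* The equation without its pressure: d_t v_i = force v i - d_i p. *)
Definition force i : R3 R -> R := fun x =>
  \sum_j partial j (partial j (u i)) x - \sum_j u j x * partial j (u i) x.

Lemma force_Ck i n : Ck n (force i).
Proof.
apply: CkB; apply: Ck_sum => k; first by do 2!apply: Ck_partial; exact: Cu.
by apply: CkM; [exact: Cu|apply: Ck_partial; exact: Cu].
Qed.

(* The time derivative of Om a b, the pressure gradient being curl-free. *)
Definition Q a b : R3 R -> R := fun x => partial a (force b) x - partial b (force a) x.

Lemma partial_force a i x : partial a (force i) x =
  \sum_j partial j (partial j (partial a (u i))) x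
  - \sum_j (u j x * partial j (partial a (u i)) x + partial j (u i) x * partial a (u j) x).
Proof.
have C n : Ck n (fun x => \sum_j partial j (partial j (u i)) x).
  by apply: Ck_sum => k; do 2!apply: Ck_partial; exact: Cu.
have C' n : Ck n (fun x => \sum_j u j x * partial j (u i) x).
  by apply: Ck_sum => k; apply: CkM; [exact: Cu|apply: Ck_partial; exact: Cu].
rewrite /force partialB; [|exact: Ck_derivable (C 1%N)|exact: Ck_derivable (C' 1%N)].
congr (_ - _).
  rewrite partial_sum; last by move=> k; apply: (@Ck_derivable _ 0); do 2!apply: Ck_partial; exact: Cu.
  apply: eq_bigr => j _.
  have E : partial a (partial j (u i)) = partial j (partial a (u i)).
    by apply/funext => y; exact: (@clairaut R (u i) a j y (Cu i 2)).
  by rewrite (@clairaut R (partial j (u i)) a j x (Ck_partial j (Cu i 3))) E.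
rewrite partial_sum; last first.
  by move=> k; apply: (@Ck_derivable _ 0); apply: CkM; [exact: Cu|apply: Ck_partial; exact: Cu].
apply: eq_bigr => j _; rewrite partialM; [|exact: D|exact: DD].
by rewrite (@clairaut R (u i) a j x (Cu i 2)).
Qed.

Lemma partial_Om j a b x : partial j (Om a b) x = partial j (partial a (u b)) x - partial j (partial b (u a)) x.
Proof. by rewrite /Om partialB//; exact: DD. Qed.

Lemma partial2_Om j a b x : partial j (partial j (Om a b)) x =
  partial j (partial j (partial a (u b))) x - partial j (partial j (partial b (u a))) x.
Proof.
rewrite (_ : partial j (Om a b) = fun x => partial j (partial a (u b)) x - partial j (partial b (u a)) x); last first.
  by apply/funext => y; exact: partial_Om.
by rewrite partialB//; apply: (@Ck_derivable _ 0); do 2!apply: Ck_partial; exact: Cu.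
Qed.

(** The vorticity equation. Writing d_j u_b = Om_jb + d_b u_j, the products d_a u_j d_b u_j cancel
    by symmetry, so every stretching term contains a factor Om, to be paired with eta^2. *)
Lemma QE a b x : Q a b x = \sum_j partial j (partial j (Om a b)) x
  - \sum_j u j x * partial j (Om a b) x
  - \sum_j (partial a (u j) x * Om j b x - partial b (u j) x * Om j a x).
Proof.
apply: eq_trans (congr2 (fun p q => p - q) (partial_force a b x) (partial_force b a x)) _.
apply: sumB_eq => j.
rewrite (partial2_Om j a b) (partial_Om j a b) /Om.
generalize (partial j (partial j (partial a (u b))) x) (partial j (partial j (partial b (u a))) x)
  (partial j (partial a (u b)) x) (partial j (partial b (u a)) x) (u j x) (partial j (u a) x)
  (partial j (u b) x) (partial a (u j) x) (partial b (u j) x) => *.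
ring.
Qed.

Lemma partial_mul f g i x : Ck 1 f -> Ck 1 g ->
  partial i (fun y => f y * g y) x = f x * partial i g x + g x * partial i f x.
Proof. by move=> Cf Cg; apply: partialM; apply: (@Ck_derivable _ 0). Qed.

Variable r : R.
Hypothesis r0 : 0 < r.
Local Notation eta := (cutoff r).

Definition gr a b : R3 R -> R := fun x => eta x * eta x * Om a b x.

Definition hr a b j : R3 R -> R := fun x => eta x * eta x * (eta x * eta x) *
  (Om a b x * partial j (Om a b) x - 1 / 2 * (u j x * (Om a b x * Om a b x))).

Lemma eta2_Ck n : Ck n (fun x => eta x * eta x).
Proof. by apply: CkM; exact: cutoff_Ck. Qed.

Lemma eta4_Ck n : Ck n (fun x => eta x * eta x * (eta x * eta x)).
Proof. by apply: CkM; exact: eta2_Ck. Qed.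

Lemma eta2_cc : cc (fun x => eta x * eta x).
Proof. by apply: ccMl; [exact: cutoff_cc|exact: Ck_cont (cutoff_Ck 0 r)]. Qed.

Lemma gr_Ck a b n : Ck n (gr a b).
Proof. by apply: CkM; [exact: eta2_Ck|exact: Om_Ck]. Qed.

Lemma gr_cc a b : cc (gr a b).
Proof. by apply: ccMl; [exact: eta2_cc|exact: Ck_cont (Om_Ck a b 0)]. Qed.

Lemma dOm_Ck a b j n : Ck n (partial j (Om a b)).
Proof. by apply: Ck_partial; exact: Om_Ck. Qed.

Lemma hin_Ck a b j n : Ck n (fun x => Om a b x * partial j (Om a b) x - 1 / 2 * (u j x * (Om a b x * Om a b x))).
Proof.
apply: CkB; first by apply: CkM; [exact: Om_Ck|exact: dOm_Ck].
apply: CkM; first exact: Ck_cst.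
by apply: CkM; [exact: Cu|apply: CkM; exact: Om_Ck].
Qed.

Lemma hr_Ck a b j n : Ck n (hr a b j).
Proof. by apply: CkM; [exact: eta4_Ck|exact: hin_Ck]. Qed.

Lemma hr_csupp a b j : csupp (hr a b j).
Proof. by apply: csuppM; apply: csuppM; case: eta2_cc. Qed.

Lemma partial_eta2 j x : partial j (fun x => eta x * eta x) x = eta x * partial j eta x + eta x * partial j eta x.
Proof. exact: (partial_mul j x (cutoff_Ck 1 r) (cutoff_Ck 1 r)). Qed.

Lemma partial_gr a b j x : partial j (gr a b) x =
  eta x * eta x * partial j (Om a b) x + Om a b x * (eta x * partial j eta x + eta x * partial j eta x).
Proof.
apply: eq_trans (partial_mul j x (eta2_Ck 1) (Om_Ck a b 1)) _.
by rewrite partial_eta2.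
Qed.

Lemma partial_hr a b j x : partial j (hr a b j) x =
  eta x * eta x * (eta x * eta x) * (Om a b x * partial j (partial j (Om a b)) x
    + partial j (Om a b) x * partial j (Om a b) x
    - 1 / 2 * (u j x * (Om a b x * partial j (Om a b) x + Om a b x * partial j (Om a b) x)
               + Om a b x * Om a b x * partial j (u j) x))
  + (Om a b x * partial j (Om a b) x - 1 / 2 * (u j x * (Om a b x * Om a b x))) *
    (eta x * eta x * (eta x * partial j eta x + eta x * partial j eta x)
     + eta x * eta x * (eta x * partial j eta x + eta x * partial j eta x)).
Proof.
apply: eq_trans (partial_mul j x (eta4_Ck 1) (hin_Ck a b j 1)) _.
congr (_ * _ + _ * _); last first.
  apply: eq_trans (partial_mul j x (eta2_Ck 1) (eta2_Ck 1)) _.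
  by rewrite partial_eta2.
have C1 : Ck 1 (fun x => Om a b x * partial j (Om a b) x) by apply: CkM; [exact: Om_Ck|exact: dOm_Ck].
have C3 : Ck 1 (fun x => Om a b x * Om a b x) by apply: CkM; exact: Om_Ck.
have C2 : Ck 1 (fun x => u j x * (Om a b x * Om a b x)) by apply: CkM; [exact: Cu|exact: C3].
have C4 : Ck 1 (fun x => 1 / 2 * (u j x * (Om a b x * Om a b x))) by apply: CkM; [exact: Ck_cst|exact: C2].
rewrite partialB; [|exact: Ck_derivable C1|exact: Ck_derivable C4].
congr (_ - _); first exact: (partial_mul j x (Om_Ck a b 1) (dOm_Ck a b j 1)).
apply: eq_trans (partial_mul j x (Ck_cst 1 (1 / 2)) C2) _.
rewrite partialcst mulr0 addr0; congr (_ * _).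
apply: eq_trans (partial_mul j x (Cu j 1) C3) _.
by congr (_ * _ + _ * _); exact: (partial_mul j x (Om_Ck a b 1) (Om_Ck a b 1)).
Qed.

Variable c : R.
Hypothesis dc : forall i x, `|partial i eta x| <= c.

(** The factors are grouped for [triple_CS]: two compactly supported ones measured in L^4, the last
    in L^2. In [zr], the transport error, one cutoff has been used up by differentiation; of the
    remaining eta^3, two go to Om and one to u_j. [sr] is the stretching term. *)
Definition zr a b j : R3 R -> R := fun x => gr a b x * (eta x * u j x) * Om a b x.
Definition sr a b a' b' i j : R3 R -> R := fun x => gr a b x * gr a' b' x * partial i (u j) x.

(* [hr] carries the part in divergence form; the divergence-free condition
   cancels the term in [partial j (u j)]. *)
Lemma energy_pointwise a b x : eta x ^+ 4 * (Om a b x * Q a b x) <=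
  \sum_j (partial j (hr a b j) x - partial j (gr a b) x ^+ 2 +
    (4 * c ^+ 2 * Om a b x ^+ 2 + 2 * c * `|zr a b j x|
     + (`|sr a b j b a j x| + `|sr a b j a b j x|))).
Proof.
have E := energy_alg (eta x ^+ 4) (Om a b x) (fun j => partial j (partial j (Om a b)) x)
  (fun j => u j x * partial j (Om a b) x)
  (fun j => partial a (u j) x * Om j b x - partial b (u j) x * Om j a x) (div0 x).
have E1 := congr1 (fun q => eta x ^+ 4 * (Om a b x * q)) (QE a b x).
apply: le_trans (_ : _ <= _); first by rewrite le_eqVlt; apply/orP; left; apply/eqP; exact: (eq_trans E1 E).
apply: ler_sum => j _.
rewrite (partial_hr a b j x) (partial_gr a b j x).
by apply: energy_term; [rewrite cutoff_ge0 cutoff_le1|exact: dc].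
Qed.

Lemma cutoffM_csupp f : csupp (fun x => eta x * f x).
Proof. by apply: csuppM; case: (cutoff_cc r0). Qed.

Lemma zr_cc a b j : cc (zr a b j).
Proof.
apply: ccMl; last exact: Ck_cont (Om_Ck a b 0).
apply: ccMl; first exact: gr_cc.
by apply: (@Ck_cont _ 0); apply: CkM; [exact: cutoff_Ck|exact: Cu].
Qed.

Lemma sr_cc a b a' b' i j : cc (sr a b a' b' i j).
Proof.
apply: ccMl; last exact: Ck_cont (Ck_partial i (Cu j 1)).
by apply: ccMl; [exact: gr_cc|exact: Ck_cont (gr_Ck a' b' 0)].
Qed.

Lemma dgr_cc a b j : cc (partial j (gr a b)).
Proof. by apply: cc_partial; [case: (gr_cc a b)|exact: gr_Ck]. Qed.

Lemma Q_Ck a b n : Ck n (Q a b).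
Proof. by apply: CkB; apply: Ck_partial; exact: force_Ck. Qed.

Lemma eta4_cc : cc (fun x => eta x ^+ 4).
Proof.
rewrite (_ : (fun x => eta x ^+ 4) = fun x => (eta x ^+ 2) ^+ 2).
  by do 2!apply: cc_sqr; exact: cutoff_cc.
by apply/funext => x; rewrite -exprM.
Qed.

Lemma energy_lhs_cc a b : cc (fun x => eta x ^+ 4 * (Om a b x * Q a b x)).
Proof.
apply: ccMl; first exact: eta4_cc.
by apply: (@Ck_cont _ 0); apply: CkM; [exact: Om_Ck|exact: Q_Ck].
Qed.

Definition diss a b : R := \sum_j \int[mu]_x (partial j (gr a b) x ^+ 2).

Lemma diss_ge0 a b : 0 <= diss a b.
Proof. by apply: sumr_ge0 => j _; exact: RI_sqr_ge0. Qed.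

Lemma energy_integrated a b : \int[mu]_x (eta x ^+ 4 * (Om a b x * Q a b x)) <=
  - diss a b + \sum_j (4 * c ^+ 2 * \int[mu]_x (Om a b x ^+ 2) + 2 * c * \int[mu]_x `|zr a b j x|
     + (\int[mu]_x `|sr a b j b a j x| + \int[mu]_x `|sr a b j a b j x|)).
Proof.
pose F j : R3 R -> R := fun x => 4 * c ^+ 2 * Om a b x ^+ 2 + 2 * c * `|zr a b j x|
     + (`|sr a b j b a j x| + `|sr a b j a b j x|).
have i1 j : intg (partial j (hr a b j)).
  by apply: cc_intg; apply: cc_partial; [exact: hr_csupp|exact: hr_Ck].
have i2 j : intg (fun x => partial j (gr a b) x ^+ 2) by apply: cc_intg; apply: cc_sqr; exact: dgr_cc.
have i3 : intg (fun x => Om a b x ^+ 2) by apply: L2_sqr; exact: Om_L2.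
have i4 j : intg (fun x => `|zr a b j x|) by apply: intg_norm; apply: cc_intg; exact: zr_cc.
have i5 a1 b1 a' b' i j : intg (fun x => `|sr a1 b1 a' b' i j x|) by apply: intg_norm; apply: cc_intg; exact: sr_cc.
have i6 : intg (fun x => 4 * c ^+ 2 * Om a b x ^+ 2) by exact: intgZ.
have i7 j : intg (fun x => 2 * c * `|zr a b j x|) by exact: intgZ.
have i8 j : intg (fun x => `|sr a b j b a j x| + `|sr a b j a b j x|) by exact: intgD.
have i9 j : intg (fun x => 4 * c ^+ 2 * Om a b x ^+ 2 + 2 * c * `|zr a b j x|) by exact: intgD.
have iF j : intg (F j) by exact: (intgD (i9 j) (i8 j)).
have EF j : \int[mu]_x F j x = 4 * c ^+ 2 * \int[mu]_x (Om a b x ^+ 2) + 2 * c * \int[mu]_x `|zr a b j x|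
     + (\int[mu]_x `|sr a b j b a j x| + \int[mu]_x `|sr a b j a b j x|).
  apply: eq_trans (RI_D (i9 j) (i8 j)) _.
  congr (_ + _); last exact: RI_D (i5 _ _ _ _ _ _) (i5 _ _ _ _ _ _).
  apply: eq_trans (RI_D i6 (i7 j)) _.
  by congr (_ + _); [exact: RI_Z i3|exact: RI_Z (i4 j)].
have i10 j : intg (fun x => partial j (hr a b j) x - partial j (gr a b) x ^+ 2) by exact: intgB.
have i11 j : intg (fun x => partial j (hr a b j) x - partial j (gr a b) x ^+ 2 + F j x) by exact: intgD.
apply: le_trans (RI_le (cc_intg (energy_lhs_cc a b)) (intg_sum i11) (energy_pointwise a b)) _.
rewrite RI_sum; last exact: i11.
rewrite /diss -sumrN -big_split/=; apply: ler_sum => j _.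
rewrite le_eqVlt; apply/orP; left; apply/eqP.
apply: eq_trans (RI_D (i10 j) (iF j)) _.
congr (_ + _); last exact: EF.
apply: eq_trans (RI_B (i1 j) (i2 j)) _.
by rewrite (int_partial j (hr_csupp a b j) (hr_Ck a b j 1)) sub0r.
Qed.

Variables M m : R.
Hypothesis M0 : 0 <= M.
Hypothesis c01 : 0 <= c <= 108^-1.
Hypothesis Om_le : forall a b, \int[mu]_x (Om a b x ^+ 2) <= 2 * M ^+ 2.
Hypothesis du_le : forall i j, \int[mu]_x (partial i (u j) x ^+ 2) <= M ^+ 2.
Hypothesis u_le : forall j, \int[mu]_x (u j x ^+ 2) <= m ^+ 2.

Let A : R := \sum_a \sum_b diss a b.

Lemma diss_le a b : diss a b <= A.
Proof.
apply: (@le_trans _ _ (\sum_b diss a b)); first by apply: le_sum3 => k; exact: diss_ge0.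
by apply: (@le_sum3 R (fun a => \sum_b diss a b)) => k; apply: sumr_ge0 => l _; exact: diss_ge0.
Qed.

Lemma A_ge0 : 0 <= A. Proof. exact: le_trans (diss_ge0 0 0) (diss_le 0 0). Qed.

Lemma gr_le a b : \int[mu]_x (gr a b x ^+ 2) <= 2 * M ^+ 2.
Proof.
apply: le_trans (Om_le a b); apply: RI_le.
- by apply: cc_intg; apply: cc_sqr; exact: gr_cc.
- by apply: L2_sqr; exact: Om_L2.
- move=> x; rewrite /gr exprMn ler_piMl ?sqr_ge0// exprn_ile1 ?mulr_ge0 ?cutoff_ge0//.
  by rewrite mulr_ile1 ?cutoff_ge0 ?cutoff_le1.
Qed.

(** Ladyzhenskaya's inequality for eta^2 Om: 16 times the bound 2 M^2 gives 32, and [diss a b] is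
    one summand of the total dissipation [A]. *)
Lemma gr4_le a b : (\int[mu]_x (gr a b x ^+ 4)) ^+ 2 <= 32 * M ^+ 2 * A ^+ 3.
Proof.
apply: le_trans (ladyzhenskaya (proj2 (gr_cc a b)) (gr_Ck a b 1)) _.
have -> : 32 * M ^+ 2 * A ^+ 3 = 16 * (2 * M ^+ 2) * A ^+ 3 by ring.
apply: ler_pM; [| |by rewrite ler_wpM2l ?gr_le|].
- by apply: mulr_ge0 => //; exact: RI_sqr_ge0.
- by apply: exprn_ge0; exact: diss_ge0 a b.
- by rewrite lerXn2r ?nnegrE ?A_ge0 ?(diss_ge0 a b)//; exact: diss_le a b.
Qed.

Lemma sr_le a b a' b' i j : \int[mu]_x `|sr a b a' b' i j x| <= A / 216 + 8 * 216 ^+ 3 * M ^+ 6.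
Proof.
apply: (triple_bound (RI_norm_ge0 _) (RI_pow4_ge0 _) (RI_pow4_ge0 _) A_ge0 M0 (gr4_le a b) (gr4_le a' b')).
apply: le_trans (triple_CS (gr_cc a b) (gr_cc a' b') (du_L2 i j)) _.
apply: ler_wpM2l; first by apply: mulr_ge0; exact: RI_pow4_ge0.
by rewrite ler_sqr ?nnegrE ?sqr_ge0 ?RI_sqr_ge0 ?du_le.
Qed.

(** Ladyzhenskaya's bound for eta u_j: the factor 3 counts directions, and (eta du + u deta)^2 <= 2
    u^2 + 2 du^2 because |deta| <= 1. It may depend on the size [m] of u, since it enters only
    multiplied by [c]. *)
Let K : R := 16 * m ^+ 2 * (3 * (2 * m ^+ 2 + 2 * M ^+ 2)) ^+ 3.

Lemma etau_le j : (\int[mu]_x ((eta x * u j x) ^+ 4)) ^+ 2 <= K.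
Proof.
have Ch : Ck 1 (fun x => eta x * u j x) by apply: CkM; [exact: cutoff_Ck|exact: Cu].
have ch : cc (fun x => eta x * u j x) by split; [exact: Ck_cont Ch|exact: cutoffM_csupp].
have iu : intg (fun x => u j x ^+ 2) by apply: L2_sqr; exact: u_L2.
have idu i : intg (fun x => partial i (u j) x ^+ 2) by apply: L2_sqr; exact: du_L2.
apply: le_trans (ladyzhenskaya (proj2 ch) Ch) _.
apply: ler_pM.
- by apply: mulr_ge0 => //; exact: RI_sqr_ge0.
- by apply: exprn_ge0; apply: sumr_ge0 => i _; exact: RI_sqr_ge0.
- apply: ler_wpM2l => //; apply: le_trans (u_le j); apply: RI_le => //.
    by apply: cc_intg; exact: cc_sqr ch.
  move=> x; rewrite exprMn ler_piMl ?sqr_ge0// exprn_ile1 ?cutoff_ge0//.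
  exact: cutoff_le1.
- rewrite lerXn2r ?nnegrE//; first by apply: sumr_ge0 => i _; exact: RI_sqr_ge0.
    by apply: mulr_ge0 => //; apply: addr_ge0; apply: mulr_ge0 => //; exact: sqr_ge0.
  rewrite -sum3_cst; apply: ler_sum => i _.
  apply: (@le_trans _ _ (\int[mu]_x (2 * u j x ^+ 2 + 2 * partial i (u j) x ^+ 2))); last first.
    rewrite RI_D; [|exact: intgZ|exact: intgZ].
    by rewrite !RI_Z//; apply: lerD; apply: ler_wpM2l.
  apply: RI_le.
  + by apply: cc_intg; apply: cc_sqr; apply: cc_partial; [exact: (proj2 ch)|exact: Ch].
  + by apply: intgD; exact: intgZ.
  move=> x; rewrite (partial_mul i x (cutoff_Ck 1 r) (Cu j 1)).
  apply: etau_arith; [by rewrite cutoff_ge0 cutoff_le1|].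
  apply: (le_trans (dc i x)); case/andP: c01 => _ c1.
  by apply: (le_trans c1); rewrite invf_le1// ler1n.
Qed.

Lemma zr_le a b j : \int[mu]_x `|zr a b j x| <= 1 + 32 * M ^+ 2 * K * (2 * M ^+ 2) ^+ 4 + A.
Proof.
have Ch : Ck 1 (fun x => eta x * u j x) by apply: CkM; [exact: cutoff_Ck|exact: Cu].
have ch : cc (fun x => eta x * u j x) by split; [exact: Ck_cont Ch|exact: cutoffM_csupp].
have K0 : 0 <= K.
  by apply: le_trans (etau_le 0); exact: sqr_ge0.
apply: (error_bound (RI_norm_ge0 _) (RI_pow4_ge0 _) (RI_pow4_ge0 _) A_ge0 K0 (gr4_le a b) (etau_le j)).
apply: le_trans (triple_CS (gr_cc a b) ch (Om_L2 a b)) _.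
apply: ler_wpM2l; first by apply: mulr_ge0; exact: RI_pow4_ge0.
by rewrite ler_sqr ?nnegrE ?RI_sqr_ge0 ?Om_le// mulr_ge0 ?sqr_ge0.
Qed.

Lemma static_bound : \sum_a \sum_b \int[mu]_x (eta x ^+ 4 * (Om a b x * Q a b x)) <=
  432 * 216 ^+ 3 * M ^+ 6 + c * (216 * M ^+ 2 + 54 * (1 + 32 * M ^+ 2 * K * (2 * M ^+ 2) ^+ 4)).
Proof.
pose Z : R := 1 + 32 * M ^+ 2 * K * (2 * M ^+ 2) ^+ 4.
pose k : R := 3 * (4 * c ^+ 2 * (2 * M ^+ 2) + 2 * c * (Z + A) + 2 * (A / 216 + 8 * 216 ^+ 3 * M ^+ 6)).
case/andP: (c01) => c0 c1.
have E a b : \int[mu]_x (eta x ^+ 4 * (Om a b x * Q a b x)) <= - diss a b + k.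
  apply: le_trans (energy_integrated a b) _; rewrite lerD2l /k -sum3_cst.
  apply: ler_sum => j _; apply: lerD.
    apply: lerD; first by apply: ler_wpM2l; [apply: mulr_ge0 => //; exact: sqr_ge0|exact: Om_le].
    by apply: ler_wpM2l; [exact: mulr_ge0|exact: zr_le].
  by rewrite [leRHS]mulr_natl mulr2n; apply: lerD; exact: sr_le.
apply: (@le_trans _ _ (\sum_a \sum_b (- diss a b + k))).
  by apply: ler_sum => a _; apply: ler_sum => b _.
have -> : \sum_a \sum_b (- diss a b + k) = - A + 9 * k.
  rewrite /A -sumrN; under eq_bigr do rewrite big_split/= sum3_cst sumrN.
  by rewrite big_split/= sum3_cst mulrA -natrM.
exact: static_arith c0 c1 A_ge0.
Qed.

End static.

(** * Control of the velocity gradient by the vorticity *)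

Section gradient_arith.
Variable R : realType.

Lemma sum_products (d : 'I_3 -> 'I_3 -> R) :
  \sum_i \sum_j d i j ^+ 2 - 2^-1 * \sum_a \sum_b (d a b - d b a) ^+ 2 =
  \sum_i \sum_j d i j * d j i.
Proof. by rewrite !sum3; field. Qed.

Lemma sum_cyclic (E : 'I_3 -> 'I_3 -> R) : (forall a b, E b a = E a b) -> (forall a, E a a = 0) ->
  2 * \sum_k E (k + 1) (k + 2%:R) = \sum_a \sum_b E a b.
Proof.
move=> sE E0; rewrite !sum3.
have e1 : (1 + 2%:R : 'I_3) = 0 by exact/val_inj.
have e2 : (2%:R + 2%:R : 'I_3) = 1 by exact/val_inj.
have e3' : (2%:R + 1 : 'I_3) = 0 by exact/val_inj.
have e4 : (1 + 1 : 'I_3) = 2%:R by exact/val_inj.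
rewrite !add0r e1 e2 e3' e4 !E0 (sE 0 1) (sE 0 2%:R) (sE 1 2%:R).
ring.
Qed.

End gradient_arith.

Lemma ae3S2 (R : realType) (P Q S : R3 R -> Prop) : (forall x, P x -> Q x -> S x) ->
  {ae leb3 R, forall x, P x} -> {ae leb3 R, forall x, Q x} -> {ae leb3 R, forall x, S x}.
Proof. exact: (@filterS2 _ _ (ae3_filter R)). Qed.

Section gradient.
Variable R : realType.
Local Notation mu := (leb3 R).
Implicit Types (f g h d : R3 R -> R) (i j a b : 'I_3).
Variable u : vfield R.
Hypothesis Cu : forall i n, Ck n (u i).
Hypothesis Hu : forall i, H1 (u i).
Hypothesis div0 : forall x, \sum_i partial i (u i) x = 0.

Definition enstrophy : R := \sum_a \sum_b \int[mu]_x (Om u a b x ^+ 2).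

Lemma Om2_intg a b : intg (fun x => Om u a b x ^+ 2).
Proof. by apply: L2_sqr; exact: Om_L2. Qed.

Lemma du2_intg i j : intg (fun x => partial i (u j) x ^+ 2).
Proof. by apply: L2_sqr; exact: du_L2. Qed.

Let P : R3 R -> R := fun x =>
  \sum_i \sum_j partial i (u j) x ^+ 2 - 2^-1 * \sum_a \sum_b Om u a b x ^+ 2.

Lemma P_intg : intg P.
Proof.
apply: intgB; first by do 2!(apply: intg_sum => ?); exact: du2_intg.
by apply: intgZ; do 2!(apply: intg_sum => ?); exact: Om2_intg.
Qed.

Lemma P_integral : \int[mu]_x P x =
  \sum_i \sum_j \int[mu]_x (partial i (u j) x ^+ 2) - 2^-1 * enstrophy.
Proof.
have S (F : 'I_3 -> 'I_3 -> R3 R -> R) : (forall i j, intg (F i j)) ->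
    \int[mu]_x (\sum_i \sum_j F i j x) = \sum_i \sum_j \int[mu]_x F i j x.
  move=> iF; rewrite RI_sum; last by move=> k; apply: intg_sum => l; exact: iF.
  by apply: eq_bigr => i _; rewrite RI_sum//; exact: iF.
have i1 : intg (fun x => \sum_i \sum_j partial i (u j) x ^+ 2).
  by do 2!(apply: intg_sum => ?); exact: du2_intg.
have i2 : intg (fun x => \sum_a \sum_b Om u a b x ^+ 2).
  by do 2!(apply: intg_sum => ?); exact: Om2_intg.
apply: eq_trans (RI_B i1 (intgZ 2^-1 i2)) _.
congr (_ - _); first exact: S du2_intg.
apply: eq_trans (RI_Z _ i2) _; congr (_ * _); exact: S Om2_intg.
Qed.

Lemma P_products x : P x = \sum_i \sum_j partial i (u j) x * partial j (u i) x.
Proof.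
exact: (sum_products (fun i j => partial i (u j) x)).
Qed.

Section with_cutoff.
Variable r : R.
Hypothesis r0 : 0 < r.
Local Notation eta := (cutoff r).
Let H i j : R3 R -> R := fun x => eta x * (u j x * partial j (u i) x).

Lemma H_Ck i j n : Ck n (H i j).
Proof.
by apply: CkM; [exact: cutoff_Ck|apply: CkM; [exact: Cu|apply: Ck_partial; exact: Cu]].
Qed.

Lemma H_csupp i j : csupp (H i j).
Proof. exact: cutoffM_csupp. Qed.

Lemma partial_H i j x : partial i (H i j) x =
  eta x * (u j x * partial j (partial i (u i)) x + partial j (u i) x * partial i (u j) x)
  + u j x * partial j (u i) x * partial i eta x.
Proof.
have Cin : Ck 1 (fun x => u j x * partial j (u i) x).
  by apply: CkM; [exact: Cu|apply: Ck_partial; exact: Cu].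
apply: eq_trans (partial_mul i x (cutoff_Ck 1 r) Cin) _.
congr (_ * _ + _).
apply: eq_trans (partial_mul i x (Cu j 1) (Ck_partial j (Cu i 2))) _.
exact: (congr1 (fun p => u j x * p + partial j (u i) x * partial i (u j) x) (@clairaut R (u i) i j x (Cu i 2))).
Qed.

Lemma div_derivative j x : \sum_i partial j (partial i (u i)) x = 0.
Proof.
rewrite -partial_sum; last by move=> k; apply: (@Ck_derivable _ 0); apply: Ck_partial; exact: Cu.
by rewrite (_ : (fun x => _) = fun=> 0) ?partialcst//; apply/funext => y; exact: div0.
Qed.

(* The product d_i u_j d_j u_i is a divergence when div u = 0. *)
Lemma cutoff_products x :
  eta x * (\sum_i \sum_j partial i (u j) x * partial j (u i) x) =
  \sum_i \sum_j (partial i (H i j) x - u j x * partial j (u i) x * partial i eta x).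
Proof.
transitivity (\sum_i \sum_j (eta x * (u j x * partial j (partial i (u i)) x)
   + eta x * (partial i (u j) x * partial j (u i) x))).
  have Z : \sum_i \sum_j eta x * (u j x * partial j (partial i (u i)) x) = 0.
    rewrite exchange_big/= big1// => j _.
    transitivity (eta x * (u j x * \sum_i partial j (partial i (u i)) x)); first by rewrite !mulr_sumr.
    by rewrite div_derivative !mulr0.
  under [RHS]eq_bigr do rewrite big_split/=.
  rewrite [RHS]big_split/= Z add0r.
  by rewrite mulr_sumr; apply: eq_bigr => i _; rewrite mulr_sumr.
apply: eq_bigr => i _; apply: eq_bigr => j _.
rewrite (partial_H i j x) addrK mulrDr; congr (_ + _ * _); exact: mulrC.
Qed.

Lemma cutoff_P_le (c : R) : (forall i x, `|partial i eta x| <= c) ->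
  \int[mu]_x (eta x ^+ 1 * P x) <= c * \sum_i \sum_j \int[mu]_x `|u j x * partial j (u i) x|.
Proof.
move=> dc.
have i1 i j : intg (partial i (H i j)).
  by apply: cc_intg; apply: cc_partial; [exact: H_csupp|exact: H_Ck].
have i2 i j : intg (fun x => u j x * partial j (u i) x).
  by apply: L2_mul; [exact: u_L2|exact: du_L2].
have i3 i j : intg (fun x => c * `|u j x * partial j (u i) x|).
  by apply: intgZ; apply: intg_norm; exact: i2.
have i4 i j : intg (fun x => partial i (H i j) x + c * `|u j x * partial j (u i) x|).
  exact: intgD.
have -> : (fun x => eta x ^+ 1 * P x) = (fun x => eta x * P x) by [].
have le x : eta x * P x <= \sum_i \sum_j (partial i (H i j) x + c * `|u j x * partial j (u i) x|).
  rewrite P_products cutoff_products; apply: ler_sum => i _; apply: ler_sum => j _.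
  rewrite lerD2l (le_trans (ler_norm _))// normrN normrM mulrC.
  by apply: ler_wpM2r; [exact: normr_ge0|exact: dc].
have iP : intg (fun x => eta x * P x).
  have c1 : cc (fun x => eta x * \sum_i \sum_j partial i (u j) x * partial j (u i) x).
    apply: ccMl; first exact: cutoff_cc.
    apply: (@Ck_cont _ 0); do 2!(apply: Ck_sum => ?).
    by apply: CkM; apply: Ck_partial; exact: Cu.
  rewrite (_ : (fun x => eta x * P x) = (fun x => eta x * \sum_i \sum_j partial i (u j) x * partial j (u i) x)).
    exact: cc_intg.
  by apply/funext => x; rewrite P_products.
have i5 i : intg (fun x => \sum_j (partial i (H i j) x + c * `|u j x * partial j (u i) x|)).
  by apply: intg_sum => j; exact: i4.
apply: le_trans (RI_le iP (intg_sum i5) le) _.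
rewrite (RI_sum i5) mulr_sumr; apply: ler_sum => i _.
rewrite (RI_sum (i4 i)) mulr_sumr; apply: ler_sum => j _.
rewrite le_eqVlt; apply/orP; left; apply/eqP.
apply: eq_trans (RI_D (i1 i j) (i3 i j)) _.
rewrite (int_partial i (H_csupp i j) (H_Ck i j 1)) add0r.
by apply: RI_Z; apply: intg_norm; exact: i2.
Qed.

End with_cutoff.

(** The difference of the two integrands is sum_ij d_i u_j d_j u_i, a divergence. Against [cutoff r]
    its integral is at most C/r times the integral of the |u_j d_j u_i|, finite because u and its
    gradient are in L^2; r then tends to infinity. *)
Lemma gradient_bound : \sum_i \sum_j \int[mu]_x (partial i (u j) x ^+ 2) <= 2^-1 * enstrophy.
Proof.
rewrite -subr_le0 -P_integral.
have [C C0 HC] := cutoff_partial R.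
pose L := \sum_i \sum_j \int[mu]_x `|u j x * partial j (u i) x|.
have h : forall n : nat, \int[mu]_x (cutoff n.+1%:R x ^+ 1 * P x) <= C * L * n.+1%:R^-1.
  move=> n; have n0 : 0 < n.+1%:R :> R by rewrite ltr0n.
  have := cutoff_P_le n0 (fun i x => HC n.+1%:R i x n0).
  by rewrite mulrAC.
have lim0 : C * L * n.+1%:R^-1 @[n --> \oo] --> (0 : R).
  by rewrite -(mulr0 (C * L)); apply: cvgMr; exact: cvg_harmonic.
apply: (@ler_cvg_to _ \oo _ R (fun n : nat => \int[mu]_x (cutoff n.+1%:R x ^+ 1 * P x))
  (fun n : nat => C * L * n.+1%:R^-1) _ _ (cutoff_limit 1 P_intg) lim0).
by apply: nearW; exact: h.
Qed.

Lemma partial_le_enstrophy i j : \int[mu]_x (partial i (u j) x ^+ 2) <= 2^-1 * enstrophy.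
Proof.
apply: le_trans gradient_bound.
apply: (@le_trans _ _ (\sum_j \int[mu]_x (partial i (u j) x ^+ 2))).
  by apply: (@le_sum3 R (fun j => \int[mu]_x (partial i (u j) x ^+ 2))) => k; exact: RI_sqr_ge0.
apply: (@le_sum3 R (fun i => \sum_j \int[mu]_x (partial i (u j) x ^+ 2))) => k.
by apply: sumr_ge0 => l _; exact: RI_sqr_ge0.
Qed.

Lemma Om_le_enstrophy a b : \int[mu]_x (Om u a b x ^+ 2) <= enstrophy.
Proof.
apply: (@le_trans _ _ (\sum_b \int[mu]_x (Om u a b x ^+ 2))).
  by apply: (@le_sum3 R (fun b => \int[mu]_x (Om u a b x ^+ 2))) => k; exact: RI_sqr_ge0.
apply: (@le_sum3 R (fun i => \sum_j \int[mu]_x (Om u i j x ^+ 2))) => k.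
by apply: sumr_ge0 => l _; exact: RI_sqr_ge0.
Qed.

Lemma curl_VL2 : VL2 (fun i => Om u (i + 1) (i + 2)).
Proof. by move=> i; exact: Om_L2. Qed.

(** Each component of the curl occurs twice, as Om_ab and as Om_ba = -Om_ab, and the diagonal
    vanishes: hence the factor 2. *)
Lemma curl_enstrophy : 2 * L2norm (weak_curl u) ^+ 2 = enstrophy.
Proof.
have -> : L2norm (weak_curl u) = L2norm (fun i => Om u (i + 1) (i + 2)).
  symmetry; apply: ae_L2norm.
  - move=> i; apply: measurable_funB; apply: L2_mfun; exact: (proj1 (weak_partial_spec _ (Hu _))).
  - exact: curl_VL2.
  - move=> i.
    move: (weak_partial_classical (i + 1) (Hu (i + 2)) (Cu (i + 2) 1)) (weak_partial_classical (i + 2) (Hu (i + 1)) (Cu (i + 1) 1)).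
    by apply: ae3S2 => x; rewrite /weak_curl /Om => -> ->.
rewrite L2norm_sqr; last exact: curl_VL2.
rewrite /ip RI_sum; last by move=> i; apply: L2_mul; exact: Om_L2.
have E a b : \int[mu]_x (Om u b a x ^+ 2) = \int[mu]_x (Om u a b x ^+ 2).
  by apply: eq_Rintegral => x _; rewrite Om_anti sqrrN.
have E0 a : \int[mu]_x (Om u a a x ^+ 2) = 0.
  by under eq_Rintegral do rewrite Om_diag expr0n; rewrite Rintegral_cst// mul0r.
exact: (sum_cyclic (E := fun a b => \int[mu]_x (Om u a b x ^+ 2))).
Qed.

End gradient.

(** * Evolution of the localized enstrophy *)

Section local_uniform.
Variable R : realType.
Implicit Types (f g : R -> R3 R -> R) (s : R).

Lemma is_derive_near (g : R -> R) (s d : R) :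
  (forall e : R, 0 < e -> \forall t \near s, `|g t - g s - d * (t - s)| <= e * `|t - s|) ->
  is_derive s (1 : R) g d.
Proof.
move=> H.
have L : (fun h : R => h^-1 *: (g (h *: (1 : R) + s) - g s)) @ 0^' --> d.
  apply/cvgrPdist_le => e e0; have /nbhs_ballP[r /= r0 hr] := H e e0.
  rewrite near_withinE; apply/nbhs_ballP; exists r => //= h; rewrite /ball/= sub0r normrN => hlt h0.
  have /hr : ball s r (h *: (1 : R) + s).
    by rewrite /ball/= scaler1 opprD addrCA subrr addr0 normrN.
  rewrite scaler1 addrK => hh.
  have -> : d - h^-1 *: (g (h + s) - g s) = - (h^-1 * (g (h + s) - g s - d * h)).
    by rewrite mulrBr mulrCA mulVf// mulr1 opprB.
  by rewrite normrN normrM normfV ler_pdivrMl ?normr_gt0// [leRHS]mulrC.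
by split; [apply/cvg_ex; exists d|apply: cvg_lim].
Qed.

(** The common form of two different hypotheses, continuity of v into C^oo and joint continuity of
    the pressure gradient. It is stated at a single instant and is stable under sums and
    products. *)
Definition ucv s f := continuous (f s) /\
  forall r e : R, 0 < e -> \forall t \near s, forall x, cube r x -> `|f t x - f s x| <= e.

Lemma ucv_cst s (h : R3 R -> R) : continuous h -> ucv s (fun=> h).
Proof.
move=> ch; split; first exact: ch.
by move=> r e e0; apply: filterE => t x _; rewrite subrr normr0 ltW.
Qed.

Lemma ucvD s f g : ucv s f -> ucv s g -> ucv s (fun t x => f t x + g t x).
Proof.
move=> [cf Hf] [cg Hg]; split => [x|r e e0]; first by apply: continuousD; [exact: cf|exact: cg].
have e2 : 0 < e / 2 by rewrite divr_gt0.
move: (Hf r _ e2) (Hg r _ e2); apply: filterS2 => t hf hg x cx.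
rewrite opprD addrACA (splitr e); apply: le_trans (ler_normD _ _) _.
by apply: lerD; [exact: hf|exact: hg].
Qed.

Lemma ucvN s f : ucv s f -> ucv s (fun t x => - f t x).
Proof.
move=> [cf Hf]; split => [x|r e e0]; first by apply: continuousN; exact: cf.
by move: (Hf r _ e0); apply: filterS => t hf x cx; rewrite -opprD normrN; exact: hf.
Qed.

Lemma ucvB s f g : ucv s f -> ucv s g -> ucv s (fun t x => f t x - g t x).
Proof. by move=> uf ug; apply: ucvD => //; exact: ucvN. Qed.

Lemma ucv_sum s m (F : 'I_m -> R -> R3 R -> R) : (forall k, ucv s (F k)) ->
  ucv s (fun t x => \sum_k F k t x).
Proof.
elim: m F => [|m IH] F UF.
  have -> : (fun t x => \sum_k F k t x) = (fun=> fun=> 0).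
    by apply/funext => t; apply/funext => x; rewrite big_ord0.
  by apply: ucv_cst => x; exact: cst_continuous.
have -> : (fun t x => \sum_k F k t x) =
    (fun t x => \sum_(k < m) F (widen_ord (leqnSn m) k) t x + F ord_max t x).
  by apply/funext => t; apply/funext => x; rewrite big_ord_recr.
by apply: ucvD; [exact: (IH (fun k => F (widen_ord (leqnSn m) k)))|exact: UF].
Qed.

Lemma ucv_bounded s f r : ucv s f ->
  exists2 B : R, 0 < B & \forall t \near s, forall x, cube r x -> `|f t x| <= B.
Proof.
move=> [cf Hf]; have [M M0 fM] := continuous_cube_bounded r cf.
exists (M + 1); first by rewrite addr_gt0.
move: (Hf r 1 ltr01); apply: filterS => t ht x cx.
rewrite -[f t x](subrK (f s x)) addrC; apply: le_trans (ler_normD _ _) _.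
by apply: lerD; [exact: fM|exact: ht].
Qed.

Lemma mul_close (a b a' b' B B' d : R) : `|a'| <= B -> `|b| <= B' ->
  `|a - a'| <= d -> `|b - b'| <= d -> `|a * b - a' * b'| <= d * (B + B').
Proof.
move=> h1 h2 h3 h4.
have -> : a * b - a' * b' = (b - b') * a' + (a - a') * b by ring.
apply: le_trans (ler_normD _ _) _; rewrite !normrM mulrDr.
by apply: lerD; apply: ler_pM.
Qed.

Lemma ucvM s f g : ucv s f -> ucv s g -> ucv s (fun t x => f t x * g t x).
Proof.
move=> uf ug; split => [x|r e e0].
  by apply: continuousM; [exact: (proj1 uf)|exact: (proj1 ug)].
have [B B0 hB] := continuous_cube_bounded r (proj1 uf).
have [B' B'0 hB'] := ucv_bounded r ug.
have d0 : 0 < e / (B + B') by rewrite divr_gt0// addr_gt0.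
move: (proj2 uf r _ d0) (proj2 ug r _ d0) hB'; apply: filterS3 => t hf hg hb x cx.
have BB : B + B' != 0 by rewrite gt_eqF// addr_gt0.
rewrite -[e](divfK BB).
by apply: mul_close; [exact: hB|exact: hb|exact: hf|exact: hg].
Qed.

Lemma ucv_near s f g : (\forall t \near s, f t = g t) -> ucv s f -> ucv s g.
Proof.
move=> fg [cf Hf]; have E := nbhs_singleton fg.
split; first by rewrite -E.
by move=> r e e0; move: (Hf r _ e0) fg; apply: filterS2 => t ht <- x cx; rewrite -E; exact: ht.
Qed.

(** Compactness of the cube, in its near-covering form, turns neighbourhoods of the points (s, x)
    into one neighbourhood of [s]. The difference is split through the value at the centre (s,
    x). *)
Lemma ucv_jointly_continuous s f : (forall x, {for (s, x), continuous (fun z : R * R3 R => f z.1 z.2)}) ->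
  ucv s f.
Proof.
move=> cf.
have cs : continuous (f s).
  move=> x; apply: (@continuous_comp _ _ _ (fun y : R3 R => (s, y)) (fun z : R * R3 R => f z.1 z.2)); last exact: cf.
  exact: (@cvg_pair _ _ _ (nbhs x) (nbhs s) (nbhs x) _ _ _ (fun=> s) id (cvg_cst s) cvg_id).
split => // r e e0.
have e2 : 0 < e / 2 by rewrite divr_gt0.
have := proj1 (@compact_near_coveringP _ (cube r)) (@cube_compact R r).
move=> NC; apply: (NC R (nbhs s) (fun t x => `|f t x - f s x| <= e)) => x _.
have /cvgrPdist_le/(_ _ e2) [[A B] [/= nA nB] AB] := cf x.
have /cvgrPdist_le/(_ _ e2) nB' := cs x.
exists (B `&` (fun y => `|f s x - f s y| <= e / 2), A) => /=.
  by split => //; apply: filterI.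
move=> [y t] /= [[By hy] At].
have := AB (t, y) (conj At By); rewrite /= => h.
rewrite -[X in `|X|](subrKA (f s x)) (splitr e); apply: le_trans (ler_normD _ _) _.
by apply: lerD; [rewrite distrC|].
Qed.

Lemma ucv_family s f : continuous (f s) -> {family compact, f @ s --> f s} -> ucv s f.
Proof.
move=> cs /fam_cvgP H; split => // r e e0.
have /uniform_nbhs U : nbhs (f s : {uniform` cube r -> R}) [set h | forall y, cube r y -> `|f s y - h y| < e].
  by apply/uniform_nbhs; exists [set xy | ball xy.1 e xy.2]; split => //; rewrite -entourage_ballE; exists e.
have FF : Filter (f t @[t --> s]) by exact: fmap_filter.
have := H FF (cube r) (@cube_compact R r) _ (proj2 (uniform_nbhs _ _) U).
move=> h; apply: (@filterS _ (nbhs s) _ _ _ _ h) => t ht x cx.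
by rewrite distrC ltW//; exact: ht.
Qed.

End local_uniform.

(** * Continuity of a function with continuous partial derivatives *)

Section continuous_partials.
Variable R : realType.
Implicit Types (p : R3 R -> R) (x y : R3 R).

Lemma mvt_bound (g dg : R -> R) (a b d e : R) :
  (forall t : R, t \in `[Num.min a b, Num.max a b] -> is_derive t (1 : R) g (dg t)) ->
  (forall t : R, t \in `[Num.min a b, Num.max a b] -> `|dg t - d| <= e) ->
  `|g b - g a - (b - a) * d| <= `|b - a| * e.
Proof.
wlog ab : a b / a <= b.
  move=> W gd ge; have [ab|ba] := leP a b; first exact: W.
  rewrite minC maxC in gd ge; have := W b a (ltW ba) gd ge.
  rewrite [`|a - b|]distrC.
  by rewrite (_ : g a - g b - (a - b) * d = - (g b - g a - (b - a) * d)) ?normrN//; ring.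
rewrite min_l// max_r// => gd ge.
have cg : {within `[a, b], continuous g}.
  apply: continuous_in_subspaceT => t; rewrite inE/= => tab.
  by apply: differentiable_continuous; apply/derivable1_diffP; case: (gd t tab).
have [c cab ->] := @MVT_segment R g dg a b ab (fun t tab => gd t (subset_itv_oo_cc tab)) cg.
by rewrite [dg c * _]mulrC -mulrBr normrM ler_wpM2l//; exact: ge.
Qed.

Lemma partial_mvt p i x (a b M : R) :
  (forall t : R, t \in `[Num.min a b, Num.max a b] -> derivable p (upd i x t) (e3 R i)) ->
  (forall t : R, t \in `[Num.min a b, Num.max a b] -> `|partial i p (upd i x t)| <= M) ->
  `|p (upd i x b) - p (upd i x a)| <= M * `|b - a|.
Proof.
move=> dp pM; rewrite mulrC.
have := @mvt_bound (fun s => p (upd i x s)) (fun t => partial i p (upd i x t)) a b 0 M.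
rewrite mulr0 subr0; apply => t tab; first by apply: is_derive_upd; exact: dp.
by rewrite subr0; exact: pM.
Qed.

Lemma ball_segment (a b c e t : R) : ball c e a -> ball c e b ->
  t \in `[Num.min a b, Num.max a b] -> ball c e t.
Proof.
rewrite /ball/= !ltr_norml in_itv/= => /andP[a1 a2] /andP[b1 b2].
by have [ab|ba] := leP a b => /andP[t1 t2]; apply/andP; split; lra.
Qed.

(** For the pressure, only existence and continuity of its partial derivatives are given. Continuity
    of [p] follows from the mean value theorem along three axis-parallel segments from [x] to [y],
    all within a ball where the derivatives are bounded by [M]. *)
Lemma continuous_partials_Ck p : (forall i x, derivable p x (e3 R i)) ->
  (forall i, continuous (partial i p)) -> Ck 1 p.
Proof.
move=> dp cp; split; last by move=> i; split => [x|]; [exact: dp|exact: (conj (cp i) I)].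
move=> x; apply/cvgrPdist_le => e e0.
have N i : \forall y \near x, `|partial i p y| <= `|partial i p x| + 1.
  have /cvgrPdist_le/(_ _ ltr01) := cp i x; apply: filterS => y hy.
  rewrite -[partial i p y](subrK (partial i p x)) addrC; apply: le_trans (ler_normD _ _) _.
  by rewrite lerD2l distrC.
pose M : R := \sum_i (`|partial i p x| + 1).
have M0 : 0 < M.
  by apply: lt_le_trans (le_sum3 0 _); [rewrite ltr_pwDr|move=> k; rewrite addr_ge0].
have : \forall y \near x, forall i, `|partial i p y| <= M.
  move: (N 0) (N 1) (N 2%:R); apply: filterS3 => y h0 h1 h2 i.
  apply: (@le_trans _ _ (`|partial i p x| + 1)); first by case: (ord3 i) => ->; [exact: h0|exact: h1|exact: h2].
  by apply: (@le_sum3 R (fun i => `|partial i p x| + 1)) => k; rewrite addr_ge0.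
move=> /nbhs_ballP[d /= d0 hd].
have dm : 0 < Num.min d (e / (3 * M)) by rewrite lt_min d0 divr_gt0// mulr_gt0.
change (nbhs (x : R3 R) (fun y => `|p x - p y| <= e)).
apply/nbhs_ballP; exists (Num.min d (e / (3 * M))) => // y.
move=> [[b0 b1] b2].
have W (k a : R) : ball a (Num.min d (e / (3 * M))) k -> ball a d k /\ `|a - k| <= e / (3 * M).
  by rewrite /ball/= lt_min => /andP[h1 /ltW h2].
have [B0 D0] := W _ _ b0; have [B1 D1] := W _ _ b1; have [B2 D2] := W _ _ b2.
have [bx0 bx1 bx2] : [/\ ball x.1.1 d x.1.1, ball x.1.2 d x.1.2 & ball x.2 d x.2].
  by split; exact: ballxx.
have E0 : `|p (upd 0 x x.1.1) - p (upd 0 x y.1.1)| <= M * `|x.1.1 - y.1.1|.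
  apply: partial_mvt => t tI; first exact: dp.
  by apply: hd; split; [split|] => //=; exact: ball_segment tI.
have E1 : `|p (upd 1 (upd 0 x y.1.1) x.1.2) - p (upd 1 (upd 0 x y.1.1) y.1.2)| <= M * `|x.1.2 - y.1.2|.
  apply: partial_mvt => t tI; first exact: dp.
  by apply: hd; split; [split|] => //=; exact: ball_segment tI.
have E2 : `|p (upd 2%:R y x.2) - p (upd 2%:R y y.2)| <= M * `|x.2 - y.2|.
  apply: partial_mvt => t tI; first exact: dp.
  by apply: hd; split; [split|] => //=; exact: ball_segment tI.
have S : `|p x - p y| <= M * `|x.1.1 - y.1.1| + M * `|x.1.2 - y.1.2| + M * `|x.2 - y.2|.
  move: E0 E1 E2; rewrite /upd/= -!surjective_pairing => E0 E1 E2.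
  apply: le_trans (lerD (lerD E0 E1) E2).
  by apply: le_trans _ (lerD (ler_normD _ _) (lexx _)); apply: le_trans _ (ler_normD _ _); rewrite !subrKA.
apply: (le_trans S); rewrite -!mulrDr.
have -> : e = M * (e / (3 * M) + e / (3 * M) + e / (3 * M)) by field; rewrite gt_eqF.
by rewrite ler_wpM2l ?(ltW M0)//; apply: lerD => //; apply: lerD.
Qed.

End continuous_partials.

(** * Elimination of the pressure, and error estimates *)

Section pressure.
Variable R : realType.
Local Notation mu := (leb3 R).

(** The pressure is only known to be C^1, so its curl-freeness is used weakly: the derivatives are
    moved onto [phi], whose mixed derivatives commute. *)
Lemma curl_grad_free (p phi : R3 R -> R) (a b : 'I_3) : Ck 1 p -> csupp phi -> Ck 2 phi ->
  \int[mu]_x (partial a p x * partial b phi x - partial b p x * partial a phi x) = 0.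
Proof.
move=> Cp sphi Cphi.
have I i j : \int[mu]_x (partial i p x * partial j phi x) = - \int[mu]_x (p x * partial i (partial j phi) x).
  by rewrite (int_by_parts i (csupp_partial j sphi) Cp (Ck_partial j Cphi)) opprK.
have cI i j : cc (fun x => partial i p x * partial j phi x).
  apply: ccMr; first exact: Ck_cont (Ck_partial i Cp).
  by apply: cc_partial => //; exact: CkS.
rewrite intB//.
apply/eqP; rewrite subr_eq0; apply/eqP.
have J : \int[mu]_x (p x * partial a (partial b phi) x) = \int[mu]_x (p x * partial b (partial a phi) x).
  by apply: eq_Rintegral => x _; rewrite (@clairaut R phi a b x Cphi).
exact: (eq_trans (I a b) (eq_trans (congr1 (fun z => - z) J) (esym (I b a)))).
Qed.

Lemma curl_by_parts (f g phi : R3 R -> R) (a b : 'I_3) : Ck 1 f -> Ck 1 g -> csupp phi -> Ck 1 phi ->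
  \int[mu]_x (f x * partial b phi x - g x * partial a phi x) =
  \int[mu]_x ((partial a g x - partial b f x) * phi x).
Proof.
move=> Cf Cg sphi Cphi.
have c1 h j : Ck 1 h -> cc (fun x => h x * partial j phi x).
  by move=> Ch; apply: ccMr; [exact: Ck_cont Ch|exact: cc_partial].
have cphi : cc phi by split; [exact: Ck_cont Cphi|].
have c2 h j : Ck 1 h -> cc (fun x => partial j h x * phi x).
  by move=> Ch; apply: ccMr; [exact: Ck_cont (Ck_partial j Ch)|exact: cphi].
apply: eq_trans (intB (c1 _ b Cf) (c1 _ a Cg)) _.
under [in RHS]eq_Rintegral do rewrite mulrBl.
apply: (eq_trans _ (esym (intB (c2 _ a Cg) (c2 _ b Cf)))).
have e1 := int_by_parts b sphi Cf Cphi; have e2 := int_by_parts a sphi Cg Cphi.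
apply: eq_trans (congr2 (fun y z => y - z) e1 e2) _.
by rewrite opprK addrC.
Qed.

(* A continuous majorant of the indicator of [cube r]. *)
Definition bmp (r : R) : R3 R -> R := fun x =>
  4 - \sum_i `|crd i x| / r + `|4 - \sum_i `|crd i x| / r|.

Lemma bmp_cc r : 0 < r -> cc (bmp r).
Proof.
move=> r0.
have cy : continuous (fun x : R3 R => 4 - \sum_i `|crd i x| / r).
  have E : (fun x : R3 R => 4 - \sum_i `|crd i x| / r) =
      (fun x => 4 - (`|crd 0 x| / r + `|crd 1 x| / r + `|crd 2%:R x| / r)).
    by apply/funext => x; rewrite sum3.
  rewrite E => x.
  have C i : (fun x : R3 R => `|crd i x| / r) @ x --> `|crd i x| / r.
    by apply: cvgMl; apply: cvg_norm; exact: crd_continuous.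
  by apply: cvgB; [exact: cvg_cst|apply: cvgD; [apply: cvgD; exact: C|exact: C]].
split; first by move=> x; apply: cvgD; [exact: cy|apply: cvg_norm; exact: cy].
exists (4 * r) => x nx; rewrite /bmp.
have [i hi] : exists i, 4 * r < `|crd i x|.
  apply/not_existsP => h; apply: nx; apply: cube_crd => i.
  by rewrite leNgt; apply/negP; exact: h.
have le : 4 <= \sum_i `|crd i x| / r.
  apply: (@le_trans _ _ (`|crd i x| / r)); first by rewrite ler_pdivlMr// ltW.
  by apply: (@le_sum3 R (fun i => `|crd i x| / r)) => k; rewrite divr_ge0// ltW.
by rewrite ler0_norm ?subr_le0// addrN.
Qed.

Lemma bmp_ge0 r x : 0 <= bmp r x.
Proof. by rewrite /bmp -lerBlDl sub0r ler_normr lexx orbT. Qed.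

Lemma bmp_ge1 r x : 0 < r -> cube r x -> 1 <= bmp r x.
Proof.
move=> r0 cx; rewrite /bmp.
have h : \sum_i `|crd i x| / r <= 3.
  rewrite -[leRHS]mulr1 -sum3_cst; apply: ler_sum => i _.
  by rewrite ler_pdivrMr// mul1r crd_cube.
by rewrite ger0_norm; lra.
Qed.

Lemma int_bound (f : R3 R -> R) (r e : R) : 0 < r -> 0 <= e -> cc f ->
  (forall x, ~ cube r x -> f x = 0) -> (forall x, cube r x -> `|f x| <= e) ->
  `|\int[mu]_x f x| <= e * \int[mu]_x bmp r x.
Proof.
move=> r0 e0 cf f0 fe.
have le x : `|f x| <= e * bmp r x.
  have [cx|nx] := pselect (cube r x); last by rewrite f0// normr0 mulr_ge0// bmp_ge0.
  by apply: (le_trans (fe x cx)); rewrite ler_peMr// bmp_ge1.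
have cb := ccZ e (bmp_cc r0).
rewrite -(intZ e (bmp_cc r0)) ler_norml; apply/andP; split.
  rewrite -(intN cb); apply: int_le => //; first exact: ccN.
  by move=> x; rewrite lerNl (le_trans (ler_norm _))// normrN.
by apply: int_le => // x; apply: le_trans (ler_norm _) _.
Qed.

(** Here d is an increment of velocity over the time step h, D the time derivative, and P, P0 are
    derivatives of the test function at the two times. *)
Lemma quotient_close (h d D P P0 B delta : R) : `|d - h * D| <= `|h| * delta -> `|P - P0| <= delta ->
  `|D| <= B -> `|P| <= B -> `|d * P - h * (D * P0)| <= `|h| * (delta * (2 * B)).
Proof.
move=> h1 h2 h3 h4.
have -> : d * P - h * (D * P0) = (d - h * D) * P + h * (D * (P - P0)) by ring.
apply: le_trans (ler_normD _ _) _; rewrite !normrM.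
have -> : `|h| * (delta * (2 * B)) = `|h| * delta * B + `|h| * (B * delta) by ring.
apply: lerD; first exact: ler_pM.
by apply: ler_wpM2l => //; exact: ler_pM.
Qed.

Lemma quotient_close2 (h d D P P0 d' D' P' P0' B delta : R) :
  `|d - h * D| <= `|h| * delta -> `|P - P0| <= delta -> `|D| <= B -> `|P| <= B ->
  `|d' - h * D'| <= `|h| * delta -> `|P' - P0'| <= delta -> `|D'| <= B -> `|P'| <= B ->
  `|d * P - d' * P' - h * (D * P0 - D' * P0')| <= `|h| * (delta * (4 * B)).
Proof.
move=> h1 h2 h3 h4 h5 h6 h7 h8.
have k1 := quotient_close h1 h2 h3 h4; have k2 := quotient_close h5 h6 h7 h8.
have -> : d * P - d' * P' - h * (D * P0 - D' * P0') =
  (d * P - h * (D * P0)) - (d' * P' - h * (D' * P0')) by ring.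
apply: le_trans (ler_normB _ _) _; apply: le_trans (lerD k1 k2) _.
by rewrite le_eqVlt; apply/orP; left; apply/eqP; ring.
Qed.

End pressure.

(** * Time derivative of the localized enstrophy *)

Section time_derivative.
Variable R : realType.
Local Notation mu := (leb3 R).
Variables (T : \bar R) (v : R -> vfield R) (p : R -> R3 R -> R).
Hypothesis Cv : continuous_smooth T v.
Hypothesis NS : navier_stokes T v p.
Implicit Types (i j a b : 'I_3).

Lemma time_int_near (s : R) : time_int T s -> \forall t \near s, time_int T t.
Proof.
move=> [s0]; case: T => [q||]; rewrite /time_int/= ?lte_fin//.
- move=> sq; have m0 : 0 < Num.min s (q - s) by rewrite lt_min s0 subr_gt0.
  apply/nbhs_ballP; exists (Num.min s (q - s)) => // t.
  rewrite /ball/= lt_min !ltr_norml lte_fin => /andP[/andP[_ h1] /andP[h2 _]].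
  by split; lra.
- move=> _; apply/nbhs_ballP; exists s => // t.
  rewrite /ball/= ltr_norml => /andP[_ h]; split; [lra|exact: ltry].
Qed.

Lemma v_Ck (t : R) i n : time_int T t -> Ck n (v t i).
Proof. by move=> ht; apply: smooth_Ck; exact: (proj1 Cv). Qed.

Lemma ucv_partials (s : R) i (l : seq 'I_3) : time_int T s -> ucv s (fun t => partials l (v t i)).
Proof.
move=> hs; apply: ucv_family; last exact: (proj2 Cv).
exact: (proj1 (proj1 Cv s i hs l)).
Qed.

Lemma ucv_Om (s : R) a b : time_int T s -> ucv s (fun t => Om (v t) a b).
Proof. by move=> hs; apply: ucvB; [exact: (ucv_partials b [:: a])|exact: (ucv_partials a [:: b])]. Qed.

Lemma ucv_dOm (s : R) j a b : time_int T s -> ucv s (fun t => partial j (Om (v t) a b)).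
Proof.
move=> hs; apply: (@ucv_near _ _ (fun t x => partial j (partial a (v t b)) x - partial j (partial b (v t a)) x)).
  move: (time_int_near hs); apply: filterS => t ht; apply/funext => x.
  by rewrite partial_Om// => i n; exact: v_Ck.
by apply: ucvB; [exact: (ucv_partials b [:: j; a])|exact: (ucv_partials a [:: j; b])].
Qed.

Lemma ucv_force (s : R) i : time_int T s -> ucv s (fun t => force (v t) i).
Proof.
move=> hs; apply: ucvB; apply: ucv_sum => j; first exact: (ucv_partials i [:: j; j]).
by apply: ucvM; [exact: (ucv_partials j [::])|exact: (ucv_partials i [:: j])].
Qed.

Lemma pressure_Ck (s : R) : time_int T s -> Ck 1 (p s).
Proof.
case: NS => _ dp cp _ _ hs; apply: continuous_partials_Ck => [i x|i]; first exact: dp.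
by apply: (proj1 (@ucv_jointly_continuous R s (fun t => partial i (p t)) _)) => x; exact: cp.
Qed.

Definition vt i (t : R) : R3 R -> R := fun x => force (v t) i x - partial i (p t) x.

Lemma ucv_vt (s : R) i : time_int T s -> ucv s (vt i).
Proof.
move=> hs; apply: ucvB; first exact: ucv_force.
by apply: ucv_jointly_continuous => x; case: NS => _ _ cp _ _; exact: cp.
Qed.

Lemma is_derive_v (t : R) x i : time_int T t -> is_derive t (1 : R) (fun s => v s i x) (vt i t x).
Proof.
case: NS => dv _ _ E _ ht; split; first exact: dv.
have := E t x i ht; rewrite /vt /force => {}E.
by rewrite addrAC -E addrK.
Qed.

(** At fixed [x] the mean value theorem in time bounds the error by the oscillation of [vt], which
    is uniform over the cube. *)
Lemma time_quotient (s r e : R) i : time_int T s -> 0 < e ->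
  \forall t \near s, forall x, cube r x -> `|v t i x - v s i x - (t - s) * vt i s x| <= `|t - s| * e.
Proof.
move=> hs e0.
have : \forall t \near s, time_int T t /\ forall x, cube r x -> `|vt i t x - vt i s x| <= e.
  by move: (time_int_near hs) (proj2 (ucv_vt i hs) r e e0); apply: filterS2.
move=> /nbhs_ballP[d /= d0 hd]; apply/nbhs_ballP; exists d => //= t bt x cx.
have I (q : R) : q \in `[Num.min s t, Num.max s t] -> ball s d q.
  by apply: ball_segment => //; exact: ballxx.
apply: (@mvt_bound R (fun q => v q i x) (fun q => vt i q x) s t (vt i s x) e) => q /I bq.
  by apply: is_derive_v; case: (hd q bq).
by case: (hd q bq) => _; exact.
Qed.

Section energy_derivative.
Variables (r s : R) (a b : 'I_3).
Hypothesis r0 : 0 < r.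
Hypothesis hs : time_int T s.

Let chi : R3 R -> R := fun x => cutoff r x * cutoff r x * (cutoff r x * cutoff r x).
Let psi (t : R) : R3 R -> R := fun x => chi x * (Om (v t) a b x + Om (v s) a b x).

Lemma psi_Ck (t : R) n : time_int T t -> Ck n (psi t).
Proof.
move=> ht; apply: CkM; first exact: eta4_Ck.
by apply: CkD; apply: Om_Ck => i m; exact: v_Ck.
Qed.

Lemma psi_out (t : R) x : ~ cube r x -> psi t x = 0.
Proof. by move=> nx; rewrite /psi /chi cutoff_out// !mul0r. Qed.

Lemma psi_csupp (t : R) : csupp (psi t).
Proof. by exists r => x; exact: psi_out. Qed.

Lemma ucv_dpsi j : ucv s (fun t => partial j (psi t)).
Proof.
apply: (@ucv_near _ _ (fun t x => chi x * (partial j (Om (v t) a b) x + partial j (Om (v s) a b) x)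
   + (Om (v t) a b x + Om (v s) a b x) * partial j chi x)).
  move: (time_int_near hs); apply: filterS => t ht; apply/funext => x.
  have Ct : Ck 1 (Om (v t) a b) by apply: Om_Ck => i n; exact: v_Ck.
  have Cs : Ck 1 (Om (v s) a b) by apply: Om_Ck => i n; exact: v_Ck.
  rewrite /psi; symmetry; apply: eq_trans (partial_mul j x (eta4_Ck r 1) (CkD Ct Cs)) _.
  congr (_ * _ + _); apply: partialD; [exact: Ck_derivable Ct|exact: Ck_derivable Cs].
have cchi : continuous chi by exact: Ck_cont (eta4_Ck r 0).
have Cs : Ck 1 (Om (v s) a b) by apply: Om_Ck => i n; exact: v_Ck.
apply: ucvD; apply: ucvM.
- exact: ucv_cst cchi.
- by apply: ucvD; [exact: ucv_dOm|apply: ucv_cst; exact: Ck_cont (Ck_partial j Cs)].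
- by apply: ucvD; [exact: ucv_Om|apply: ucv_cst; exact: Ck_cont Cs].
- by apply: ucv_cst; exact: Ck_cont (Ck_partial j (eta4_Ck r 1)).
Qed.

Let G (t : R) : R := \int[mu]_x (cutoff r x ^+ 4 * Om (v t) a b x ^+ 2).

Lemma chi_Om_cc (t : R) : time_int T t -> cc (fun x => cutoff r x ^+ 4 * Om (v t) a b x ^+ 2).
Proof.
move=> ht; apply: ccMl; first exact: eta4_cc.
have C : Ck 0 (Om (v t) a b) by apply: Om_Ck => i n; exact: v_Ck.
by apply: (@Ck_cont _ 0); exact: (CkM C C).
Qed.

(* Only v, not its curl, is known to be differentiable in time; hence all space
   derivatives are moved onto psi before dividing by t - s. *)
Lemma energy_increment (t : R) : time_int T t -> G t - G s =
  \int[mu]_x ((v t a x - v s a x) * partial b (psi t) x - (v t b x - v s b x) * partial a (psi t) x).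
Proof.
move=> ht.
have Cd i : Ck 1 (fun x => v t i x - v s i x) by apply: CkB; exact: v_Ck.
rewrite (curl_by_parts a b (Cd a) (Cd b) (psi_csupp t) (psi_Ck 1 ht)).
rewrite -(intB (chi_Om_cc ht) (chi_Om_cc hs)); apply: eq_Rintegral => x _.
have dd i j : partial i (fun x => v t j x - v s j x) x = partial i (v t j) x - partial i (v s j) x.
  by apply: partialB; apply: (@Ck_derivable _ 0); exact: v_Ck.
rewrite (dd a b) (dd b a) /psi /chi /Om.
generalize (partial a (v t b) x) (partial a (v s b) x) (partial b (v t a) x) (partial b (v s a) x) (cutoff r x) => *.
ring.
Qed.

(** At t = s the test function is 2 eta^4 Om, whence the factor 2. The pressure part vanishes by
    [curl_grad_free], and the curl of [force] is [Q]. *)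
Lemma energy_rate : \int[mu]_x (vt a s x * partial b (psi s) x - vt b s x * partial a (psi s) x) =
  2 * \int[mu]_x (cutoff r x ^+ 4 * (Om (v s) a b x * Q (v s) a b x)).
Proof.
have Cvs i n : Ck n (v s i) by exact: v_Ck.
have CF i : Ck 1 (force (v s) i) by exact: force_Ck.
have cM (f : R3 R -> R) j : continuous f -> cc (fun x => f x * partial j (psi s) x).
  by move=> cf; apply: ccMr => //; apply: cc_partial; [exact: psi_csupp|exact: psi_Ck].
have c1 : cc (fun x => force (v s) a x * partial b (psi s) x - force (v s) b x * partial a (psi s) x).
  by apply: ccB; apply: cM; exact: Ck_cont (CF _).
have c2 : cc (fun x => partial a (p s) x * partial b (psi s) x - partial b (p s) x * partial a (psi s) x).
  by apply: ccB; apply: cM; exact: Ck_cont (Ck_partial _ (pressure_Ck hs)).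
transitivity (\int[mu]_x (force (v s) a x * partial b (psi s) x - force (v s) b x * partial a (psi s) x
  - (partial a (p s) x * partial b (psi s) x - partial b (p s) x * partial a (psi s) x))).
  apply: eq_Rintegral => x _; rewrite /vt.
  generalize (force (v s) a x) (force (v s) b x) (partial a (p s) x) (partial b (p s) x) (partial b (psi s) x) (partial a (psi s) x) => *.
  ring.
apply: eq_trans (intB c1 c2) _.
rewrite (curl_grad_free a b (pressure_Ck hs) (psi_csupp s) (psi_Ck 2 hs)) subr0.
rewrite (curl_by_parts a b (CF a) (CF b) (psi_csupp s) (psi_Ck 1 hs)).
rewrite -(intZ 2 (energy_lhs_cc Cvs r0 a b)); apply: eq_Rintegral => x _.
rewrite /psi /chi -/(Q (v s) a b x).
generalize (Q (v s) a b x) (Om (v s) a b x) (cutoff r x) => *; ring.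
Qed.

Lemma energy_derivative : is_derive s (1 : R) G
  (2 * \int[mu]_x (cutoff r x ^+ 4 * (Om (v s) a b x * Q (v s) a b x))).
Proof.
apply: is_derive_near => e e0.
have [B1 B10 hB1] := ucv_bounded r (ucv_dpsi a).
have [B2 B20 hB2] := ucv_bounded r (ucv_dpsi b).
have [B3 B30 hB3] := continuous_cube_bounded r (proj1 (ucv_vt a hs)).
have [B4 B40 hB4] := continuous_cube_bounded r (proj1 (ucv_vt b hs)).
pose B : R := B1 + B2 + B3 + B4.
have B0 : 0 < B by rewrite /B !addr_gt0.
have [l1 l2 l3 l4] : [/\ B1 <= B, B2 <= B, B3 <= B & B4 <= B] by split; rewrite /B; lra.
pose beta : R := \int[mu]_x bmp r x.
have beta0 : 0 <= beta by apply: int_ge0 => x; exact: bmp_ge0.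
(* [quotient_close2] gives the error |t - s| delta 4 B on the cube, which [int_bound] multiplies by
   beta; this choice keeps the product below e |t - s|. The summand 1 makes the denominator positive
   without a lower bound on beta. *)
pose delta : R := e / (4 * B * (beta + 1)).
have K0 : 0 < 4 * B * (beta + 1) by rewrite !mulr_gt0// ltr_wpDl.
have delta0 : 0 < delta by rewrite /delta divr_gt0.
have N1 : \forall t \near s, time_int T t /\
   forall x, cube r x -> `|partial a (psi t) x| <= B /\ `|partial b (psi t) x| <= B.
  move: (time_int_near hs) hB1 hB2; apply: filterS3 => t ht h1 h2; split => // x cx.
  by split; [exact: le_trans (h1 x cx) l1|exact: le_trans (h2 x cx) l2].
have N2 : \forall t \near s, forall x, cube r x ->
    `|partial a (psi t) x - partial a (psi s) x| <= delta /\ `|partial b (psi t) x - partial b (psi s) x| <= delta.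
  move: (proj2 (ucv_dpsi a) r _ delta0) (proj2 (ucv_dpsi b) r _ delta0).
  by apply: filterS2 => t h1 h2 x cx; split; [exact: h1|exact: h2].
have N3 : \forall t \near s, forall x, cube r x ->
    `|v t a x - v s a x - (t - s) * vt a s x| <= `|t - s| * delta /\
    `|v t b x - v s b x - (t - s) * vt b s x| <= `|t - s| * delta.
  move: (time_quotient r a hs delta0) (time_quotient r b hs delta0).
  by apply: filterS2 => t h1 h2 x cx; split; [exact: h1|exact: h2].
move: N1 N2 N3; apply: filterS3 => t [ht n1] n2 n3.
rewrite (energy_increment ht) -energy_rate mulrC.
have cM (f : R3 R -> R) (q : R) j : time_int T q -> continuous f -> cc (fun x => f x * partial j (psi q) x).
  by move=> hq cf; apply: ccMr => //; apply: cc_partial; [exact: psi_csupp|exact: psi_Ck].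
have cv i : continuous (fun x => v t i x - v s i x).
  by apply: (@Ck_cont _ 0); apply: CkB; exact: v_Ck.
have cD : cc (fun x => (v t a x - v s a x) * partial b (psi t) x - (v t b x - v s b x) * partial a (psi t) x).
  by apply: ccB; apply: cM.
have cE : cc (fun x => vt a s x * partial b (psi s) x - vt b s x * partial a (psi s) x).
  by apply: ccB; apply: cM => //; exact: (proj1 (ucv_vt _ hs)).
rewrite -(intZ (t - s) cE) -(intB cD (ccZ (t - s) cE)).
apply: le_trans (@int_bound R _ r (`|t - s| * (delta * (4 * B))) r0 _ _ _ _) _.
- by rewrite mulr_ge0// mulr_ge0 ?(ltW delta0)// mulr_ge0// ltW.
- by apply: ccB => //; exact: ccZ.
- move=> x nx.
  have P q j : partial j (psi q) x = 0.
    by apply: (@partial_out R (psi q) j r x) => // y; exact: psi_out.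
  by rewrite !P !mulr0 subrr mulr0 subrr.
- move=> x cx.
  have [p1 p2] := n1 x cx; have [q1 q2] := n2 x cx; have [w1 w2] := n3 x cx.
  have D1 : `|vt a s x| <= B by exact: le_trans (hB3 x cx) l3.
  have D2 : `|vt b s x| <= B by exact: le_trans (hB4 x cx) l4.
  exact: (quotient_close2 w1 q2 D1 p2 w2 q1 D2 p1).
rewrite -mulrA mulrC; apply: ler_wpM2r => //.
have -> : delta * (4 * B) * \int[mu]_x bmp r x = e * (beta / (beta + 1)).
  by rewrite -/beta /delta; field; rewrite !gt_eqF// ltr_wpDl.
by rewrite ler_piMr ?(ltW e0)// ler_pdivrMr ?ltr_wpDl// mul1r lerDl.
Qed.

End energy_derivative.
End time_derivative.

(** * Norms of velocity and vorticity compared with the H^1 norm *)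

Section norms.
Variable R : realType.
Local Notation mu := (leb3 R).
Implicit Types (u d : vfield R).

Lemma subB_exchange (x y z t : R) : x - y - (z - t) = x - z - (y - t).
Proof. by ring. Qed.

Lemma weak_partial_VL2 u j : (forall i, H1 (u i)) -> VL2 (fun i => weak_partial j (u i)).
Proof. by move=> Hu i; exact: (proj1 (weak_partial_spec j (Hu i))). Qed.

Lemma weak_curl_VL2 u : (forall i, H1 (u i)) -> VL2 (weak_curl u).
Proof. by move=> Hu i; apply: L2B; apply: (proj1 (weak_partial_spec _ (Hu _))). Qed.

Lemma H1_VL2 u : (forall i, H1 (u i)) -> VL2 u.
Proof. by move=> Hu i; case: (Hu i). Qed.

Lemma curl_sqr_le (d : 'I_3 -> 'I_3 -> R) :
  \sum_i (d (i + 1) (i + 2%:R) - d (i + 2%:R) (i + 1)) * (d (i + 1) (i + 2%:R) - d (i + 2%:R) (i + 1)) <=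
  2 * \sum_j \sum_i d j i * d j i.
Proof.
have h (x y : R) : (x - y) * (x - y) <= 2 * (x * x + y * y).
  by have := sqr_ge0 (x + y); nra.
rewrite !sum3.
have e1 : (1 + 2%:R : 'I_3) = 0 by exact/val_inj.
have e2 : (2%:R + 2%:R : 'I_3) = 1 by exact/val_inj.
have e3' : (2%:R + 1 : 'I_3) = 0 by exact/val_inj.
have e4 : (1 + 1 : 'I_3) = 2%:R by exact/val_inj.
rewrite !add0r e1 e2 e3' e4.
have := h (d 1 2%:R) (d 2%:R 1); have := h (d 2%:R 0) (d 0 2%:R); have := h (d 0 1) (d 1 0).
have s i : 0 <= d i i * d i i by rewrite -expr2 sqr_ge0.
have := s 0; have := s 1; have := s 2%:R.
lra.
Qed.

Lemma double_le (S L : R) : 0 <= S -> 0 <= L -> 2 * S <= 2 ^+ 2 * (L + S).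
Proof. by move=> S0 L0; rewrite -natrX; lra. Qed.

Lemma L2norm_le_H1norm u : L2norm u <= H1norm u.
Proof.
rewrite /H1norm -[leLHS](ger0_norm (L2norm_ge0 u)) -sqrtr_sqr ler_wsqrtr// lerDl.
by apply: sumr_ge0 => j _; exact: sqr_ge0.
Qed.

Lemma L2norm_curl_le u : (forall i, H1 (u i)) -> L2norm (weak_curl u) <= 2 * H1norm u.
Proof.
move=> Hu; have N0 : 0 <= 2 * H1norm u by rewrite mulr_ge0// sqrtr_ge0.
rewrite -ler_sqr ?nnegrE ?L2norm_ge0// (L2norm_sqr (weak_curl_VL2 Hu)).
have iw j i : intg (fun x => weak_partial j (u i) x * weak_partial j (u i) x).
  by apply: L2_mul; exact: (weak_partial_VL2 j Hu i).
have E : ip (weak_curl u) (weak_curl u) <= 2 * \sum_j L2norm (fun i => weak_partial j (u i)) ^+ 2.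
  have -> : \sum_j L2norm (fun i => weak_partial j (u i)) ^+ 2 =
      \int[mu]_x (\sum_j \sum_i weak_partial j (u i) x * weak_partial j (u i) x).
    rewrite RI_sum; last by move=> j; apply: intg_sum => i; exact: iw.
    by apply: eq_bigr => j _; rewrite (L2norm_sqr (weak_partial_VL2 j Hu)).
  have iS : intg (fun x => \sum_j \sum_i weak_partial j (u i) x * weak_partial j (u i) x).
    by do 2!(apply: intg_sum => ?); exact: iw.
  rewrite -(RI_Z 2 iS); apply: RI_le.
  - by apply: ip_intg; exact: weak_curl_VL2.
  - exact: intgZ.
  - by move=> x; exact: (curl_sqr_le (fun j i => weak_partial j (u i) x)).
apply: (le_trans E); rewrite exprMn /H1norm sqr_sqrtr; last first.
  by rewrite addr_ge0 ?sqr_ge0// sumr_ge0// => j _; exact: sqr_ge0.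
have S0 : 0 <= \sum_j L2norm (fun i => weak_partial j (u i)) ^+ 2 by apply: sumr_ge0 => j _; exact: sqr_ge0.
by apply: double_le => //; exact: sqr_ge0.
Qed.

(** [weak_partial] is a choice of representative and so is additive only almost everywhere; the curl
    of the difference is exchanged for the difference of the curls inside the norm. *)
Lemma curl_dist_le u d : (forall i, H1 (u i)) -> (forall i, H1 (d i)) ->
  `|L2norm (weak_curl u) - L2norm (weak_curl d)| <= 2 * H1norm (fun i x => u i x - d i x).
Proof.
move=> Hu Hd; have Hud i : H1 (fun x => u i x - d i x) by exact: H1B.
apply: le_trans (L2norm_dist (weak_curl_VL2 Hu) (weak_curl_VL2 Hd)) _.
apply: le_trans _ (L2norm_curl_le Hud); rewrite le_eqVlt; apply/orP; left; apply/eqP; symmetry.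
apply: ae_L2norm; last 1 first.
- move=> i; move: (weak_partialBE (i + 1) (Hu (i + 2)) (Hd (i + 2))) (weak_partialBE (i + 2) (Hu (i + 1)) (Hd (i + 1))).
  by apply: ae3S2 => x h1 h2; exact: (eq_trans (congr2 (fun y z => y - z) h1 h2) (subB_exchange _ _ _ _)).
- move=> i; apply: measurable_funB; apply: L2_mfun; exact: weak_curl_VL2.
- exact: weak_curl_VL2.
Qed.

Lemma norm_dist_le u d : (forall i, H1 (u i)) -> (forall i, H1 (d i)) ->
  `|L2norm u - L2norm d| <= H1norm (fun i x => u i x - d i x).
Proof.
move=> Hu Hd; apply: le_trans (L2norm_dist (H1_VL2 Hu) (H1_VL2 Hd)) _.
exact: L2norm_le_H1norm.
Qed.

Lemma int_sqr_le_norm u j : (forall i, H1 (u i)) -> \int[mu]_x (u j x ^+ 2) <= L2norm u ^+ 2.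
Proof.
move=> Hu; have iu i : intg (fun x => u i x * u i x) by apply: L2_mul; exact: H1_VL2.
rewrite (L2norm_sqr (H1_VL2 Hu)) /ip RI_sum//.
by apply: (@le_sum3 R (fun i => \int[mu]_x (u i x * u i x))) => k; exact: RI_sqr_ge0.
Qed.

Lemma cvg_sum3 (F : 'I_3 -> nat -> R) (l : 'I_3 -> R) : (forall k, F k n @[n --> \oo] --> l k) ->
  \sum_k F k n @[n --> \oo] --> \sum_k l k.
Proof.
move=> Fl; rewrite sum3; under eq_fun do rewrite sum3.
by apply: cvgD; [apply: cvgD|]; exact: Fl.
Qed.

Lemma is_derive_sum3 (F : 'I_3 -> R -> R) (dF : 'I_3 -> R) (t : R) :
  (forall k, is_derive t (1 : R) (F k) (dF k)) ->
  is_derive t (1 : R) (fun s => \sum_k F k s) (\sum_k dF k).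
Proof. by move=> FF; rewrite -fct_sumE; exact: is_derive_sum. Qed.

End norms.

(** * Growth of the vorticity norm *)

Section growth.
Variable R : realType.
Local Notation mu := (leb3 R).
Variables (T : \bar R) (v : R -> vfield R) (p : R -> R3 R -> R).
Hypothesis CH : continuous_H1 T v.
Hypothesis Cv : continuous_smooth T v.
Hypothesis NS : navier_stokes T v p.

Let w (t : R) : R := L2norm (weak_curl (v t)).

Let v_H1 (t : R) i : time_dom T t -> H1 (v t i).
Proof. by move=> ht; exact: (proj1 CH). Qed.

Lemma cvg_H1 (F : R -> R) (k t : R) : time_dom T t ->
  (forall s, time_dom T s -> `|F s - F t| <= k * H1norm (fun i x => v s i x - v t i x)) ->
  F s @[s --> within (time_dom T) (nbhs t)] --> F t.
Proof.
move=> ht FH; have H := proj2 CH t ht.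
have K : k * H1norm (fun i x => v s i x - v t i x) @[s --> within (time_dom T) (nbhs t)] --> (0 : R).
  by rewrite -(mulr0 k); apply: cvgMr.
apply/cvgrPdist_le => e e0.
have /cvgrPdist_le/(_ e e0) := K; rewrite !near_withinE; apply: filterS => s hs ds.
rewrite distrC; apply: le_trans (FH s ds) _; apply: le_trans (ler_norm _) _.
by rewrite -normrN -sub0r; exact: hs.
Qed.

Lemma vorticity_norm_cvg (t : R) : time_dom T t -> w s @[s --> within (time_dom T) (nbhs t)] --> w t.
Proof.
move=> ht; apply: (cvg_H1 (k := 2) ht) => s hs.
by apply: curl_dist_le => i; exact: v_H1.
Qed.

Lemma velocity_norm_cvg (t : R) : time_dom T t ->
  L2norm (v s) @[s --> within (time_dom T) (nbhs t)] --> L2norm (v t).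
Proof.
move=> ht; apply: (cvg_H1 (F := fun s => L2norm (v s)) (k := 1) ht) => s hs.
by rewrite mul1r; apply: norm_dist_le => i; exact: v_H1.
Qed.

Section interval.
Variables s t M : R.
Hypothesis s0 : 0 < s.
Hypothesis st : s < t.
Hypothesis tT : (t%:E < T)%E.
Hypothesis wM : forall q : R, s <= q <= t -> w q <= M.

Lemma interval_time_int (q : R) : q \in `[s, t] -> time_int T q.
Proof.
rewrite in_itv/= => /andP[sq qt]; split; first exact: lt_le_trans sq.
by apply: le_lt_trans tT; rewrite lee_fin.
Qed.

Let dom (q : R) : q \in `[s, t] -> time_dom T q.
Proof. by move=> /interval_time_int[q0 qT]; split => //; exact: ltW. Qed.

(** A continuous function on the compact interval attains its maximum. The size of [m] is
    immaterial, as it enters only the part of the estimate that carries the factor c = O(1/r). *)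
Lemma velocity_bounded : exists m : R, forall q : R, q \in `[s, t] -> L2norm (v q) <= m.
Proof.
have c : {within `[s, t], continuous (fun q => L2norm (v q))}.
  apply/subspace_continuousP => q qI; apply: cvg_trans (velocity_norm_cvg (dom qI)).
  by apply: cvg_app; apply: within_subset => r /= rI; exact: dom.
have [q _ hq] := @EVT_max R (fun q => L2norm (v q)) s t (ltW st) c.
by exists (L2norm (v q)).
Qed.

Let M0 : 0 <= M.
Proof. by apply: (le_trans (L2norm_ge0 _) (wM (q := s) _)); rewrite lexx ltW. Qed.

(** The coefficient of [c] in [static_bound], with its constant [K] written out. *)
Definition error_constant (m : R) : R := 216 * M ^+ 2 + 54 * (1 +
  32 * M ^+ 2 * (16 * m ^+ 2 * (3 * (2 * m ^+ 2 + 2 * M ^+ 2)) ^+ 3) * (2 * M ^+ 2) ^+ 4).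

Let G (r q : R) : R := \sum_a \sum_b \int[mu]_x (cutoff r x ^+ 4 * Om (v q) a b x ^+ 2).

(** By the mean value theorem in time, [static_bound] at one intermediate instant suffices; its
    bounds on the gradient come from [partial_le_enstrophy]. *)
Lemma localized_growth (r c m : R) : 0 < r -> 0 <= c <= 108^-1 ->
  (forall i x, `|partial i (cutoff r) x| <= c) ->
  (forall q : R, q \in `[s, t] -> L2norm (v q) <= m) ->
  G r t - G r s <= 2 * (432 * 216 ^+ 3 * M ^+ 6 + c * error_constant m) * (t - s).
Proof.
move=> r0 c01 dc vm.
pose dG (q : R) : R := \sum_a \sum_b 2 * \int[mu]_x (cutoff r x ^+ 4 * (Om (v q) a b x * Q (v q) a b x)).
have dGd (q : R) : q \in `[s, t] -> is_derive q (1 : R) (G r) (dG q).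
  move=> qI; apply: is_derive_sum3 => a; apply: is_derive_sum3 => b.
  exact: (energy_derivative Cv NS a b r0 (interval_time_int qI)).
have cG : {within `[s, t], continuous (G r)}.
  apply: continuous_in_subspaceT => q; rewrite inE/= => qI.
  by apply: differentiable_continuous; apply/derivable1_diffP; case: (dGd q qI).
have [q qI ->] := @MVT_segment R (G r) dG s t (ltW st) (fun q qI => dGd q (subset_itv_oo_cc qI)) cG.
apply: ler_wpM2r; first by rewrite subr_ge0 ltW.
have -> : dG q = 2 * \sum_a \sum_b \int[mu]_x (cutoff r x ^+ 4 * (Om (v q) a b x * Q (v q) a b x)).
  by rewrite /dG mulr_sumr; apply: eq_bigr => a _; rewrite mulr_sumr.
apply: ler_wpM2l => //.
have Cq i n : Ck n (v q i) by apply: (v_Ck Cv); exact: interval_time_int.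
have Hq i : H1 (v q i) by apply: v_H1; exact: dom.
have divq x : \sum_i partial i (v q i) x = 0.
  by case: NS => _ _ _ _; apply; exact: interval_time_int.
have wq : w q ^+ 2 <= M ^+ 2.
  by rewrite ler_sqr ?nnegrE ?L2norm_ge0//; apply: wM; move: qI; rewrite in_itv.
have Eq : 2 * w q ^+ 2 = enstrophy (v q) := curl_enstrophy Cq Hq.
apply: (static_bound Cq Hq divq r0 dc M0 c01).
- move=> a b; apply: le_trans (Om_le_enstrophy (v q) a b) _.
  by rewrite -Eq; exact: ler_wpM2l.
- move=> i j; apply: le_trans (partial_le_enstrophy Cq Hq divq i j) _.
  by rewrite -Eq mulKf.
- move=> j; apply: le_trans (int_sqr_le_norm j Hq) _.
  have v0 := L2norm_ge0 (v q); have vq := vm q qI.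
  by rewrite ler_sqr ?nnegrE// (le_trans v0).
Qed.

(** For r = n + 1 the localized sums tend to 2 w^2, and the error proportional to c tends to 0.
    Dividing by 2 leaves 432 216^3, written as half of 864 216^3 to fit [ode_bounds]. *)
Lemma vorticity_growth : w t ^+ 2 - w s ^+ 2 <= 864 * 216 ^+ 3 / 2 * (t - s) * M ^+ 6.
Proof.
have [C C0 HC] := cutoff_partial R.
have [m vm] := velocity_bounded.
have sI : s \in `[s, t] by rewrite in_itv/= lexx ltW.
have tI : t \in `[s, t] by rewrite in_itv/= lexx ltW.
have lim q : q \in `[s, t] -> G n.+1%:R q @[n --> \oo] --> 2 * w q ^+ 2.
  move=> qI.
  have Cq i n : Ck n (v q i) by apply: (v_Ck Cv); exact: interval_time_int.
  have Hq i : H1 (v q i) by apply: v_H1; exact: dom.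
  rewrite (curl_enstrophy Cq Hq).
  apply: (cvg_sum3 (F := fun a n => \sum_b \int[mu]_x (cutoff n.+1%:R x ^+ 4 * Om (v q) a b x ^+ 2))) => a.
  apply: (cvg_sum3 (F := fun b n => \int[mu]_x (cutoff n.+1%:R x ^+ 4 * Om (v q) a b x ^+ 2))) => b.
  by apply: cutoff_limit; exact: Om2_intg.
have L1 : G n.+1%:R t - G n.+1%:R s @[n --> \oo] --> 2 * w t ^+ 2 - 2 * w s ^+ 2.
  by apply: cvgB; exact: lim.
have L0 : C * n.+1%:R^-1 @[n --> \oo] --> (0 : R).
  by rewrite -(mulr0 C); apply: cvgMr; exact: cvg_harmonic.
have L2' : 2 * (432 * 216 ^+ 3 * M ^+ 6 + C * n.+1%:R^-1 * error_constant m) * (t - s) @[n --> \oo]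
    --> 2 * (432 * 216 ^+ 3 * M ^+ 6 + 0 * error_constant m) * (t - s).
  apply: cvgMl; apply: cvgMr; apply: cvgD; first exact: cvg_cst.
  by apply: cvgMl.
have N : \forall n \near \oo, G n.+1%:R t - G n.+1%:R s <=
    2 * (432 * 216 ^+ 3 * M ^+ 6 + C * n.+1%:R^-1 * error_constant m) * (t - s).
  (* [localized_growth] demands c <= 1/108; with c = C / (n + 1) this holds for all large n. *)
  have p108 : 0 < 108^-1 :> R by rewrite invr_gt0.
  have /cvgrPdist_le/(_ _ p108) := L0; apply: filterS => n.
  rewrite sub0r normrN => hn.
  apply: localized_growth => //; first by rewrite divr_ge0 ?(ltW C0)//= (le_trans (ler_norm _) hn).
  by move=> i x; exact: HC.
have : 2 * w t ^+ 2 - 2 * w s ^+ 2 <= 2 * (432 * 216 ^+ 3 * M ^+ 6 + 0 * error_constant m) * (t - s).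
  by apply: (@ler_cvg_to _ \oo _ R _ _ _ _ L1 L2' N).
rewrite mul0r addr0 -mulrBr -mulrA.
rewrite ler_pM2l// => h; apply: (le_trans h).
by rewrite le_eqVlt; apply/orP; left; apply/eqP; field.
Qed.

End interval.
End growth.

Theorem theorem3p2 (R : realType) :
  exists C0 : R, 1 < C0 /\
  forall (T : \bar R) (v0 : vfield R) (v : R -> vfield R),
    (0 < T)%E ->
    (forall i, H1 (v0 i)) ->
    {ae leb3 R, forall x, weak_div v0 x = 0} ->
    classical_solution T v0 v ->
    let a := L2norm (weak_curl v0) in
    let w := fun t : R => L2norm (weak_curl (v t)) in
    let W := fun gamma t : R =>
      gamma * \int[@lebesgue_measure R]_(s in `[0, t]) (w s ^+ 4) in
    let D := fun gamma t : R =>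
      1 + (gamma - C0) * a ^+ 4
          * \int[@lebesgue_measure R]_(tau in `[0, t]) expR (W gamma tau) in
    (forall gamma t : R, C0 <= gamma -> time_dom T t ->
       w t <= a * expR (W gamma t / 4) / D gamma t `^ (4^-1)) /\
    (forall gamma t : R, C0 <= gamma -> time_dom T t -> C0 * a ^+ 4 * t < 1 ->
       D gamma t <= ((1 - C0 * a ^+ 4 * t) `^ ((gamma - C0) / C0))^-1).
Proof.
have C1 : 1 < 864 * 216 ^+ 3 :> R by rewrite -!natrX -natrM ltr1n.
exists (864 * 216 ^+ 3); split; first exact: C1.
move=> T v0 v T0 Hv0 _ [CH Cv [p NS] ini].
have d0 : time_dom T 0 by split.
(* The datum agrees with [v 0] only almost everywhere, yet [ae_weak_partial] makes the two weak
   curls equal as functions. *)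
have E : weak_curl v0 = weak_curl (v 0).
  apply/funext => i; apply/funext => x; rewrite /weak_curl.
  have W j k : weak_partial j (v0 k) = weak_partial j (v 0 k).
    symmetry; apply: ae_weak_partial; last exact: ini.
      by apply: L2_mfun; case: (proj1 CH 0 k d0).
    by apply: L2_mfun; case: (Hv0 k).
  by rewrite !W.
rewrite E.
apply: (ode_bounds (w := fun t => L2norm (weak_curl (v t))) (lt_trans ltr01 C1)) => [t|t ht|s t M s0 st tT wM].
- exact: L2norm_ge0.
- exact: vorticity_norm_cvg CH t ht.
- exact: (vorticity_growth CH Cv NS s0 st tT wM).
Qed.
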